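(* Let $\Lambda$ be a finite-dimensional $k$-algebra of rank $2$ with complete set of primitive orthogonal idempotents $1=e_1+e_2$ and $e_2\Lambda e_1=0$ (equivalently $\Sigma(\Lambda)\in\mathsf{Fan}^{+-}_{\rm sc}(2)$). Then there exists a finite-dimensional $k$-algebra $\Gamma$ of rank $2$ (with a complete set of primitive orthogonal idempotents) such that $\Sigma(\Gamma)=\rho(\Sigma(\Lambda))$. Moreover, if $\Lambda$ is elementary, then $\Gamma$ can be taken to be elementary.
   Context: $k$ is a field; elementary means $\Lambda/J_\Lambda$ is a product of copies of $k$. The $g$-fan $\Sigma(\Lambda)$ consists of the cones $\operatorname{cone}\{[T_1],\dots,[T_m]\}$ for basic 2-term presilting complexes $T=\bigoplus T_i$ (indecomposable $T_i$) in $K^b(\operatorname{proj}\Lambda)$ (2-term: degrees $-1,0$; presilting: $\operatorname{Hom}(T,T[\ell])=0$ for $\ell>0$; $[T]=[T^0]-[T^{-1}]$), in $\mathbb{R}^2$ via $[e_1\Lambda]\mapsto(1,0)$, $[e_2\Lambda]\mapsto(0,1)$. $\mathsf{Fan}^{+-}_{\rm sc}(2)$: (possibly infinite) nonsingular fans in $\mathbb{R}^2$ containing $\sigma_+=\operatorname{cone}\{(1,0),(0,1)\}$, $-\sigma_+$ and $\sigma_{-+}=\operatorname{cone}\{(-1,0),(0,1)\}$, each cone lying in a closed coordinate quadrant, each ray in exactly two 2-dimensional cones, all maximal cones 2-dimensional. Rotation of fans: for $\Sigma\in\mathsf{Fan}^{+-}_{\rm sc}(2)$ let $\sigma=\operatorname{cone}\{(1,0),(\ell,-1)\}$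 be its 2-dimensional cone adjacent to $\sigma_+$ along $(1,0)$ ($\ell\ge0$). Let $\Sigma'$ be the fan with rays $(\Sigma_1\setminus\{\mathbb{R}_{\ge0}(0,1)\})\cup\{\mathbb{R}_{\ge0}(-\ell,1)\}$ and 2-dimensional cones $(\Sigma_2\setminus\{\sigma_+,\sigma_{-+}\})\cup\{-\sigma,\operatorname{cone}\{(-\ell,1),(1,0)\}\}$. Then $\rho(\Sigma)$ is the image of $\Sigma'$ under the linear map of $\mathbb{R}^2$ sending $(1,0)\mapsto(0,1)$ and $(\ell,-1)\mapsto(1,0)$. *)

(* Defs.v *)
From Stdlib Require Import Reals.
From HB Require Import structures.
From mathcomp Require Import all_boot all_order all_algebra.
From mathcomp Require Import falgebra.

Set Implicit Arguments.
Unset Strict Implicit.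
Unset Printing Implicit Defensive.

Import GRing.Theory.
Local Open Scope ring_scope.

Definition point := (R * R)%type.

Definition padd (x y : point) : point := (Rplus x.1 y.1, Rplus x.2 y.2).
Definition pscale (t : R) (x : point) : point := (Rmult t x.1, Rmult t x.2).
Definition pt_origin : point := (R0, R0).
Definition pdet (u v : point) : R := Rminus (Rmult u.1 v.2) (Rmult u.2 v.1).

Fixpoint cone_gen (vs : seq point) : point -> Prop :=
  match vs with
  | [::] => fun x => x = pt_origin
  | v :: vs' => fun x => exists (t : R) (y : point),
                  Rle R0 t /\ cone_gen vs' y /\ x = padd (pscale t v) y
  end.

Definition set_eq (C D : point -> Prop) := forall x, C x <-> D x.
Definition fan_eq (F G : (point -> Prop) -> Prop) :=
  forall C : point -> Prop, F C <-> G C.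

Definition is_ray (C : point -> Prop) :=
  exists v : point, v <> pt_origin /\ set_eq C (cone_gen [:: v]).
Definition is_twodim (C : point -> Prop) :=
  exists u v : point, C u /\ C v /\ pdet u v <> R0.

Definition sigma_plus := cone_gen [:: (R1, R0); (R0, R1)].
Definition sigma_mp := cone_gen [:: (Ropp R1, R0); (R0, R1)].

(* the cone cone{(1,0),(l,-1)} adjacent to sigma_+ along (1,0) *)
Definition adj_cone (l : nat) := cone_gen [:: (R1, R0); (INR l, Ropp R1)].

(* the linear map with (1,0) |-> (0,1), (l,-1) |-> (1,0):  (x,y) |-> (-y, x + l y) *)
Definition rho_map (l : nat) (x : point) : point :=
  (Ropp x.2, Rplus x.1 (Rmult (INR l) x.2)).

Definition image_cone (f : point -> point) (C : point -> Prop) : point -> Prop :=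
  fun x => exists y, C y /\ x = f y.

(* Sigma' : zero cone, rays (Sigma_1 minus R>=0(0,1)) plus R>=0(-l,1),
   2-dim cones (Sigma_2 minus {sigma_+, sigma_-+}) plus -sigma and
   cone{(-l,1),(1,0)}. *)
Definition rho_pre (l : nat) (F : (point -> Prop) -> Prop) (C : point -> Prop) :=
  set_eq C (cone_gen [::])
  \/ (F C /\ is_ray C /\ ~ set_eq C (cone_gen [:: (R0, R1)]))
  \/ set_eq C (cone_gen [:: (Ropp (INR l), R1)])
  \/ (F C /\ is_twodim C /\ ~ set_eq C sigma_plus /\ ~ set_eq C sigma_mp)
  \/ set_eq C (cone_gen [:: (Ropp R1, R0); (Ropp (INR l), R1)])
  \/ set_eq C (cone_gen [:: (Ropp (INR l), R1); (R1, R0)]).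

(* rho(Sigma), computed with the parameter l of the adjacent cone *)
Definition rho (l : nat) (F : (point -> Prop) -> Prop) (C : point -> Prop) :=
  exists C', rho_pre l F C' /\ set_eq C (image_cone (rho_map l) C').

Section Algebra.
Variables (k : fieldType) (A : falgType k).

Definition idempotent (x : A) := x * x = x.

Definition primitive_idem (x : A) :=
  idempotent x /\ x <> 0 /\
  forall a b : A, idempotent a -> idempotent b -> a * b = 0 -> b * a = 0 ->
    a + b = x -> a = 0 \/ b = 0.

Definition cpoi (e1 e2 : A) :=
  primitive_idem e1 /\ primitive_idem e2 /\ e1 * e2 = 0 /\ e2 * e1 = 0 /\
  e1 + e2 = 1.

(* rank 2: the two indecomposable projectives e1 A and e2 A are not isomorphic
   (Hom(e_j A, e_i A) = e_i A e_j via left multiplication) *)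
Definition rank2 (e1 e2 : A) :=
  ~ exists a b : A, a = e2 * a * e1 /\ b = e1 * b * e2 /\ b * a = e1 /\ a * b = e2.

Definition right_ideal (I : A -> Prop) :=
  I 0 /\ (forall x y, I x -> I y -> I (x + y)) /\ (forall x a, I x -> I (x * a)).

Definition maximal_right_ideal (I : A -> Prop) :=
  right_ideal I /\ ~ I 1 /\
  forall I' : A -> Prop, right_ideal I' -> (forall x, I x -> I' x) -> ~ I' 1 ->
    forall x, I' x -> I x.

Definition jacobson (x : A) := forall I, maximal_right_ideal I -> I x.

Definition kalg_morph (f : A -> k) :=
  (forall (a : k) (x y : A), f (a *: x + y) = a * f x + f y) /\
  (forall x y : A, f (x * y) = f x * f y) /\ f 1 = 1.

(* Lambda / J  is isomorphic (as k-algebra) to k x ... x k :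
   there is a surjective k-algebra map A -> k^n whose kernel is J. *)
Definition elementary :=
  exists (n : nat) (pi : 'I_n -> A -> k),
    (forall i, kalg_morph (pi i)) /\
    (forall c : 'I_n -> k, exists x : A, forall i, pi i x = c i) /\
    (forall x : A, jacobson x <-> forall i, pi i x = 0).

Variables (e1 e2 : A).

Definition idem (b : bool) : A := if b then e2 else e1.

(* a projective is a list of labels s, P_s = (+)_j e_{s_j} A; a morphism
   P_s -> P_t is a matrix M with M i j in e_{t_i} A e_{s_j} *)
Definition is_hom (s t : seq bool) (M : 'M[A]_(size t, size s)) :=
  forall i j, M i j = idem (nth false t i) * M i j * idem (nth false s j).

Definition idmx (s : seq bool) : 'M[A]_(size s, size s) :=
  \matrix_(i, j) (if i == j then idem (nth false s i) else 0).

(* 2-term complex  T^{-1} --d--> T^0 *)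
Record cx := Cx { cm1 : seq bool; c0 : seq bool; cd : 'M[A]_(size c0, size cm1) }.

Definition wf (T : cx) := is_hom (cd T).

Definition chain_map (T U : cx) (f1 : 'M[A]_(size (cm1 U), size (cm1 T)))
    (f0 : 'M[A]_(size (c0 U), size (c0 T))) :=
  is_hom f1 /\ is_hom f0 /\ f0 *m cd T = cd U *m f1.

Definition homotopic (T U : cx) (f1 g1 : 'M[A]_(size (cm1 U), size (cm1 T)))
    (f0 g0 : 'M[A]_(size (c0 U), size (c0 T))) :=
  exists h : 'M[A]_(size (cm1 U), size (c0 T)),
    is_hom h /\ f1 - g1 = h *m cd T /\ f0 - g0 = cd U *m h.

Definition cx_iso (T U : cx) :=
  exists f1 f0 g1 g0,
    @chain_map T U f1 f0 /\ @chain_map U T g1 g0 /\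
    @homotopic T T (g1 *m f1) (idmx (cm1 T)) (g0 *m f0) (idmx (c0 T)) /\
    @homotopic U U (f1 *m g1) (idmx (cm1 U)) (f0 *m g0) (idmx (c0 U)).

Definition zero_cx : cx := @Cx [::] [::] 0.

Definition dsum (T U : cx) : cx :=
  @Cx (cm1 T ++ cm1 U) (c0 T ++ c0 U)
    (castmx (esym (size_cat _ _), esym (size_cat _ _))
       (block_mx (cd T) 0 0 (cd U))).

Definition bigsum (Ts : seq cx) : cx := foldr dsum zero_cx Ts.

(* Hom(T, T[l]) = 0 for l > 0; for 2-term complexes only l = 1 is nontrivial:
   every f : T^{-1} -> T^0 is null-homotopic, f = d h1 + h0 d *)
Definition presilting (T : cx) :=
  forall f : 'M[A]_(size (c0 T), size (cm1 T)), is_hom f ->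
    exists (h1 : 'M[A]_(size (cm1 T), size (cm1 T)))
           (h0 : 'M[A]_(size (c0 T), size (c0 T))),
      is_hom h1 /\ is_hom h0 /\ f = cd T *m h1 + h0 *m cd T.

Definition indecomposable (T : cx) :=
  ~ cx_iso T zero_cx /\
  forall U V, wf U -> wf V -> cx_iso T (dsum U V) ->
    cx_iso U zero_cx \/ cx_iso V zero_cx.

Definition basic_presilting (Ts : seq cx) :=
  (forall i, (i < size Ts)%N ->
     wf (nth zero_cx Ts i) /\ indecomposable (nth zero_cx Ts i)) /\
  (forall i j, (i < size Ts)%N -> (j < size Ts)%N -> i <> j ->
     ~ cx_iso (nth zero_cx Ts i) (nth zero_cx Ts j)) /\
  presilting (bigsum Ts).

(* [T] = [T^0] - [T^{-1}],  [e1 A] |-> (1,0), [e2 A] |-> (0,1) *)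
Definition gvec (T : cx) : point :=
  (Rminus (INR (count negb (c0 T))) (INR (count negb (cm1 T))),
   Rminus (INR (count id (c0 T))) (INR (count id (cm1 T)))).

Definition gfan (C : point -> Prop) :=
  exists Ts : seq cx, basic_presilting Ts /\ set_eq C (cone_gen (map gvec Ts)).

End Algebra.

(* Main.v *)
(* Let M = e1 L e2 and let y_1, ..., y_n be a minimal family of generators of M
   as a left module over A = e1 L e1.  A 2-term complex (e2 L)^b -> (e1 L)^a is an
   a x b matrix over M; writing its entries in terms of the y_i lifts it to an
   a x nb matrix F over A.  If F is a split epimorphism, its kernel is a matrix N
   from A^c to A^(nb), with c = nb - a.  Now N is a 2-term complex over the
   triangular algebra G with f1 G f1 = {(s, b) | s y = y b}, a subalgebra of
   M_n(A) x e2 L e2, with f1 G f2 = A^n, f2 G f2 = A and f2 G f1 = 0.  The passage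
   from F to N is invertible and respects isomorphism, direct sums and the
   vanishing of Hom(T, U[1]); on g-vectors it sends (a, -b) to (b, a - nb), which
   is the linear map of the rotation.  If F is not a split epimorphism, then the
   radical part of F forces the g-vectors of a presilting family to be (1, 0) or
   (n, -1), the generators of the cone adjacent to the positive one; dually for
   complexes over G.

   Everything takes place in a matrix algebra over L with orthogonal idempotents
   p = e1, q = e2 and E, a sum of n copies of e1, and with x in E R q the column
   of the y_i. *)

(* The obstacle is that the lift [F] of [M] is not unique. Two lifts differ by a matrix killed by
   [x], whose rows are relations between the generators, and minimality says that relations have
   coefficients in the radical. Hence whether [F] splits depends on [M] only, and maps between the
   matrices [M] lift to maps between the lifts up to a defect that a section absorbs or that is
   harmless modulo the radical. The kernel of [F] is again a matrix because idempotent matrices over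
   a local corner split off free summands. The condition [e2 L e1 = 0] acts in two quadrants. In the
   second it makes every differential zero; in the fourth it makes homotopies vanish, so that
   isomorphism in the homotopy category becomes equivalence of matrices. The constant [l] of the
   rotation is the number [n] of generators: the column of the [y_i], read as a complex from [e2 L]
   to [n] copies of [e1 L], spans the adjacent cone together with [e1 L] in degree 0. *)
Require Import Defs.
From Stdlib Require Import Reals Lra Classical Setoid Morphisms.
From HB Require Import structures.
From mathcomp Require Import all_boot all_order all_algebra.
From mathcomp Require Import falgebra.

Set Implicit Arguments.
Unset Strict Implicit.
Unset Printing Implicit Defensive.

Import GRing.Theory.
Local Open Scope ring_scope.

(** * Corners and local idempotents *)

Section Corner.
Variable R : nzRingType.
Implicit Types e f g p q z y s : R.

Definition corner e f z := e * z = z /\ z * f = z.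

Definition corner_unit e z := exists y, corner e e y /\ z * y = e /\ y * z = e.

(** For an idempotent [e] this is localness of the ring [e R e], stated inside [R] so that the
    corner is never formed as a ring of its own. *)
Definition local_idem e :=
  e * e = e /\ e <> 0 /\
  forall z, corner e e z -> corner_unit e z \/ corner_unit e (e - z).

Lemma corner_sand e f z : e * e = e -> f * f = f -> corner e f (e * z * f).
Proof. by move=> ee ff; split; rewrite ?mulrA ?ee // -mulrA ff. Qed.

Lemma corner_eq e f z : corner e f z -> e * z * f = z.
Proof. by case=> -> ->. Qed.

Lemma corner_mul e f g z y : corner e f z -> corner f g y -> corner e g (z * y).
Proof. by move=> [a b] [c d]; split; rewrite ?mulrA ?a // -mulrA d. Qed.

Lemma corner_add e f z y : corner e f z -> corner e f y -> corner e f (z + y).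
Proof. by move=> [a b] [c d]; split; rewrite ?mulrDl ?mulrDr ?a ?b ?c ?d. Qed.

Lemma corner_opp e f z : corner e f z -> corner e f (- z).
Proof. by move=> [a b]; split; rewrite ?mulNr ?mulrN ?a ?b. Qed.

Lemma corner0 e f : corner e f 0.
Proof. by split; rewrite ?mulr0 ?mul0r. Qed.

Lemma corner_id e : e * e = e -> corner e e e.
Proof. by []. Qed.

Lemma corner_sum (I : finType) (P : pred I) e f (F : I -> R) :
  (forall i, P i -> corner e f (F i)) -> corner e f (\sum_(i | P i) F i).
Proof.
move=> h; apply: (big_ind (corner e f)) => //; first exact: corner0.
exact: corner_add.
Qed.

Variable p : R.
Hypothesis pl : local_idem p.

Let pp : p * p = p := pl.1.
Let p0 : p <> 0 := pl.2.1.

Lemma corner_unit_id : corner_unit p p.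
Proof. by exists p. Qed.

Lemma corner_unit0 : ~ corner_unit p 0.
Proof. by case=> y [_ [h _]]; apply: p0; rewrite -h mul0r. Qed.

(* A local corner is Dedekind finite: [s * z] is a nonzero idempotent. *)
Lemma corner_unit_linv z s : corner p p z -> corner p p s -> z * s = p ->
  s * z = p.
Proof.
move=> cz cs zs; set t := s * z.
have ct : corner p p t by apply: corner_mul cs cz.
have tt : t * t = t by rewrite /t mulrA -(mulrA s z s) zs cs.2.
have [[y [cy [ty yt]]]|[y [cy [ty yt]]]] := pl.2.2 t ct.
  by rewrite -ct.1 -yt -mulrA tt.
have : t = 0.
  by rewrite -ct.2 -ty mulrA mulrBr tt ct.2 subrr mul0r.
(* [p = p * p = z * (s * z) * s], which is zero once [t] is. *)
move=> t0; case: p0; rewrite -pp -{1}zs -{1}zs.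
by rewrite mulrA -(mulrA z s z) -/t t0 mulr0 mul0r.
Qed.

Lemma corner_unit_rinv z s : corner p p z -> corner p p s -> z * s = p ->
  corner_unit p z /\ corner_unit p s.
Proof.
by move=> cz cs zs; have sz := corner_unit_linv cz cs zs; split; [exists s | exists z].
Qed.

(** A factor of a unit has a one-sided inverse, and in a local corner a one-sided inverse is
    two-sided. *)
Lemma corner_unit_mul z y : corner p p z -> corner p p y ->
  corner_unit p (z * y) <-> corner_unit p z /\ corner_unit p y.
Proof.
move=> cz cy; split=> [[s [cs [h1 h2]]]|[[s [cs [h1 h2]]] [t [ct [h3 h4]]]]].
  split.
    by apply: (corner_unit_rinv cz (corner_mul cy cs) _).1; rewrite mulrA.
  by apply: (corner_unit_rinv (corner_mul cs cz) cy _).2; rewrite -mulrA.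
exists (t * s); split; first exact: corner_mul ct cs.
by rewrite mulrA -(mulrA z) h3 cz.2 h1 mulrA -(mulrA t) h2 ct.2 h4.
Qed.

(** Multiplying by the inverse of the sum gives two elements with sum [p], where localness applies.
    Together with [corner_unit_mul] this makes the nonunits of the corner a two-sided ideal, its
    radical. *)
Lemma corner_unit_add z y : corner p p z -> corner p p y ->
  corner_unit p (z + y) -> corner_unit p z \/ corner_unit p y.
Proof.
move=> cz cy [u [cu [h1 h2]]].
have czu := corner_mul cz cu; have cyu := corner_mul cy cu.
have E : p - z * u = y * u by rewrite -h1 mulrDl addrAC subrr add0r.
have [h|h] := pl.2.2 _ czu; [left|right].
  exact: ((corner_unit_mul cz cu).1 h).1.
by move: h; rewrite E => h; exact: ((corner_unit_mul cy cu).1 h).1.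
Qed.

Lemma corner_unit_sum (I : finType) (F : I -> R) :
  (forall i, corner p p (F i)) -> corner_unit p (\sum_i F i) ->
  exists i, corner_unit p (F i).
Proof.
move=> cF.
(* The induction also has to carry that partial sums lie in the corner, since [corner_unit_add] asks
   for it. *)
suff : corner p p (\sum_i F i) /\ (corner_unit p (\sum_i F i) ->
   exists i, corner_unit p (F i)) by case.
apply: (big_ind (fun x => corner p p x /\ (corner_unit p x ->
   exists i, corner_unit p (F i)))).
- by split; [exact: corner0 | move/corner_unit0].
- move=> x y [cx hx] [cy hy]; split; first exact: corner_add.
  by move=> /(corner_unit_add cx cy) [].
- by move=> i _; split=> // h; exists i.
Qed.

Lemma corner_unitN z : corner_unit p z -> corner_unit p (- z).
Proof.
case=> y [cy [h1 h2]]; exists (- y); split; first exact: corner_opp.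
by rewrite !mulrNN.
Qed.

End Corner.

(** * Fitting's lemma and primitive idempotents *)

Section Fitting.
Variables (k : fieldType) (A : falgType k).

Lemma power_dependence (z : A) : exists n (c : 'I_n -> k) (i : 'I_n),
  c i != 0 /\ \sum_(j < n) c j *: z ^+ j = 0.
Proof.
set n := (dim A).+1; exists n.
pose X := [tuple z ^+ i | i < n].
have nf : ~~ free X.
  apply/negP; rewrite /free size_tuple => /eqP h.
  by have := dimvS (subvf <<X>>%VS); rewrite dimvf h ltnn.
have := nf; move/negP => H.
apply: NNPP => nex; apply: H; apply/freeP => c hc i.
apply/eqP/negPn/negP => ci; apply: nex; exists c, i; split=> //.
by rewrite -[RHS]hc; apply: eq_bigr => j _; rewrite (nth_map j) ?size_enum_ord // nth_ord_enum.
Qed.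

(** In a linear relation between the powers of [z], the lowest power with a nonzero coefficient is a
    combination of higher ones. The resulting [w] is a polynomial in [z], hence commutes with it. *)
Lemma fitting_power (z : A) : exists m (w : A),
  z * w = w * z /\ z ^+ m = z ^+ m.+1 * w.
Proof.
have [n [c [i0 [ci0 hc]]]] := power_dependence z.
have ex : exists i, [exists j : 'I_n, (val j == i) && (c j != 0)].
  by exists (val i0); apply/existsP; exists i0; rewrite eqxx.
have [m /existsP [j /andP [/eqP jm cj]] mmin] := ex_minnP ex.
exists m, (- (c j)^-1 *: \sum_(i < n | (i > m)%N) c i *: z ^+ (i - m.+1)); split.
  rewrite -scalerAr -scalerAl; congr (_ *: _).
  rewrite mulr_sumr mulr_suml; apply: eq_bigr => i _.
  by rewrite -scalerAr -scalerAl -exprS exprSr.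
rewrite -scalerAr mulr_sumr.
have -> : \sum_(i < n | (m < i)%N) z ^+ m.+1 * (c i *: z ^+ (i - m.+1))
    = \sum_(i < n | (m < i)%N) c i *: z ^+ i.
  by apply: eq_bigr => i mi; rewrite -scalerAr -exprD subnKC.
move: hc; rewrite (bigID (fun i : 'I_n => (m < i)%N)) /= => /eqP.
rewrite addr_eq0 => /eqP ->; rewrite (bigD1 j) /=; last by rewrite jm ltnn.
rewrite big1 ?addr0 => [|i /andP [im ij]].
  by rewrite scalerN scaleNr opprK scalerA mulVf // scale1r jm.
rewrite -leqNgt in im.
case: (eqVneq (c i) 0) => [->|ci]; first by rewrite scale0r.
have /mmin : [exists l : 'I_n, (val l == i) && (c l != 0)].
  by apply/existsP; exists i; rewrite eqxx ci.
rewrite leq_eqVlt => /orP [/eqP h|]; first by case/eqP: ij; apply: val_inj; rewrite /= jm.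
by rewrite ltnNge im.
Qed.

(** Fitting's decomposition: with [y = z * w] and [z ^+ m = z ^+ m * y], the power [q = y ^+ m] is
    an idempotent of the corner, so it is [0] or [e]. In the first case [z ^+ m = z ^+ m * q]
    vanishes; in the second [z] divides [e] on both sides. *)
Lemma corner_nilp_or_unit (e z : A) : primitive_idem e -> corner e e z ->
  (exists m, z ^+ m = 0) \/ corner_unit e z.
Proof.
move=> [ee [e0 prim]] [ez ze].
have [m0 [w [zw hm0]]] := fitting_power z.
pose y := z * w.
have ey : e * y = y by rewrite /y mulrA ez.
have ye : y * e = y by rewrite /y zw -mulrA ze.
have czw m : GRing.comm (z ^+ m) w by apply/commr_sym/commrX; rewrite /GRing.comm zw.
have cc i j : z ^+ i * w ^+ j = w ^+ j * z ^+ i by apply: commrX.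
have zm : z ^+ m0.+1 = z ^+ m0.+1 * y by rewrite /y mulrA -exprSr exprS {1}hm0 mulrA -exprS.
(* The exponent is [m0.+1] and not [m0] so that it is positive: [y ^+ m] then lies in the corner,
   and one factor [z] can be split off. *)
set m := m0.+1 in zm.
have zmi i : z ^+ m = z ^+ m * y ^+ i.
  by elim: i => [|i ih]; rewrite ?expr0 ?mulr1 // exprS mulrA -zm -ih.
have yX i : y ^+ i = z ^+ i * w ^+ i by rewrite /y exprMn_comm.
pose q := y ^+ m.
have qq : q * q = q.
  by rewrite {1}/q yX cc -mulrA -zmi -cc -yX.
have eq_ : e * q = q by rewrite /q exprS mulrA ey.
have qe_ : q * e = q by rewrite /q exprSr -mulrA ye.
have [q0|q1] : q = 0 \/ e - q = 0.
  apply: prim => //.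
  - by rewrite /Defs.idempotent mulrBl !mulrBr ee eq_ qe_ qq subrr subr0.
  - by rewrite mulrBr qe_ qq subrr.
  - by rewrite mulrBl eq_ qq subrr.
  - by rewrite addrC subrK.
- by left; exists m; rewrite (zmi m) -/q q0 mulr0.
right; move/eqP: q1; rewrite subr_eq0 => /eqP q1.
have E1 : z * (z ^+ m0 * w ^+ m) = e by rewrite mulrA -exprS -yX -/q -q1.
have E2 : (z ^+ m0 * w ^+ m) * z = e.
  by rewrite cc -mulrA -exprSr -cc -yX -/q -q1.
(* [w] need not lie in the corner, so the inverse is cut down by [e]. *)
set S := z ^+ m0 * w ^+ m in E1 E2; exists (e * S * e); split; first exact: corner_sand.
by split; [rewrite mulrA (mulrA z e) ze E1 ee | rewrite -(mulrA _ e) ez -mulrA E2 ee].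
Qed.

(** Only the nilpotent case of Fitting's alternative needs work: there the geometric series [S]
    inverts [1 - z], and [e * S * e] inverts [e - z]. *)
Lemma primitive_local (e : A) : primitive_idem e -> local_idem e.
Proof.
move=> pe; have [ee [e0 _]] := pe; split=> //; split=> // z cz.
have [[m zm]|] := corner_nilp_or_unit pe cz; last by left.
right; have [ez ze] := cz.
pose S := \sum_(i < m) z ^+ i.
have S1 : (1 - z) * S = 1.
  by have := subrX1 z m; rewrite zm sub0r => h; rewrite -opprB mulNr -h opprK.
have zS : z * S = S * z.
  by rewrite /S mulr_sumr mulr_suml; apply: eq_bigr => i _; rewrite -exprS exprSr.
have S2 : S * (1 - z) = 1 by rewrite mulrBr mulr1 -zS -{1}(mul1r S) -mulrBl.
have el : e - z = e * (1 - z) by rewrite mulrBr mulr1 ez.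
have er : e - z = (1 - z) * e by rewrite mulrBl mul1r ze.
have ec : e * (e - z) = e - z by rewrite mulrBr ee ez.
have ce : (e - z) * e = e - z by rewrite mulrBl ee ze.
exists (e * S * e); split; first exact: corner_sand.
split; first by rewrite mulrA (mulrA _ e S) ce el -(mulrA e) S1 mulr1 ee.
by rewrite -(mulrA _ e) ec er mulrA -(mulrA e S) S2 mulr1 ee.
Qed.

End Fitting.

(** * Matrices over a local corner *)

Section MatrixHom.
Variable R : nzRingType.

(* With idempotents [e] and [f], the morphisms from the object [f] to the
   object [e] in the Karoubi envelope of matrices over [R]. *)
Definition mhom m n (e : 'M[R]_m) (f : 'M[R]_n) (M : 'M[R]_(m, n)) :=
  e *m M = M /\ M *m f = M.

Lemma mhom_mul m n l (e : 'M[R]_m) (f : 'M[R]_n) (g : 'M[R]_l) M N :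
  mhom e f M -> mhom f g N -> mhom e g (M *m N).
Proof. by move=> [a b] [c d]; split; rewrite ?mulmxA ?a // -mulmxA d. Qed.

Lemma mhom_add m n (e : 'M[R]_m) (f : 'M[R]_n) M N :
  mhom e f M -> mhom e f N -> mhom e f (M + N).
Proof. by move=> [a b] [c d]; split; rewrite ?mulmxDl ?mulmxDr ?a ?b ?c ?d. Qed.

Lemma mhom_opp m n (e : 'M[R]_m) (f : 'M[R]_n) M : mhom e f M -> mhom e f (- M).
Proof. by move=> [a b]; split; rewrite ?mulmxN ?mulNmx ?a ?b. Qed.

Lemma mhom_sub m n (e : 'M[R]_m) (f : 'M[R]_n) M N :
  mhom e f M -> mhom e f N -> mhom e f (M - N).
Proof. by move=> h1 h2; apply: mhom_add => //; apply: mhom_opp. Qed.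

Lemma mhom0 m n (e : 'M[R]_m) (f : 'M[R]_n) : mhom e f 0.
Proof. by split; rewrite ?mulmx0 ?mul0mx. Qed.

Lemma mhom_scalarP m n (p q : R) (M : 'M[R]_(m, n)) :
  mhom p%:M q%:M M <-> forall i j, corner p q (M i j).
Proof.
have r (N : 'M[R]_(m,n)) i j : (N *m q%:M) i j = N i j * q.
  rewrite mxE (bigD1 j) //= big1 ?addr0 ?mxE ?eqxx ?mulr1n // => l /negPf lj.
  by rewrite mxE lj mulr0n mulr0.
split=> [[a b] i j|h].
  by split; [rewrite -{2}a mul_scalar_mx mxE | rewrite -{2}b r].
by split; apply/matrixP=> i j; rewrite ?mul_scalar_mx ?r ?mxE; case: (h i j).
Qed.

Lemma mulmx_scalar m n (M : 'M[R]_(m, n)) (q : R) i j :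
  (M *m q%:M) i j = M i j * q.
Proof.
rewrite mxE (bigD1 j) //= big1 ?addr0 ?mxE ?eqxx ?mulr1n // => l /negPf lj.
by rewrite mxE lj mulr0n mulr0.
Qed.

Lemma scalar_mulr_col m1 m2 n (p : R) (A : 'M[R]_(m1, n)) (B : 'M[R]_(m2, n)) :
  p%:M *m col_mx A B = col_mx (p%:M *m A) (p%:M *m B).
Proof. by rewrite !mul_scalar_mx scale_col_mx. Qed.

Lemma scalar_mull_row m n1 n2 (p : R) (A : 'M[R]_(m, n1)) (B : 'M[R]_(m, n2)) :
  row_mx A B *m p%:M = row_mx (A *m p%:M) (B *m p%:M).
Proof. by rewrite scalar_mx_block mul_row_block !mulmx0 addr0 add0r. Qed.

Lemma mhom_col m1 m2 n (p : R) (f : 'M[R]_n) (A : 'M[R]_(m1, n)) (B : 'M[R]_(m2, n)) :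
  mhom p%:M f A -> mhom p%:M f B -> mhom p%:M f (col_mx A B).
Proof. by move=> [a b] [c d]; split; rewrite ?scalar_mulr_col ?mul_col_mx ?a ?b ?c ?d. Qed.

Lemma mhom_row m n1 n2 (p : R) (e : 'M[R]_m) (A : 'M[R]_(m, n1)) (B : 'M[R]_(m, n2)) :
  mhom e p%:M A -> mhom e p%:M B -> mhom e p%:M (row_mx A B).
Proof. by move=> [a b] [c d]; split; rewrite ?scalar_mull_row ?mul_mx_row ?a ?b ?c ?d. Qed.

Lemma mhom_colK m1 m2 n (p : R) (f : 'M[R]_n) (A : 'M[R]_(m1, n)) (B : 'M[R]_(m2, n)) :
  mhom p%:M f (col_mx A B) -> mhom p%:M f A /\ mhom p%:M f B.
Proof.
by case; rewrite scalar_mulr_col mul_col_mx => /eq_col_mx [a c] /eq_col_mx [b d].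
Qed.

Lemma mhom_rowK m n1 n2 (p : R) (e : 'M[R]_m) (A : 'M[R]_(m, n1)) (B : 'M[R]_(m, n2)) :
  mhom e p%:M (row_mx A B) -> mhom e p%:M A /\ mhom e p%:M B.
Proof.
by case; rewrite scalar_mull_row mul_mx_row => /eq_row_mx [a c] /eq_row_mx [b d].
Qed.

Lemma mhom_scalar_id n (p : R) : p * p = p -> mhom p%:M p%:M (p%:M : 'M[R]_n).
Proof. by move=> pp; split; rewrite -scalar_mxM pp. Qed.

End MatrixHom.

(** * Matrices modulo the radical of a local corner *)

Section LocalMatrix.
Variables (R : nzRingType) (p : R).
Hypothesis pl : local_idem p.

Let pp : p * p = p := pl.1.
Local Notation "1p" := (p%:M) (at level 0).
Local Notation phom := (mhom 1p 1p).

Lemma phom_id n : phom (1p : 'M[R]_n).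
Proof. exact: mhom_scalar_id. Qed.
Hint Resolve phom_id : core.

(** For matrices over the corner this is the radical, which over a local ring can be read off
    entrywise. *)
Definition nonunit_mx m n (M : 'M[R]_(m, n)) := forall i j, ~ corner_unit p (M i j).

Lemma rad0 m n : nonunit_mx (0 : 'M[R]_(m, n)).
Proof. by move=> i j; rewrite mxE; apply: corner_unit0. Qed.

Lemma rad_opp m n (M : 'M[R]_(m, n)) : nonunit_mx M -> nonunit_mx (- M).
Proof. by move=> h i j; rewrite mxE => /corner_unitN; rewrite opprK; apply: h. Qed.

Lemma rad_add m n (M N : 'M[R]_(m, n)) : phom M -> phom N ->
  nonunit_mx M -> nonunit_mx N -> nonunit_mx (M + N).
Proof.
move=> /mhom_scalarP cM /mhom_scalarP cN h1 h2 i j; rewrite mxE.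
by move=> /(corner_unit_add pl (cM i j) (cN i j)) [/h1|/h2].
Qed.

Lemma rad_mull m n l (A : 'M[R]_(m, n)) (M : 'M[R]_(n, l)) : phom A -> phom M ->
  nonunit_mx M -> nonunit_mx (A *m M).
Proof.
move=> /mhom_scalarP cA /mhom_scalarP cM h i j; rewrite mxE.
case/(corner_unit_sum pl) => [r|r]; first exact: corner_mul (cA i r) (cM r j).
by case/(corner_unit_mul pl (cA i r) (cM r j)) => _ /h.
Qed.

Lemma rad_mulr m n l (M : 'M[R]_(m, n)) (A : 'M[R]_(n, l)) : phom M -> phom A ->
  nonunit_mx M -> nonunit_mx (M *m A).
Proof.
move=> /mhom_scalarP cM /mhom_scalarP cA h i j; rewrite mxE.
case/(corner_unit_sum pl) => [r|r]; first exact: corner_mul (cM i r) (cA r j).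
by case/(corner_unit_mul pl (cM i r) (cA r j)) => /h.
Qed.

(** Congruence modulo the radical. Membership of both sides in the corner is built in, so that
    congruences can be chained and multiplied. *)
Definition req m n (M N : 'M[R]_(m, n)) := [/\ phom M, phom N & nonunit_mx (M - N)].

Lemma req_refl m n (M : 'M[R]_(m, n)) : phom M -> req M M.
Proof. by move=> h; split=> //; rewrite subrr; apply: rad0. Qed.

Lemma req_sym m n (M N : 'M[R]_(m, n)) : req M N -> req N M.
Proof. by case=> a b c; split=> //; rewrite -opprB; apply: rad_opp. Qed.

Lemma req_trans m n (M N P : 'M[R]_(m, n)) : req M N -> req N P -> req M P.
Proof.
move=> [a b c] [_ d e]; split=> //.
have -> : M - P = (M - N) + (N - P) by rewrite addrA subrK.
by apply: rad_add => //; apply: mhom_sub.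
Qed.

Lemma req_mul m n l (M M' : 'M[R]_(m, n)) (N N' : 'M[R]_(n, l)) :
  req M M' -> req N N' -> req (M *m N) (M' *m N').
Proof.
move=> [a b c] [a' b' c']; split; [exact: mhom_mul a a'|exact: mhom_mul b b'|].
have -> : M *m N - M' *m N' = M *m (N - N') + (M - M') *m N'.
  by rewrite mulmxBr mulmxBl addrA subrK.
apply: rad_add.
- by apply: mhom_mul a _; apply: mhom_sub.
- by apply: mhom_mul b'; apply: mhom_sub.
- by apply: rad_mull => //; apply: mhom_sub.
- by apply: rad_mulr => //; apply: mhom_sub.
Qed.

Lemma rad_unit1 (M : 'M[R]_1) : phom M -> corner_unit p (M 0 0) ->
  exists N : 'M[R]_1, [/\ phom N, M *m N = 1p & N *m M = 1p].
Proof.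
move=> hM [y [cy [h1 h2]]]; exists y%:M; split.
- by apply/mhom_scalarP => i j; rewrite !ord1 mxE.
- by apply/matrixP=> i j; rewrite !ord1 mulmx_scalar h1 !mxE eqxx mulr1n.
- by apply/matrixP=> i j; rewrite !ord1 mul_scalar_mx !mxE h2 eqxx mulr1n.
Qed.

(** Elimination: the upper left entry is a unit, and the Schur complement [d - c *m a' *m b] is
    again congruent to the identity because [c] is radical. *)
Lemma one_add_rad_rinv n (K : 'M[R]_n) : req K 1p ->
  exists W : 'M[R]_n, phom W /\ K *m W = 1p.
Proof.
elim: n K => [|n IH] K [hK _ rK].
  by exists 0; split; [exact: mhom0 | apply/matrixP; case].
rewrite -[n.+1]/(1 + n)%N in K hK rK *.
move: hK rK; rewrite -(submxK K).
set a := ulsubmx K; set b := ursubmx K; set c := dlsubmx K; set d := drsubmx K.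
clearbody a b c d => hK rK.
have hKb := hK; rewrite /block_mx in hKb.
have [/mhom_rowK [ha hb] /mhom_rowK [hc hd]] := mhom_colK hKb.
have rK' i j : ~ corner_unit p (block_mx (a - p%:M) b c (d - p%:M) i j).
  by have := rK i j; rewrite scalar_mx_block opp_block_mx add_block_mx !subr0.
have ra : nonunit_mx (a - 1p).
  by move=> i j; have := rK' (lshift n i) (lshift n j); rewrite block_mxEul.
have rc : nonunit_mx c.
  by move=> i j; have := rK' (rshift 1 i) (lshift n j); rewrite block_mxEdl.
have rd : nonunit_mx (d - 1p).
  by move=> i j; have := rK' (rshift 1 i) (rshift 1 j); rewrite block_mxEdr.
have ua : corner_unit p (a 0 0).
  have ca : corner p p (a 0 0) by move/mhom_scalarP: ha.
  case: (pl.2.2 _ ca) => // h; case: (ra 0 0).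
  by rewrite !mxE /= -opprB; apply: corner_unitN.
have [a' [ha' aa' a'a]] := rad_unit1 ha ua.
have hcab : phom (c *m a' *m b) by apply: mhom_mul hb; apply: mhom_mul hc ha'.
have [W [hW SW]] : exists W : 'M[R]_n, phom W /\ (d - c *m a' *m b) *m W = 1p.
  apply: IH; split=> //; first exact: mhom_sub.
  rewrite addrAC; apply: rad_add => //; try exact: mhom_sub; try exact: mhom_opp.
  apply: rad_opp; rewrite -mulmxA; apply: rad_mulr => //; exact: mhom_mul ha' hb.
have hWc : phom (W *m c *m a') by apply: mhom_mul ha'; apply: mhom_mul hW hc.
have hab : phom (a' *m b) by apply: mhom_mul hb.
(* The usual block inverse, with [W] the right inverse of the Schur complement. *)
exists (block_mx (a' + a' *m b *m (W *m c *m a')) (- (a' *m b *m W))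
   (- (W *m c *m a')) W); split.
  apply: mhom_col; apply: mhom_row; try exact: mhom_opp.
  - by apply: mhom_add => //; apply: mhom_mul hab hWc.
  - by apply: mhom_opp; apply: mhom_mul hab hW.
  - by [].
rewrite mulmx_block scalar_mx_block; congr block_mx.
- by rewrite mulmxDr !mulmxA aa' mulmxN hb.1 !mulmxA addrK.
- by rewrite mulmxN !mulmxA aa' hb.1 addNr.
- transitivity (c *m a' - (d - c *m a' *m b) *m W *m (c *m a')).
    by rewrite !mulmxBl opprB mulmxDr mulmxN !mulmxA addrA.
  by rewrite SW mulmxA hc.1 subrr.
- by rewrite mulmxN -SW mulmxBl !mulmxA addrC.
Qed.

End LocalMatrix.

(** * Free objects, their ranks and their direct summands *)

Section FreeObjects.
Variables (R : nzRingType) (p : R).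
Hypothesis pl : local_idem p.

Let pp : p * p = p := pl.1.
Local Notation "1p" := (p%:M) (at level 0).
Local Notation phom := (mhom 1p 1p).
Local Notation req := (@req R p _ _).
Local Notation nonunit_mx := (@nonunit_mx R p _ _).

Let phom1 n : phom (1p : 'M[R]_n) := phom_id pl n.
Hint Resolve phom1 : core.

(** The right inverse [W] is itself congruent to the identity, so it has a right inverse too, which
    can only be [K]. *)
Lemma one_add_rad_inv n (K : 'M[R]_n) : req K 1p ->
  exists W : 'M[R]_n, [/\ req W 1p, K *m W = 1p & W *m K = 1p].
Proof.
move=> hK; have [W [hW KW]] := one_add_rad_rinv pl hK.
have rW : req W 1p.
  apply: req_sym; rewrite -{1}KW -{2}hW.1.
  exact: (req_mul pl hK (req_refl pl hW)).
have [V [hV WV]] := one_add_rad_rinv pl rW.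
exists W; split=> //.
have [[_ hK1] _ _] := hK.
by have -> : K = V; [rewrite -hK1 -WV mulmxA KW hV.1 | rewrite WV].
Qed.

(** Rank factorization over the residue division ring, without forming that ring: the factorization
    holds modulo the radical, while the one-sided inverses [L] and [U] are exact. Rows are added one
    at a time. *)
Lemma rank_factor m n (F : 'M[R]_(m, n)) : phom F ->
  exists r (I0 : 'M[R]_(m, r)) (P0 : 'M[R]_(r, n)) (L : 'M[R]_(r, m)) (U : 'M[R]_(n, r)),
    [/\ phom I0, phom P0, phom L & phom U] /\
    [/\ L *m I0 = 1p, P0 *m U = 1p & req F (I0 *m P0)].
Proof.
elim: m F => [|m IH] F hF.
  exists 0, 0, 0, 0, 0; split; first by split; exact: mhom0.
  split; try by apply/matrixP; case.
  by rewrite mul0mx; split=> //; [exact: mhom0 | case].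
rewrite -[m.+1]/(1 + m)%N in F hF *.
move: hF; rewrite -(vsubmxK F); move: (usubmx F) (dsubmx F) => w G hF.
have [hw hG] := mhom_colK hF.
have [r [I0 [P0 [L [U [[hI hP hL hU] [LI PU [_ hIP rG]]]]]]]] := IH G hG.
(* The new row reduced by the earlier ones, so that [w' *m U = 0]. The rank grows exactly when a
   unit entry is left. *)
have [w' Ew'] : exists w', w' = w - w *m U *m P0 by exists (w - w *m U *m P0).
have hwU := mhom_mul hw hU.
have hw' : phom w' by rewrite Ew'; apply: mhom_sub => //; apply: mhom_mul hwU hP.
have w'U : w' *m U = 0.
  by rewrite Ew' mulmxBl -!mulmxA PU (mulmxA w) hwU.2 subrr.
case: (classic (exists j, corner_unit p (w' 0 j))) => [[j uj]|nuj].
  have hd : phom (p *: delta_mx j 0 : 'M[R]_(n, 1)).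
    apply/mhom_scalarP => i l; rewrite !mxE; case: andb; rewrite ?mulr1 ?mulr0 //.
    exact: corner0.
  have [v [hv wv _]] : exists v : 'M[R]_1, [/\ phom v,
      (w' *m (p *: delta_mx j 0)) *m v = 1p & v *m (w' *m (p *: delta_mx j 0)) = 1p].
    apply: rad_unit1 => //; first exact: mhom_mul hw' hd.
    rewrite mxE (bigD1 j) //= big1 => [|i /negPf ij]; last by rewrite !mxE ij mulr0 mulr0.
    by rewrite !mxE !eqxx mulr1 addr0 (((mhom_scalarP _ _ _).1 hw') 0 j).2.
  have [m1 [hm1 w'm1]] : exists m1, phom m1 /\ w' *m m1 = 1p.
    by exists (p *: delta_mx j 0 *m v); split; [apply: mhom_mul hd hv | rewrite mulmxA].
  (* The column [m1] inverts [w']; the correction gives [P0 *m m1' = 0] and leaves [w' *m m1']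
     unchanged. *)
  pose m1' := m1 - U *m P0 *m m1.
  have hm1' : phom m1'.
    by apply: mhom_sub => //; apply: mhom_mul hm1; apply: mhom_mul hU hP.
  exists (1 + r)%N, (block_mx 1p (w *m U) 0 I0), (col_mx w' P0),
    (block_mx 1p (- (w *m U *m L)) 0 L), (row_mx m1' U).
  have hz x y : phom (0 : 'M[R]_(x, y)) by exact: mhom0.
  have hI' : phom (block_mx 1p (w *m U) 0 I0) by apply: mhom_col; apply: mhom_row.
  split; first split.
  - by [].
  - exact: mhom_col.
  - apply: mhom_col; apply: mhom_row => //.
    by apply: mhom_opp; apply: mhom_mul hwU hL.
  - exact: mhom_row.
  split.
  - rewrite mulmx_block !mulmx0 !mul0mx mulNmx !addr0 !add0r hwU.1.
    by rewrite -(mulmxA _ L I0) LI hwU.2 addrN -scalar_mxM pp -scalar_mx_block.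
  - rewrite mul_col_row PU w'U scalar_mx_block /m1'.
    rewrite !mulmxBr !mulmxA w'U w'm1 !mul0mx PU hP.1 subr0 subrr.
    by [].
  - rewrite mul_block_col hw'.1 mul0mx add0r Ew' -addrA addNr addr0.
    split=> //.
      by apply: mhom_col => //; apply: mhom_mul hI hP.
    rewrite opp_col_mx add_col_mx subrr => i j'; rewrite -(splitK i).
    by case: (split i) => i' /=; rewrite ?col_mxEu ?col_mxEd; [apply: rad0|apply: rG].
exists r, (col_mx (w *m U) I0), P0, (row_mx 0 L), U; split; first split=> //.
- exact: mhom_col.
- by apply: mhom_row => //; apply: mhom0.
split=> //; first by rewrite mul_row_col mul0mx add0r.
rewrite mul_col_mx; split=> //.
  by apply: mhom_col; [apply: mhom_mul hwU hP | apply: mhom_mul hI hP].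
rewrite opp_col_mx add_col_mx => i j'; rewrite -(splitK i).
case: (split i) => i' /=; rewrite ?col_mxEu ?col_mxEd; last exact: rG.
rewrite (ord1 i') -Ew' => h; apply: nuj; exists j'; exact: h.
Qed.

(** [P] and [Q] are mutually inverse isomorphisms between the object [f] and the sum of [N] copies
    of [p]. *)
Definition free_obj n N (f : 'M[R]_n) :=
  exists (P : 'M[R]_(N, n)) (Q : 'M[R]_(n, N)),
    [/\ mhom 1p f P, mhom f 1p Q, P *m Q = 1p & Q *m P = f].

Lemma free_obj_id n : free_obj n (1p : 'M[R]_n).
Proof. by exists 1p, 1p; split; rewrite ?(phom1 n).1. Qed.

Lemma free_obj_idem n N (f : 'M[R]_n) : free_obj N f -> f *m f = f.
Proof.
by case=> P [Q [hP hQ PQ QP]]; rewrite -{2}QP mulmxA hQ.1 QP.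
Qed.

(** Direct summands of free objects over a local corner are free. A rank factorization [I0 *m P0] of
    the idempotent satisfies [P0 *m I0 = 1p] modulo the radical, so after correction by [W] it gives
    maps [I] and [PP] with [PP *m I = 1p] exactly; the rest of the idempotent is radical and must
    vanish. *)
Lemma free_obj_split n N (f e : 'M[R]_n) : free_obj N f -> mhom f f e ->
  e *m e = e -> exists c, free_obj c e.
Proof.
case=> P [Q [hP hQ PQ QP]] he ee.
have [e' Ee'] : exists x, x = P *m e *m Q by eexists.
have he' : phom e' by rewrite Ee'; apply: mhom_mul hQ; apply: mhom_mul hP he.
have ee' : e' *m e' = e'.
  by rewrite Ee' !mulmxA -(mulmxA _ Q) QP -(mulmxA P e f) he.2 -(mulmxA P e e) ee.
have [r [I0 [P0 [L [U [[hI hP0 hL hU] [LI PU rF]]]]]]] := rank_factor he'.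
have hIP := mhom_mul hI hP0.
have rr X Y (M : 'M[R]_(X, Y)) : phom M -> req M M by apply: req_refl.
have q1 : req (I0 *m P0 *m (I0 *m P0)) (I0 *m P0).
  apply: (req_trans pl _ rF); rewrite -ee'.
  by apply: (req_mul pl); apply: req_sym.
have q2 : req (P0 *m I0) 1p.
  have := req_mul pl (req_mul pl (rr _ _ _ hL) q1) (rr _ _ _ hU).
  by rewrite !mulmxA LI hP0.1 -(mulmxA _ P0 U) PU (mhom_mul hP0 hI).2.
have q3 : req (P0 *m e' *m I0) 1p.
  have := req_mul pl (req_mul pl (rr _ _ _ hP0) rF) (rr _ _ _ hI).
  move=> h; apply: (req_trans pl h); rewrite mulmxA -mulmxA -(phom1 r).1.
  exact: (req_mul pl q2 q2).
have [W [hW KW WK]] := one_add_rad_inv q3.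
have [hWh _ _] := hW.
have [I EI] : exists x, x = e' *m I0 by eexists.
have [PP EP] : exists x, x = W *m P0 *m e' by eexists.
have hII : phom I by rewrite EI; apply: mhom_mul he' hI.
have hPP : phom PP by rewrite EP; apply: mhom_mul he'; apply: mhom_mul hWh hP0.
have PI : PP *m I = 1p.
  by rewrite EP EI !mulmxA -(mulmxA _ e' e') ee' -!mulmxA (mulmxA P0) WK.
have dd : req (e' - I *m PP) 0.
  have hIPP := mhom_mul hII hPP.
  split; [exact: mhom_sub | exact: mhom0 | rewrite subr0].
  suff : req e' (I *m PP) by case.
  apply: (req_trans pl rF); apply: req_sym.
  have h := req_mul pl (req_mul pl rF (rr _ _ _ hI)) (req_mul pl (req_mul pl hW (rr _ _ _ hP0)) rF).
  rewrite EI EP; apply: (req_trans pl h); rewrite hP0.1.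
  have h2 := req_trans pl (req_mul pl q1 (rr _ _ _ hIP)) q1.
  by rewrite !mulmxA in h2 *.
(* An idempotent [d] in the radical is zero, because [1p - d] is invertible and annihilates [d]. *)
have d0 : e' - I *m PP = 0.
  have eI : e' *m I = I by rewrite EI mulmxA ee'.
  have Pe : PP *m e' = PP by rewrite EP -!mulmxA ee'.
  set d := e' - I *m PP in dd *.
  have ddd : d *m d = d.
    rewrite /d mulmxBl !mulmxBr ee' mulmxA eI -(mulmxA I PP e') Pe.
    by rewrite -mulmxA (mulmxA PP I) PI hPP.1 subrr subr0.
  have [hd _ rd] := dd.
  have [V [_ V1 V2]] : exists V : 'M[R]_N, [/\ req V 1p, (1p - d) *m V = 1p & V *m (1p - d) = 1p].
    apply: one_add_rad_inv; split=> //; first exact: mhom_sub.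
    by rewrite addrAC subrr add0r; apply: rad_opp; rewrite -[d]subr0.
  by rewrite -hd.2 -V1 mulmxA mulmxBr hd.2 ddd subrr mul0mx.
exists r, (PP *m P), (Q *m I).
have ef : Q *m e' *m P = e.
  by rewrite Ee' !mulmxA QP he.1 -mulmxA QP he.2.
have eI : e *m Q *m I = Q *m I.
  rewrite EI mulmxA -ef -!mulmxA (mulmxA P Q) PQ (mulmxA 1p) he'.1.
  by rewrite (mulmxA e') ee'.
have Pe : PP *m P *m e = PP *m P.
  rewrite -ef !mulmxA -(mulmxA PP P Q) PQ hPP.2 EP -(mulmxA _ e' e') ee'.
  by [].
split.
- by split; rewrite ?mulmxA ?hPP.1.
- by split; rewrite ?mulmxA // -mulmxA hII.2.
- by rewrite mulmxA -(mulmxA PP P Q) PQ hPP.2 PI.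
by rewrite mulmxA -(mulmxA Q I PP) -(subr0_eq d0) ef.
Qed.

Lemma phom_retract_size m n (T : 'M[R]_(n, m)) (F : 'M[R]_(m, n)) :
  phom T -> phom F -> T *m F = 1p -> (n <= m)%N.
Proof.
elim: m n T F => [|m IH] n T F hT hF TF.
  case: n T F hT hF TF => // n T F _ _ /matrixP /(_ 0 0).
  rewrite mxE big_ord0 mxE eqxx mulr1n => p0.
  by case: pl.2.1.
case: n T F hT hF TF => // n T F hT hF TF.
rewrite -[m.+1]/(1 + m)%N in T F hT hF TF *.
move: hF hT TF; rewrite -(vsubmxK F) -(hsubmxK T).
move: (usubmx F) (dsubmx F) (lsubmx T) (rsubmx T) => w G t S.
move=> /mhom_colK [hw hG] /mhom_rowK [ht hS].
rewrite mul_row_col => TF.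
case: (classic (exists j, corner_unit p (w 0 j))) => [[j [v [cv [wv vw]]]]|nuj]; last first.
  have rw : nonunit_mx w by move=> i j; rewrite ord1 => h; apply: nuj; exists j.
  apply: (leq_trans (n := m)) => //.
  have htw : phom (t *m w) by exact: mhom_mul ht hw.
  have [V [hV KV VK]] : exists V : 'M[R]_n.+1, [/\ req V 1p, (S *m G) *m V = 1p & V *m (S *m G) = 1p].
    apply: one_add_rad_inv; split=> //; first exact: mhom_mul hS hG.
    rewrite -TF opprD addrCA subrr addr0; apply: rad_opp.
    exact: (rad_mull pl).
  have [hVV _ _] := hV.
  by apply: (IH _ (V *m S) G) => //; [exact: mhom_mul hVV hS | rewrite -mulmxA].
rewrite ltnS.
have cw l : corner p p (w 0 l) by move/mhom_scalarP: hw.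
(* The columns of [D] form a basis of the kernel of [w]: coordinate [j] is eliminated by means of
   the unit [w 0 j], and the others are free. *)
pose D : 'M[R]_(n.+1, n) := \matrix_(i, l)
  (if i == j then - (v * w 0 (lift j l)) else if i == lift j l then p else 0).
have hD : phom D.
  apply/mhom_scalarP => i l; rewrite mxE; case: eqP => _.
    by apply: corner_opp; apply: corner_mul cv (cw _).
  by case: eqP => _ //; apply: corner0.
have wD : w *m D = 0.
  apply/matrixP => i l; rewrite ord1 !mxE (bigD1 j) //= !mxE eqxx.
  rewrite (bigD1 (lift j l)) /=; last by rewrite eq_sym neq_lift.
  rewrite !mxE eq_sym (negPf (neq_lift _ _)) eqxx big1 => [|i' /andP [/negPf a /negPf b]].
    by rewrite mulrN mulrA wv (cw _).1 (cw _).2 addr0 addNr.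
  by rewrite mxE a b mulr0.
have rowD : row' j D = 1p.
  apply/matrixP => i l; rewrite !mxE eq_sym (negPf (neq_lift _ _)).
  by rewrite (inj_eq lift_inj); case: eqP => //=.
apply: (IH _ (row' j S) (G *m D)).
- by apply/mhom_scalarP => i l; rewrite mxE; move/mhom_scalarP: hS.
- exact: mhom_mul hG hD.
- rewrite -rowD; transitivity (row' j (S *m (G *m D))).
    by apply/matrixP => i l; rewrite !mxE; apply: eq_bigr => x _; rewrite mxE.
  rewrite mulmxA; have -> : S *m G = 1p - t *m w by rewrite -TF addrAC subrr add0r.
  by rewrite mulmxBl -mulmxA wD mulmx0 subr0 hD.1.
Qed.

Lemma free_obj_size n N N' (f : 'M[R]_n) : free_obj N f -> free_obj N' f -> N = N'.
Proof.
case=> P [Q [hP hQ PQ QP]] [P' [Q' [hP' hQ' PQ' QP']]].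
apply/eqP; rewrite eqn_leq.
rewrite (@phom_retract_size N' N (P *m Q') (P' *m Q)) ?(@phom_retract_size N N' (P' *m Q) (P *m Q')) //.
- exact: mhom_mul hP' hQ.
- exact: mhom_mul hP hQ'.
- by rewrite mulmxA -(mulmxA P' Q) QP hP'.2 PQ'.
- exact: mhom_mul hP hQ'.
- exact: mhom_mul hP' hQ.
- by rewrite mulmxA -(mulmxA P Q') QP' hP.2 PQ.
Qed.

(** The complementary idempotent [1p - S *m K] is free of some rank [c], which makes the object of
    rank [n] free of rank [n + c] as well; hence [c = 0]. *)
Lemma phom_dedekind n (K S : 'M[R]_n) : phom K -> phom S -> K *m S = 1p ->
  S *m K = 1p.
Proof.
move=> hK hS KS; have hSK := mhom_mul hS hK.
pose e := 1p - S *m K.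
have he : phom e by apply: mhom_sub.
have ee : e *m e = e.
  rewrite /e mulmxBl !mulmxBr (phom1 n).1 hSK.1 hSK.2.
  by rewrite mulmxA -(mulmxA S) KS hS.2 subrr subr0.
have [c [P [Q [hP hQ PQ QP]]]] := free_obj_split (free_obj_id n) he ee.
have hP' : phom P by split; [exact: hP.1 | rewrite -hP.2 -mulmxA he.2].
have hQ' : phom Q by split; [rewrite -hQ.1 mulmxA he.1 | exact: hQ.2].
have KQ : K *m Q = 0.
  by rewrite -hQ.1 mulmxA /e mulmxBr hK.2 mulmxA KS hK.1 subrr mul0mx.
have PS : P *m S = 0.
  by rewrite -hP.2 -mulmxA /e mulmxBl hS.1 -mulmxA KS hS.2 subrr mulmx0.
have /(free_obj_size (free_obj_id n)) E : free_obj (n + c) (1p : 'M[R]_n).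
  exists (col_mx K P), (row_mx S Q); split.
  - exact: mhom_col.
  - exact: mhom_row.
  - by rewrite mul_col_row KS KQ PS PQ -scalar_mx_block.
  - by rewrite mul_row_col QP /e addrC subrK.
have c0 : c = 0%N by apply/eqP; rewrite -(eqn_add2l n) addn0 -E.
move: P Q hP hQ PQ QP hP' hQ' KQ PS; rewrite c0 => P Q _ _ _ QP _ _ _ _.
have e0 : e = 0 by rewrite -QP; apply/matrixP=> i j; rewrite !mxE big_ord0.
by rewrite (subr0_eq e0).
Qed.

(** [f] is not a multiple of [p], so the entries of [F] say nothing by themselves; being radical is
    tested on maps from the object of rank one. *)
Definition radical_to n (f : 'M[R]_n) a (F : 'M[R]_(a, n)) :=
  forall s : 'M[R]_(n, 1), mhom f 1p s -> nonunit_mx (F *m s).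

(** For a rank factorization [I0 *m P0], the matrix [1p - I0 *m L] describes the cokernel modulo the
    radical. A row of it with a unit entry is unimodular and kills [I0]; if there is none, [F] has a
    right inverse up to an invertible matrix. *)
Lemma epi_or_radical a n N (f : 'M[R]_n) (F : 'M[R]_(a, n)) :
  free_obj N f -> mhom 1p f F ->
  (exists S : 'M[R]_(n, a), mhom f 1p S /\ F *m S = 1p) \/
  (exists (u : 'M[R]_(1, a)) (u' : 'M[R]_(a, 1)),
     [/\ phom u, phom u', u *m u' = 1p & radical_to f (u *m F)]).
Proof.
case=> P [Q [hP hQ PQ QP]] hF.
have hFQ := mhom_mul hF hQ.
have [r [I0 [P0 [L [U [[hI hP0 hL hU] [LI PU rF]]]]]]] := rank_factor hFQ.
have hIL := mhom_mul hI hL.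
case: (classic (exists i j, corner_unit p ((1p - I0 *m L) i j))) => [[i [j uij]]|nu].
  right; have [d Ed] : exists x, x = 1p - I0 *m L by eexists.
  rewrite -Ed in uij; have hd : phom d by rewrite Ed; apply: mhom_sub.
  have cd : corner p p (d i j) by move/mhom_scalarP: hd.
  have [y [cy [h1 h2]]] := uij.
  exists (row i d), (\col_l (if l == j then y else 0)).
  have hu : phom (row i d).
    by apply/mhom_scalarP => i' j'; rewrite mxE; move/mhom_scalarP: hd.
  split=> //.
  - apply/mhom_scalarP => i' j'; rewrite mxE; case: eqP => // _; exact: corner0.
  - apply/matrixP=> i' j'; rewrite !ord1 !mxE (bigD1 j) //= big1 => [|l /negPf lj].
      by rewrite !mxE eqxx addr0 h1.
    by rewrite !mxE lj mulr0.
  - move=> s hs; rewrite -hs.1 -QP.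
    have uI : row i d *m I0 = 0.
      rewrite -row_mul Ed mulmxBl hI.1 -mulmxA LI hI.2 subrr.
      by apply/matrixP=> ? ?; rewrite !mxE.
    have [_ _ rr] := req_mul pl (req_refl pl hu) rF.
    rewrite -(mulmxA Q P s) mulmxA -(mulmxA _ F Q).
    move: rr; rewrite (mulmxA _ I0) uI mul0mx subr0 => rr.
    apply: (rad_mulr pl) => //; first exact: mhom_mul hu hFQ.
    exact: mhom_mul hP hs.
left.
have q : req (F *m Q *m U *m L) 1p.
  have h := req_mul pl (req_mul pl rF (req_refl pl hU)) (req_refl pl hL).
  apply: (req_trans pl h); rewrite -(mulmxA I0) PU hI.2.
  apply: req_sym; split=> // i j uij; apply: nu; by exists i, j.
have [W [[hW _ _] KW _]] := one_add_rad_inv q.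
exists (Q *m U *m L *m W); split.
  by apply: mhom_mul hW; apply: mhom_mul hL; apply: mhom_mul hQ hU.
by rewrite !mulmxA.
Qed.

(** The dual argument, with a column of [1p - U *m P0], which [P0] kills. *)
Lemma mono_or_radical c n N (f : 'M[R]_n) (F : 'M[R]_(n, c)) :
  free_obj N f -> mhom f 1p F ->
  (exists S : 'M[R]_(c, n), mhom 1p f S /\ S *m F = 1p) \/
  (exists (v : 'M[R]_(c, 1)) (v' : 'M[R]_(1, c)),
     [/\ phom v, phom v', v' *m v = 1p &
      forall m (t : 'M[R]_(m, n)), mhom 1p f t -> nonunit_mx (t *m F *m v)]).
Proof.
case=> P [Q [hP hQ PQ QP]] hF.
have hFQ := mhom_mul hP hF.
have [r [I0 [P0 [L [U [[hI hP0 hL hU] [LI PU rF]]]]]]] := rank_factor hFQ.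
have hIL := mhom_mul hU hP0.
case: (classic (exists i j, corner_unit p ((1p - U *m P0) i j))) => [[i [j uij]]|nu].
  right; have [d Ed] : exists x, x = 1p - U *m P0 by eexists.
  rewrite -Ed in uij; have hd : phom d by rewrite Ed; apply: mhom_sub.
  have cd : corner p p (d i j) by move/mhom_scalarP: hd.
  have [y [cy [h1 h2]]] := uij.
  exists (col j d), (\row_l (if l == i then y else 0)).
  have hu : phom (col j d).
    by apply/mhom_scalarP => i' j'; rewrite mxE; move/mhom_scalarP: hd.
  split=> //.
  - apply/mhom_scalarP => i' j'; rewrite mxE; case: eqP => // _; exact: corner0.
  - apply/matrixP=> i' j'; rewrite !ord1 !mxE (bigD1 i) //= big1 => [|l /negPf lj].
      by rewrite !mxE eqxx addr0 h2.
    by rewrite !mxE lj mul0r.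
  - move=> m t ht; rewrite -ht.2 -QP.
    have uI : P0 *m col j d = 0.
      have -> : P0 *m col j d = col j (P0 *m d).
        by apply/matrixP => ? ?; rewrite !mxE; apply: eq_bigr => ? _; rewrite mxE.
      rewrite Ed mulmxBr hP0.2 mulmxA PU hP0.1 subrr.
      by apply/matrixP=> ? ?; rewrite !mxE.
    have [_ _ rr] := req_mul pl rF (req_refl pl hu).
    rewrite !mulmxA -(mulmxA _ P F) -(mulmxA _ (P *m F)).
    move: rr; rewrite -(mulmxA I0) uI mulmx0 subr0 => rr.
    apply: (rad_mull pl) => //; last exact: mhom_mul hFQ hu.
    exact: mhom_mul ht hQ.
left.
have q : req (U *m L *m (P *m F)) 1p.
  have h := req_mul pl (req_refl pl (mhom_mul hU hL)) rF.
  apply: (req_trans pl h); rewrite mulmxA -(mulmxA U) LI hU.2.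
  apply: req_sym; split=> // i j uij; apply: nu; by exists i, j.
have [W [[hW _ _] _ WK]] := one_add_rad_inv q.
exists (W *m U *m L *m P); split.
  by apply: mhom_mul hP; apply: mhom_mul hL; apply: mhom_mul hW hU.
by rewrite -WK !mulmxA.
Qed.

(* The hypothesis says that no unimodular row is killed modulo the radical. *)
Lemma free_obj_inv n N (f : 'M[R]_n) (K : 'M[R]_n) : free_obj N f -> mhom f f K ->
  (forall u : 'M[R]_(1, n), mhom 1p f u -> radical_to f (u *m K) -> radical_to f u) ->
  exists W, [/\ mhom f f W, K *m W = f & W *m K = f].
Proof.
move=> fr hK H; have ff := free_obj_idem fr.
have [P [Q [hP hQ PQ QP]]] := fr.
have hK' : phom (P *m K *m Q) by apply: mhom_mul hQ; apply: mhom_mul hP hK.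
case: (epi_or_radical (free_obj_id N) hK') => [[S [hS KS]]|[u [u' [hu hu' uu' ru]]]].
  have SK := phom_dedekind hK' hS KS.
  exists (Q *m S *m P); split.
  - by apply: mhom_mul hP; apply: mhom_mul hQ hS.
  - have -> : K *m (Q *m S *m P) = Q *m ((P *m K *m Q) *m S) *m P.
      by rewrite !mulmxA QP hK.1.
    by rewrite KS hQ.2 QP.
  - have -> : Q *m S *m P *m K = Q *m (S *m (P *m K *m Q)) *m P.
      by rewrite !mulmxA -(mulmxA _ Q P) QP -(mulmxA _ K f) hK.2.
    by rewrite SK hQ.2 QP.
(* The split row [u *m P] becomes radical after [K], so by hypothesis it is radical itself; but it
   takes [Q *m u'] to the identity. *)
exfalso.
have huP : mhom 1p f (u *m P) by exact: mhom_mul hu hP.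
have h : radical_to f (u *m P).
  apply: H => // s hs; rewrite -hs.1 -QP.
  have := ru (P *m s) (mhom_mul hP hs); by rewrite !mulmxA.
have := h (Q *m u') (mhom_mul hQ hu') 0 0.
rewrite mulmxA -(mulmxA u) PQ hu.2 uu' mxE eqxx mulr1n => np.
by apply: np; apply: corner_unit_id.
Qed.

End FreeObjects.

(** * The correspondence between matrices *)

Section Correspondence.
Variables (R : nzRingType) (p q E x : R) (ell : nat).
Hypothesis pl : local_idem p.
Hypothesis qq : q * q = q.
Hypothesis cx : corner E q x.
Hypothesis freeE : free_obj p ell (E%:M : 'M[R]_1).
Hypothesis gen_x : forall m, corner p q m -> exists2 u, corner p E u & u * x = m.
Hypothesis min_x : forall u, corner p E u -> u * x = 0 ->
  forall s, corner E p s -> ~ corner_unit p (u * s).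

Local Notation pM := (p%:M).
Local Notation qM := (q%:M).
Local Notation EM := (E%:M).
Local Notation xM := (x%:M).
Local Notation radical_to := (radical_to p).

Let EE : E * E = E.
Proof.
by have /matrixP /(_ 0 0) := free_obj_idem freeE; rewrite -scalar_mxM !mxE eqxx !mulr1n.
Qed.

Let pM1 n : mhom pM pM (pM : 'M[R]_n) := phom_id pl n.
Let qM1 n : mhom qM qM (qM : 'M[R]_n).
Proof. exact: mhom_scalar_id. Qed.
Let EM1 n : mhom EM EM (EM : 'M[R]_n).
Proof. exact: mhom_scalar_id. Qed.
Let xM1 n : mhom EM qM (xM : 'M[R]_n).
Proof. by split; rewrite -scalar_mxM ?cx.1 ?cx.2. Qed.
Hint Resolve pM1 qM1 EM1 xM1 : core.

Lemma free_obj_scalar n : free_obj p (ell * n) (EM : 'M[R]_n).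
Proof.
elim: n => [|n IH].
  rewrite muln0; exists 0, 0; split; try exact: mhom0; by apply/matrixP; case.
have [P [Q [hP hQ PQ QP]]] := IH; have [P1 [Q1 [hP1 hQ1 PQ1 QP1]]] := freeE.
rewrite mulnS -[n.+1]/(1 + n)%N; exists (block_mx P1 0 0 P), (block_mx Q1 0 0 Q).
split.
- by apply: mhom_col; apply: mhom_row => //; apply: mhom0.
- by apply: mhom_col; apply: mhom_row => //; apply: mhom0.
- by rewrite mulmx_block !mulmx0 !mul0mx !addr0 !add0r PQ PQ1 -scalar_mx_block.
- by rewrite mulmx_block !mulmx0 !mul0mx !addr0 !add0r QP QP1 -scalar_mx_block.
Qed.

Lemma lift_rows a b (V : 'M[R]_(a, b)) : mhom pM qM V ->
  exists2 v : 'M[R]_(a, b), mhom pM EM v & v *m xM = V.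
Proof.
move=> /mhom_scalarP cV.
have [f hf] : exists f : 'I_a -> 'I_b -> R, forall i j, corner p E (f i j) /\ f i j * x = V i j.
  have h i j : exists u, corner p E u /\ u * x = V i j.
    by have [u a1 a2] := gen_x (cV i j); exists u.
  by have [f hf] := fin_all_exists (fun i => fin_all_exists (h i)); exists f.
exists (\matrix_(i, j) f i j).
  by apply/mhom_scalarP => i j; rewrite mxE; case: (hf i j).
by apply/matrixP => i j; rewrite mulmx_scalar mxE; case: (hf i j).
Qed.

Lemma lift_free n b N (f : 'M[R]_n) (V : 'M[R]_(n, b)) : free_obj p N f -> mhom f qM V ->
  exists2 v : 'M[R]_(n, b), mhom f EM v & v *m xM = V.
Proof.
case=> P [Q [hP hQ PQ QP]] hV.
have [v hv vx] := lift_rows (mhom_mul hP hV).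
by exists (Q *m v); [exact: mhom_mul hQ hv | rewrite -mulmxA vx mulmxA QP hV.1].
Qed.

(** The entries of [u] are relations between the generators, so this is minimality of [x] in matrix
    form. It is what controls the choice of lifts. *)
Lemma kills_radical a b (u : 'M[R]_(a, b)) : mhom pM EM u -> u *m xM = 0 -> radical_to EM u.
Proof.
move=> /mhom_scalarP cu ux s /mhom_scalarP cs i j; rewrite mxE.
case/(corner_unit_sum pl) => [l|l]; first exact: corner_mul (cu i l) (cs l j).
apply: min_x => //; move/matrixP: ux => /(_ i l); by rewrite mulmx_scalar mxE.
Qed.

Lemma radical_to_add a b (u v : 'M[R]_(a, b)) : mhom pM EM u -> mhom pM EM v ->
  radical_to EM u -> radical_to EM v -> radical_to EM (u + v).
Proof.
move=> hu hv ru rv s hs; rewrite mulmxDl; apply: (rad_add pl).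
- exact: mhom_mul hu hs.
- exact: mhom_mul hv hs.
- exact: ru.
- exact: rv.
Qed.

Lemma radical_to_mx a b n (u : 'M[R]_(a, b)) (S : 'M[R]_(b, n)) :
  radical_to EM u -> mhom EM pM S -> nonunit_mx p (u *m S).
Proof.
move=> ru /mhom_scalarP cS i j.
have hc : mhom EM pM (col j S) by apply/mhom_scalarP => i' j'; rewrite mxE.
have := ru _ hc i 0; rewrite !mxE; congr (~ corner_unit p _).
by apply: eq_bigr => l _; rewrite mxE.
Qed.

Lemma radical_to_mul a b b' (u : 'M[R]_(a, b)) (K : 'M[R]_(b, b')) : mhom EM EM K ->
  radical_to EM u -> radical_to EM (u *m K).
Proof. by move=> hK ru s hs; rewrite -mulmxA; apply: ru; apply: mhom_mul hK hs. Qed.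

(* Matrices over the corner algebra of pairs [(s, b)] with [s * x = x * b]. *)
Definition cmat b' b (S : 'M[R]_(b', b)) (B : 'M[R]_(b', b)) :=
  [/\ mhom EM EM S, mhom qM qM B & S *m xM = xM *m B].

(** Projectivity of [E] lifts [B] through [x]. The lift is not unique: two of them differ by a
    matrix killed by [x]. *)
Lemma cmat_lift b' b (B : 'M[R]_(b', b)) : mhom qM qM B -> exists S, cmat S B.
Proof.
move=> hB; have [S hS Sx] := lift_free (free_obj_scalar b') (mhom_mul (xM1 b') hB).
by exists S.
Qed.

Lemma cmat_mul a b c (S : 'M[R]_(a, b)) B (S' : 'M[R]_(b, c)) B' :
  cmat S B -> cmat S' B' -> cmat (S *m S') (B *m B').
Proof.
move=> [h1 h2 h3] [h4 h5 h6]; split.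
- exact: mhom_mul h1 h4.
- exact: mhom_mul h2 h5.
- by rewrite -mulmxA h6 !mulmxA h3.
Qed.

(** Vanishing of Hom(T, U[1]) for the complexes T and U with differentials [M] and [M']. *)
Definition homzeroM a b a' b' (M : 'M[R]_(a, b)) (M' : 'M[R]_(a', b')) :=
  forall V : 'M[R]_(a', b), mhom pM qM V -> exists (A : 'M[R]_(a', a)) (B : 'M[R]_(b', b)),
    [/\ mhom pM pM A, mhom qM qM B & V = A *m M + M' *m B].

(** The same over the rotated algebra. Of a pair only the part [S] acts on [N]; the part [B] records
    that [S] is compatible with [x]. *)
Definition homzeroN b c b' c' (N : 'M[R]_(b, c)) (N' : 'M[R]_(b', c')) :=
  forall V : 'M[R]_(b', c), mhom EM pM V ->
  exists (S B : 'M[R]_(b', b)) (C : 'M[R]_(c', c)),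
    [/\ cmat S B, mhom pM pM C & V = S *m N + N' *m C].

(* [F] is a lift of [M] through the generators [x], it is a split epimorphism,
   and [N] is its kernel; [S] and [T] are the splitting. *)
Definition corr0 a b c (M : 'M[R]_(a, b)) (N : 'M[R]_(b, c)) :=
  exists (F : 'M[R]_(a, b)) (S : 'M[R]_(b, a)) (T : 'M[R]_(c, b)),
    [/\ mhom pM EM F, mhom EM pM S, mhom pM EM T & mhom EM pM N] /\
    [/\ F *m xM = M, F *m S = pM, F *m N = 0, T *m N = pM & S *m F + N *m T = EM].

(** [F] and [T] together identify [b] copies of [E], an object of rank [ell * b], with the sum of
    objects of ranks [a] and [c]. *)
Lemma corr0_size a b c (M : 'M[R]_(a, b)) (N : 'M[R]_(b, c)) :
  corr0 M N -> (a + c = ell * b)%N.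
Proof.
case=> F [S [T [[hF hS hT hN] [FM FS FN TN e]]]].
(* Not among the equations of [corr0], but forced by them: multiply the decomposition of [EM] by [T]
   on the left and [S] on the right. *)
have TS : T *m S = 0.
  have : T *m (S *m F + N *m T) *m S = T *m S by rewrite e hT.2.
  rewrite mulmxDr !mulmxA TN hT.1 mulmxDl -(mulmxA _ F S) FS -(mulmxA _ S) hS.2.
  by move=> h; apply: (addrI (T *m S)); rewrite h addr0.
apply: (free_obj_size pl (f := EM : 'M[R]_b)) (free_obj_scalar b).
exists (col_mx F T), (row_mx S N); split.
- exact: mhom_col.
- exact: mhom_row.
- by rewrite mul_col_row FS FN TS TN -scalar_mx_block.
- by rewrite mul_row_col.
Qed.

Lemma exact_factor a b c d (F : 'M[R]_(a, b)) S (N : 'M[R]_(b, c)) T (D : 'M[R]_(b, d)) :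
  S *m F + N *m T = EM -> EM *m D = D -> F *m D = 0 -> N *m (T *m D) = D.
Proof. by move=> e h FD; rewrite -{2}h -e mulmxDl -mulmxA FD mulmx0 add0r mulmxA. Qed.

Section Transfer.
Variables (a b c a' b' c' : nat).
Variables (M : 'M[R]_(a, b)) (N : 'M[R]_(b, c)) (M' : 'M[R]_(a', b')) (N' : 'M[R]_(b', c')).
Hypothesis cMN : corr0 M N.
Hypothesis cMN' : corr0 M' N'.

(** Lift [V] to [v] and write [S' *m v *m N] as [K *m N + N' *m C]. Applying [F'] shows that
    [v - F' *m K] kills [N], so it factors through [F]; multiplying by [x] gives the required form
    of [V]. *)
Lemma homzeroN_M : homzeroN N N' -> homzeroM M M'.
Proof.
have [F [S [T [[hF hS hT hN] [FM FS FN TN e]]]]] := cMN.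
have [F' [S' [T' [[hF' hS' hT' hN'] [FM' FS' FN' TN' e']]]]] := cMN'.
move=> H V hV; have [v hv vx] := lift_rows hV.
have [K [B [C [[hK hB KB] hC eZ]]]] := H (S' *m v *m N) (mhom_mul (mhom_mul hS' hv) hN).
have hFK := mhom_mul hF' hK.
have vN : (v - F' *m K) *m N = 0.
  rewrite mulmxBl; move: (congr1 (mulmx F') eZ).
  rewrite mulmxDr !mulmxA FS' FN' mul0mx addr0 hv.1 => ->.
  by rewrite subrr.
have hd : mhom pM EM (v - F' *m K) by apply: mhom_sub.
exists ((v - F' *m K) *m S), B; split=> //; first exact: mhom_mul hd hS.
have : (v - F' *m K) *m S *m F = v - F' *m K.
  by rewrite -{2}hd.2 -e mulmxDr (mulmxA _ N) vN mul0mx addr0 mulmxA.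
rewrite -{1}FM mulmxA => ->; rewrite mulmxBl vx -FM' -(mulmxA F' K) KB mulmxA.
by rewrite subrK.
Qed.

(** Push [Z] down to [F' *m Z *m T] and decompose it after multiplication by [x]. The lifted
    equation has an error [k] killed by [x]; adding [S' *m k] to the lift [K0] removes the error
    without changing [K0 *m xM]. What is left of [Z] is killed by [F'], so it factors through
    [N']. *)
Lemma homzeroM_N : homzeroM M M' -> homzeroN N N'.
Proof.
have [F [S [T [[hF hS hT hN] [FM FS FN TN e]]]]] := cMN.
have [F' [S' [T' [[hF' hS' hT' hN'] [FM' FS' FN' TN' e']]]]] := cMN'.
move=> H Z hZ; have hv : mhom pM EM (F' *m Z *m T) by apply: mhom_mul hT; apply: mhom_mul hF' hZ.
have [A [B [hA hB eV]]] := H _ (mhom_mul hv (xM1 b)).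
have [K0 [hK0 _ KB0]] := cmat_lift hB.
have [k Ek] : exists k, k = F' *m Z *m T - A *m F - F' *m K0 by eexists.
have hk : mhom pM EM k.
  rewrite Ek; apply: mhom_sub; first apply: mhom_sub => //; first exact: mhom_mul hA hF.
  exact: mhom_mul hF' hK0.
have kx : k *m xM = 0.
  rewrite Ek !mulmxBl eV -!(mulmxA _ _ xM) FM KB0 -FM' (mulmxA F') .
  by rewrite (addrC (A *m M)) addrK subrr.
have hSk := mhom_mul hS' hk.
have FK : F' *m (K0 + S' *m k) = F' *m Z *m T - A *m F.
  by rewrite mulmxDr mulmxA FS' hk.1 Ek addrC subrK.
have hK : mhom EM EM (K0 + S' *m k) by apply: mhom_add.
exists (K0 + S' *m k), B, (T' *m (Z - (K0 + S' *m k) *m N)).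
have hZK : mhom EM pM (Z - (K0 + S' *m k) *m N) by apply: mhom_sub => //; apply: mhom_mul hK hN.
split.
- by split=> //; rewrite mulmxDl -mulmxA kx mulmx0 addr0.
- exact: mhom_mul hT' hZK.
have F0 : F' *m (Z - (K0 + S' *m k) *m N) = 0.
  rewrite mulmxBr (mulmxA F') FK mulmxBl -(mulmxA _ T) TN -(mulmxA A) FN mulmx0 subr0.
  by rewrite (mhom_mul hF' hZ).2 subrr.
by rewrite (exact_factor e' hZK.1 F0) addrC subrK.
Qed.

Definition isoM := exists (A : 'M[R]_(a', a)) (A' : 'M[R]_(a, a'))
    (B : 'M[R]_(b', b)) (B' : 'M[R]_(b, b')),
  [/\ mhom pM pM A, mhom pM pM A', mhom qM qM B & mhom qM qM B'] /\
  [/\ A *m A' = pM, A' *m A = pM, B *m B' = qM, B' *m B = qM & A *m M = M' *m B].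

Definition isoN := exists (S B : 'M[R]_(b', b)) (S' B' : 'M[R]_(b, b'))
    (C : 'M[R]_(c', c)) (C' : 'M[R]_(c, c')),
  [/\ cmat S B, cmat S' B', mhom pM pM C & mhom pM pM C'] /\
  [/\ S *m S' = EM, S' *m S = EM, B *m B' = qM & B' *m B = qM] /\
  [/\ C *m C' = pM, C' *m C = pM & S *m N = N' *m C].

(** [F] is the cokernel of [N], so an isomorphism between [N] and [N'] induces one between the
    cokernels, computed by the sections as [F' *m K *m S]. *)
Lemma isoN_M : isoN -> isoM.
Proof.
have [F [S [T [[hF hS hT hN] [FM FS FN TN e]]]]] := cMN.
have [F' [S' [T' [[hF' hS' hT' hN'] [FM' FS' FN' TN' e']]]]] := cMN'.
case=> K [B [K' [B' [C [C' [[[hK hB KB] [hK' hB' KB'] hC hC'] [[KK KK' BB BB'] [CC CC' KN]]]]]]]].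
have KN' : K' *m N' = N *m C'.
  by rewrite -hN'.2 -CC !mulmxA -(mulmxA K') -KN mulmxA KK' hN.1.
have AF : F' *m K *m S *m F = F' *m K.
  rewrite -(mulmxA _ S) -[S *m F](addrK (N *m T)) e mulmxBr (mhom_mul hF' hK).2.
  by rewrite (mulmxA _ N) -(mulmxA F') KN !mulmxA FN' !mul0mx subr0.
have AF' : F *m K' *m S' *m F' = F *m K'.
  rewrite -(mulmxA _ S') -[S' *m F'](addrK (N' *m T')) e' mulmxBr (mhom_mul hF hK').2.
  by rewrite (mulmxA _ N') -(mulmxA F) KN' !mulmxA FN !mul0mx subr0.
exists (F' *m K *m S), (F *m K' *m S'), B, B'; split; first split=> //.
- by apply: mhom_mul hS; apply: mhom_mul hF' hK.
- by apply: mhom_mul hS'; apply: mhom_mul hF hK'.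
split=> //.
- by rewrite !mulmxA AF -(mulmxA F') KK hF'.2 FS'.
- by rewrite !mulmxA AF' -(mulmxA F) KK' hF.2 FS.
- by rewrite -FM mulmxA AF -mulmxA KB mulmxA FM'.
Qed.

(** An arbitrary lift of [B] commutes with the lifts [F] and [F'] only after multiplication by [x];
    the section [S'] carries the defect back into the lift. *)
Lemma lift_chain (A : 'M[R]_(a', a)) (B : 'M[R]_(b', b)) F F' S' :
  mhom pM pM A -> mhom qM qM B -> mhom pM EM F -> mhom pM EM F' -> mhom EM pM S' ->
  F *m xM = M -> F' *m xM = M' -> F' *m S' = pM ->
  A *m M = M' *m B -> exists2 K, cmat K B & F' *m K = A *m F.
Proof.
move=> hA hB hF hF' hS' FM FM' FS' AM.
have [K0 [hK0 _ KB0]] := cmat_lift hB.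
have hk : mhom pM EM (A *m F - F' *m K0).
  by apply: mhom_sub; [exact: mhom_mul hA hF | exact: mhom_mul hF' hK0].
exists (K0 + S' *m (A *m F - F' *m K0)).
  split=> //; first by apply: mhom_add => //; apply: mhom_mul hS' hk.
  by rewrite mulmxDl -mulmxA mulmxBl -!mulmxA FM AM KB0 -FM' mulmxA subrr mulmx0 addr0.
by rewrite (mulmxDr F') (mulmxA F' S') FS' hk.1 addrC subrK.
Qed.

End Transfer.

(** [EM - K] is killed by [x], hence radical by minimality. A lift of the identity need not be the
    identity, but it is invertible. *)
Lemma cmat_id_inv b (K : 'M[R]_b) : cmat K qM ->
  exists W, [/\ mhom EM EM W, K *m W = EM & W *m K = EM].
Proof.
case=> hK _ Kx; apply: (free_obj_inv pl (free_obj_scalar b) hK) => u hu ru.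
have hd : mhom EM EM (EM - K) by apply: mhom_sub.
have -> : u = u *m K + u *m (EM - K) by rewrite mulmxBr hu.2 addrC subrK.
apply: radical_to_add => //.
- exact: mhom_mul hu hK.
- exact: mhom_mul hu hd.
- apply: kills_radical; first exact: mhom_mul hu hd.
  by rewrite -mulmxA mulmxBl Kx (xM1 b).1 (xM1 b).2 subrr mulmx0.
Qed.

(** The lifts [K] and [K1] of mutually inverse matrices compose to lifts of the identity only. These
    are invertible, so [K1] can be corrected to a true inverse of [K]; both then preserve the
    kernels. *)
Lemma isoM_N a b c a' b' c' (M : 'M[R]_(a, b)) (N : 'M[R]_(b, c))
    (M' : 'M[R]_(a', b')) (N' : 'M[R]_(b', c')) :
  corr0 M N -> corr0 M' N' -> isoM M M' -> isoN N N'.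
Proof.
case=> F [S [T [[hF hS hT hN] [FM FS FN TN e]]]].
case=> F' [S' [T' [[hF' hS' hT' hN'] [FM' FS' FN' TN' e']]]].
case=> A [A' [B [B' [[hA hA' hB hB'] [AA AA' BB BB' AM]]]]].
have hM : mhom pM qM M by rewrite -FM; apply: mhom_mul hF (xM1 b).
have hM' : mhom pM qM M' by rewrite -FM'; apply: mhom_mul hF' (xM1 b').
have AM' : A' *m M' = M *m B'.
  by rewrite -hM'.2 -BB !mulmxA -(mulmxA A') -AM mulmxA AA' hM.1.
have [K cK FK] := lift_chain hA hB hF hF' hS' FM FM' FS' AM.
have [K1 cK1 FK1] := lift_chain hA' hB' hF' hF hS FM' FM FS AM'.
have cKK := cmat_mul cK1 cK; rewrite BB' in cKK.
have cKK' := cmat_mul cK cK1; rewrite BB in cKK'.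
have [W1 [hW1 _ WK1]] := cmat_id_inv cKK.
have [W2 [hW2 KW2 _]] := cmat_id_inv cKK'.
have [hK _ Kx] := cK; have [hK1 _ _] := cK1.
(* The left inverse and the right inverse of [K] coincide. *)
have eW : W1 *m K1 = K1 *m W2.
  by rewrite -(mhom_mul hW1 hK1).2 -KW2 !mulmxA -(mulmxA W1) WK1 -mulmxA (mhom_mul hK1 hW2).1.
have [K' EK'] : exists x, x = W1 *m K1 by eexists.
have hK' : mhom EM EM K' by rewrite EK'; apply: mhom_mul hW1 hK1.
have KK' : K' *m K = EM by rewrite EK' -mulmxA.
have KK : K *m K' = EM by rewrite EK' eW mulmxA.
have FK' : F *m K' = A' *m F'.
  by rewrite -(mhom_mul hF hK').1 -AA' -!mulmxA (mulmxA A) -FK -mulmxA KK hF'.2.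
have cK' : cmat K' B'.
  split=> //; rewrite -(mulmx1 xM).
  rewrite mulmx1 -{1}(xM1 b').2 -BB !mulmxA -(mulmxA K') -Kx !mulmxA KK'.
  by rewrite (xM1 b).1.
have KN : K *m N = N' *m (T' *m K *m N).
  rewrite -mulmxA (exact_factor e') ?mulmxA ?hK.1 // FK -mulmxA FN mulmx0 //.
have KN' : K' *m N' = N *m (T *m K' *m N').
  rewrite -mulmxA (exact_factor e) ?mulmxA ?hK'.1 // FK' -mulmxA FN' mulmx0 //.
exists K, B, K', B', (T' *m K *m N), (T *m K' *m N'); split; first split=> //.
- by apply: mhom_mul hN; apply: mhom_mul hT' hK.
- by apply: mhom_mul hN'; apply: mhom_mul hT hK'.
split=> //; split=> //.
- by rewrite -mulmxA -KN' mulmxA -(mulmxA T') KK hT'.2 TN'.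
- by rewrite -mulmxA -KN mulmxA -(mulmxA T) KK' hT.2 TN.
Qed.

(** The kernel of the split epimorphism is the image of the idempotent [EM - S *m F], free by
    [free_obj_split]; its rank is [c]. *)
Lemma corr0_of_epi a b (F : 'M[R]_(a, b)) (S : 'M[R]_(b, a)) :
  mhom pM EM F -> mhom EM pM S -> F *m S = pM ->
  exists c (N : 'M[R]_(b, c)), corr0 (F *m xM) N.
Proof.
move=> hF hS FS; have hSF := mhom_mul hS hF.
have he : mhom EM EM (EM - S *m F) by apply: mhom_sub.
have ee : (EM - S *m F) *m (EM - S *m F) = EM - S *m F.
  rewrite mulmxBl (he.1) mulmxBr hSF.2 mulmxA -(mulmxA S) FS hS.2 subrr subr0.
  by [].
have [c [P [Q [hP hQ PQ QP]]]] := free_obj_split pl (free_obj_scalar b) he ee.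
have hP' : mhom pM EM P by split; [exact: hP.1 | rewrite -hP.2 -mulmxA he.2].
have hQ' : mhom EM pM Q by split; [rewrite -hQ.1 mulmxA he.1 | exact: hQ.2].
exists c, Q, F, S, P; split=> //; split=> //.
- by rewrite -hQ.1 mulmxA mulmxBr hF.2 mulmxA FS hF.1 subrr mul0mx.
- by rewrite QP addrC subrK.
Qed.

Lemma corr0_of_mono b c (N : 'M[R]_(b, c)) (T : 'M[R]_(c, b)) :
  mhom EM pM N -> mhom pM EM T -> T *m N = pM ->
  exists a (M : 'M[R]_(a, b)), mhom pM qM M /\ corr0 M N.
Proof.
move=> hN hT TN; have hNT := mhom_mul hN hT.
have he : mhom EM EM (EM - N *m T) by apply: mhom_sub.
have ee : (EM - N *m T) *m (EM - N *m T) = EM - N *m T.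
  rewrite mulmxBl (he.1) mulmxBr hNT.2 mulmxA -(mulmxA N) TN hN.2 subrr subr0.
  by [].
have [a [P [Q [hP hQ PQ QP]]]] := free_obj_split pl (free_obj_scalar b) he ee.
have hP' : mhom pM EM P by split; [exact: hP.1 | rewrite -hP.2 -mulmxA he.2].
have hQ' : mhom EM pM Q by split; [rewrite -hQ.1 mulmxA he.1 | exact: hQ.2].
exists a, (P *m xM); split; first exact: mhom_mul hP' (xM1 b).
exists P, Q, T; split=> //; split=> //.
- by rewrite -hP.2 -mulmxA mulmxBl hN.1 -mulmxA TN hN.2 subrr mulmx0.
- by rewrite QP subrK.
Qed.

(* [M] is, up to isomorphism, a sum of copies of the minimal generator [x] and
   of zero rows. *)
Definition cogenerated a b (M : 'M[R]_(a, b)) :=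
  exists (F : 'M[R]_(a, b)) (T : 'M[R]_(b, a)),
    [/\ mhom pM EM F, mhom EM pM T, F *m xM = M & T *m F = EM].

(** If the lift [F] of [M] does not split, some unimodular row [u] makes [u *m F] radical. Vanishing
    of Hom into [M], tested in the direction of [u], then expresses the identity of [b0] copies of
    [E] through the lift [F0] of [M0] up to the radical, so [F0] is a split monomorphism. *)
Lemma epi_or_cogenerated a b (M : 'M[R]_(a, b)) : mhom pM qM M ->
  (exists c (N : 'M[R]_(b, c)), corr0 M N) \/
  forall a0 b0 (M0 : 'M[R]_(a0, b0)), mhom pM qM M0 -> homzeroM M0 M -> cogenerated M0.
Proof.
move=> hM; have [F hF FM] := lift_rows hM.
have [[S [hS FS]]|[u [u' [hu hu' uu ru]]]] := epi_or_radical pl (free_obj_scalar b) hF.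
  by left; rewrite -FM; apply: corr0_of_epi hS FS.
right=> a0 b0 M0 hM0 H; have [F0 hF0 FM0] := lift_rows hM0.
have [P [Q [hP hQ PQ QP]]] := free_obj_scalar b0.
have huF := mhom_mul hu hF.
have hPx := mhom_mul hP (xM1 b0).
have rows i : exists (A : 'rV[R]_a0) (K : 'rV[R]_b0),
  [/\ mhom pM pM A, mhom pM EM K, radical_to EM K & row i (P *m xM) = A *m M0 + K *m xM].
  have hr : mhom pM qM (row i (P *m xM)).
    by apply/mhom_scalarP => i' j; rewrite mxE; move/mhom_scalarP: hPx.
  (* The test map places the row in the direction [u']. Applying [u] recovers the row and turns the
     term through [M] into a radical one. *)
  have [A [B [hA hB eV]]] := H _ (mhom_mul hu' hr).
  have [K [hK _ Kx]] := cmat_lift hB.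
  exists (u *m A), (u *m F *m K); split.
  - exact: mhom_mul hu hA.
  - exact: mhom_mul huF hK.
  - exact: radical_to_mul.
  - rewrite -(mulmxA _ K) Kx (mulmxA _ xM) -(mulmxA u F) FM -!mulmxA -mulmxDr -eV.
    by rewrite mulmxA uu hr.1.
have [A hA] := fin_all_exists rows; have [K hK] := fin_all_exists hA.
pose A0 := \matrix_(i, j) A i 0 j; pose K0 := \matrix_(i, j) K i 0 j.
have rA i : row i A0 = A i by apply/rowP=> j; rewrite !mxE.
have rK i : row i K0 = K i by apply/rowP=> j; rewrite !mxE.
have hA0 : mhom pM pM A0.
  by apply/mhom_scalarP => i j; rewrite mxE; have [/mhom_scalarP h _ _ _] := hK i.
have hK0 : mhom pM EM K0.
  by apply/mhom_scalarP => i j; rewrite mxE; have [_ /mhom_scalarP h _ _] := hK i.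
have rK0 : radical_to EM K0.
  move=> s hs i j; have [_ _ h _] := hK i; have := h s hs 0 j.
  by rewrite -rK -row_mul mxE.
have ePx : P *m xM = A0 *m M0 + K0 *m xM.
  apply/row_matrixP => i; rewrite linearD /= !row_mul rA rK -row_mul.
  by have [_ _ _ ->] := hK i.
clearbody A0 K0.
have hAF := mhom_mul hA0 hF0.
have hD : mhom pM EM (P - A0 *m F0 - K0) by do 2 apply: mhom_sub => //.
(* [ePx] is an equation after multiplication by [x]; cancelling [x] costs a radical error. *)
have rD : radical_to EM (P - A0 *m F0 - K0).
  apply: kills_radical => //.
  by rewrite !mulmxBl ePx -!mulmxA FM0 (addrC (A0 *m M0)) addrK subrr.
have rD2 : radical_to EM (P - A0 *m F0).
  by rewrite -[P - _](subrK K0); apply: radical_to_add.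
have rq : req p (A0 *m F0 *m Q) pM.
  apply: (req_sym); split=> //; first exact: mhom_mul hAF hQ.
  by rewrite -PQ -mulmxBl; apply: radical_to_mx.
have [W [[hW _ _] _ WK]] := one_add_rad_inv pl rq.
exists F0, (Q *m W *m A0); split=> //.
  by apply: mhom_mul hA0; apply: mhom_mul hQ hW.
have -> : Q *m W *m A0 *m F0 = Q *m (W *m (A0 *m F0 *m Q)) *m P.
  by rewrite -!mulmxA QP hF0.2.
by rewrite WK hQ.2 QP.
Qed.

(** Dual to [epi_or_cogenerated]: a column [v] makes [N *m v] radical, and the columns of [Q] times
    [v'] serve as test maps. No [x] has to be cancelled, because [N0] already takes values in copies
    of [E]. *)
Lemma mono_or_split_epi b c (N : 'M[R]_(b, c)) : mhom EM pM N ->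
  (exists a (M : 'M[R]_(a, b)), mhom pM qM M /\ corr0 M N) \/
  forall b0 c0 (N0 : 'M[R]_(b0, c0)), mhom EM pM N0 -> homzeroN N N0 ->
    exists Z : 'M[R]_(c0, b0), mhom pM EM Z /\ N0 *m Z = EM.
Proof.
move=> hN.
have [[T [hT TN]]|[v [v' [hv hv' vv rv]]]] := mono_or_radical pl (free_obj_scalar b) hN.
  by left; apply: corr0_of_mono hT TN.
right=> b0 c0 N0 hN0 H.
have [P [Q [hP hQ PQ QP]]] := free_obj_scalar b0.
have cols i : exists (G : 'cV[R]_c0) (K : 'cV[R]_b0),
  [/\ mhom pM pM G, mhom EM pM K, (forall m (t : 'M[R]_(m, b0)), mhom pM EM t -> nonunit_mx p (t *m K)) & col i Q = N0 *m G + K].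
  have hr : mhom EM pM (col i Q).
    by apply/mhom_scalarP => i' j; rewrite mxE; move/mhom_scalarP: hQ.
  have [S [B [C [[hS _ _] hC eV]]]] := H _ (mhom_mul hr hv').
  exists (C *m v), (S *m N *m v); split.
  - exact: mhom_mul hC hv.
  - by apply: mhom_mul hv; apply: mhom_mul hS hN.
  - by move=> m t ht; rewrite !mulmxA; apply: rv; apply: mhom_mul ht hS.
  - by rewrite mulmxA addrC -mulmxDl -eV -mulmxA vv hr.2.
have [G hG] := fin_all_exists cols; have [K hK] := fin_all_exists hG.
pose G0 := \matrix_(i, j) G j i 0; pose K0 := \matrix_(i, j) K j i 0.
have rG i : col i G0 = G i by apply/colP=> j; rewrite !mxE.
have rK i : col i K0 = K i by apply/colP=> j; rewrite !mxE.
have cmul m n l (X : 'M[R]_(m, n)) (Y : 'M[R]_(n, l)) i : col i (X *m Y) = X *m col i Y.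
  by apply/colP=> j; rewrite !mxE; apply: eq_bigr => ? _; rewrite mxE.
have hG0 : mhom pM pM G0.
  by apply/mhom_scalarP => i j; rewrite mxE; have [/mhom_scalarP h _ _ _] := hK j.
have hK0 : mhom EM pM K0.
  by apply/mhom_scalarP => i j; rewrite mxE; have [_ /mhom_scalarP h _ _] := hK j.
have rK0 : nonunit_mx p (P *m K0).
  move=> i j; have [_ _ h _] := hK j; have := h _ P hP i 0.
  by rewrite -rK -cmul mxE.
have eQ : Q = N0 *m G0 + K0.
  apply/matrixP => i j; have [_ _ _ /matrixP /(_ i 0)] := hK j.
  by rewrite -rK -rG -cmul !mxE.
clearbody G0 K0.
have hNG := mhom_mul hN0 hG0.
have rq : req p (P *m (N0 *m G0)) pM.
  apply: req_sym; split=> //; first exact: mhom_mul hP hNG.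
  by rewrite -PQ eQ -mulmxBr addrC addKr.
have [W [[hW _ _] KW _]] := one_add_rad_inv pl rq.
exists (G0 *m W *m P); split; first by apply: mhom_mul hP; apply: mhom_mul hG0 hW.
have -> : N0 *m (G0 *m W *m P) = Q *m (P *m (N0 *m G0) *m W) *m P.
  by rewrite !mulmxA QP hN0.1.
by rewrite KW hQ.2 QP.
Qed.

(** As [F] is a split monomorphism, its target is the sum of the images of its first column, of its
    other columns and of a complement. In these coordinates one copy of the generator column stands
    alone, which indecomposability will exploit. *)
Lemma cogenerated_split a b (M : 'M[R]_(a, 1 + b)) : cogenerated M ->
  exists (M1 : 'M[R]_(ell, 1)) a2 (M2 : 'M[R]_(a2, b)),
    [/\ mhom pM qM M1, mhom pM qM M2 & isoM M (block_mx M1 0 0 M2)].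
Proof.
case=> F [T []]; rewrite -(hsubmxK F) -(vsubmxK T).
move: (lsubmx F) (rsubmx F) (usubmx T) (dsubmx T) => F1 F2 T1 T2 hF hT FM TF.
have [hF1 hF2] := mhom_rowK hF; have [hT1 hT2] := mhom_colK hT.
move: TF; rewrite mul_col_row scalar_mx_block => /eq_block_mx [T1F1 T1F2 T2F1 T2F2].
have eM : M = row_mx (F1 *m xM) (F2 *m xM).
  by rewrite -FM scalar_mx_block mul_row_block !mulmx0 addr0 add0r.
pose e := pM - F1 *m T1 - F2 *m T2.
have h1 := mhom_mul hF1 hT1; have h2 := mhom_mul hF2 hT2.
have he : mhom pM pM e by do 2 apply: mhom_sub => //.
have T1e : T1 *m e = 0.
  by rewrite !mulmxBr hT1.2 !mulmxA T1F1 T1F2 mul0mx subr0 hT1.1 subrr.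
have T2e : T2 *m e = 0.
  by rewrite !mulmxBr hT2.2 !mulmxA T2F2 T2F1 mul0mx subr0 hT2.1 subrr.
have ee : e *m e = e.
  by rewrite {1}/e !mulmxBl he.1 -!mulmxA T1e T2e !mulmx0 !subr0.
have eF1 : e *m F1 = 0.
  by rewrite !mulmxBl hF1.1 -!mulmxA T1F1 T2F1 mulmx0 subr0 hF1.2 subrr.
have eF2 : e *m F2 = 0.
  by rewrite !mulmxBl hF2.1 -!mulmxA T1F2 T2F2 mulmx0 subr0 hF2.2 subrr.
have [c [P' [Q' [hP' hQ' PQ' QP']]]] := free_obj_split pl (free_obj_id pl a) he ee.
have [P [Q [hP hQ PQ QP]]] := free_obj_scalar b.
have [P1 [Q1 [hP1 hQ1 PQ1 QP1]]] := freeE.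
have hP'' : mhom pM pM P' by split; [exact: hP'.1 | rewrite -hP'.2 -mulmxA he.2].
have hQ'' : mhom pM pM Q' by split; [rewrite -hQ'.1 mulmxA he.1 | exact: hQ'.2].
have P'F1 : P' *m F1 = 0 by rewrite -hP'.2 -mulmxA eF1 mulmx0.
have P'F2 : P' *m F2 = 0 by rewrite -hP'.2 -mulmxA eF2 mulmx0.
have T1Q' : T1 *m Q' = 0 by rewrite -hQ'.1 mulmxA T1e mul0mx.
have T2Q' : T2 *m Q' = 0 by rewrite -hQ'.1 mulmxA T2e mul0mx.
exists (P1 *m xM), (ell * b + c)%N, (col_mx (P *m xM) 0).
have hq0 m n : mhom pM qM (0 : 'M[R]_(m, n)) by exact: mhom0.
split.
- exact: mhom_mul hP1 (xM1 1).
- by apply: mhom_col => //; exact: mhom_mul hP (xM1 b).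
exists (col_mx (P1 *m T1) (col_mx (P *m T2) P')), (row_mx (F1 *m Q1) (row_mx (F2 *m Q) Q')), qM, qM.
split; first split=> //.
- apply: mhom_col; first exact: mhom_mul hP1 hT1.
  by apply: mhom_col => //; exact: mhom_mul hP hT2.
- apply: mhom_row; first exact: mhom_mul hF1 hQ1.
  by apply: mhom_row => //; exact: mhom_mul hF2 hQ.
split.
- rewrite !mul_col_row mul_mx_row mul_col_mx.
  rewrite !mulmxA -!(mulmxA P1) -!(mulmxA P).
  rewrite T1F1 T1F2 T2F1 T2F2 T1Q' T2Q' P'F1 P'F2 !mul0mx !mulmx0.
  rewrite hQ.1 hQ1.1 PQ PQ1 PQ' row_mx0 col_mx0 -!scalar_mx_block //.
- rewrite !mul_row_col QP' !mulmxA -(mulmxA F1) QP1 hF1.2 -(mulmxA F2) QP hF2.2.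
  by rewrite addrA addrC /e -[pM - _ - _]addrA -opprD subrK.
- by rewrite -scalar_mxM qq.
- by rewrite -scalar_mxM qq.
have hB : mhom pM qM (block_mx (P1 *m xM) 0 0 (col_mx (P *m xM) 0 : 'M_(ell * b + c, b))).
  apply: mhom_col; apply: mhom_row => //; first exact: mhom_mul hP1 (xM1 1).
  by apply: mhom_col => //; exact: mhom_mul hP (xM1 b).
rewrite hB.2 eM !mul_col_mx !mul_mx_row !mulmxA.
rewrite -!(mulmxA P1) -!(mulmxA P) T1F1 T1F2 T2F1 T2F2.
rewrite P'F1 P'F2 !mul0mx !mulmx0 (xM1 1).1 (xM1 b).1.
rewrite -[col_mx (row_mx 0 (P *m xM)) _]/(block_mx 0 (P *m xM) 0 0).
by rewrite block_mxEh col_mx0.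
Qed.

(** The same decomposition for the source of [N]. Only the [p] side changes coordinates, so the pair
    on the [E] side is the identity. *)
Lemma split_epi_split b c (N : 'M[R]_(1 + b, c)) (Z : 'M[R]_(c, 1 + b)) :
  mhom EM pM N -> mhom pM EM Z -> N *m Z = EM ->
  exists (N1 : 'M[R]_(1, ell)) c2 (N2 : 'M[R]_(b, c2)),
    [/\ mhom EM pM N1, mhom EM pM N2 & isoN N (block_mx N1 0 0 N2)].
Proof.
rewrite -(hsubmxK Z) -(vsubmxK N).
move: (lsubmx Z) (rsubmx Z) (usubmx N) (dsubmx N) => F1 F2 T1 T2 hT hF TF.
have [hF1 hF2] := mhom_rowK hF; have [hT1 hT2] := mhom_colK hT.
move: TF; rewrite mul_col_row scalar_mx_block => /eq_block_mx [T1F1 T1F2 T2F1 T2F2].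
pose e := pM - F1 *m T1 - F2 *m T2.
have h1 := mhom_mul hF1 hT1; have h2 := mhom_mul hF2 hT2.
have he : mhom pM pM e by do 2 apply: mhom_sub => //.
have T1e : T1 *m e = 0.
  by rewrite !mulmxBr hT1.2 !mulmxA T1F1 T1F2 mul0mx subr0 hT1.1 subrr.
have T2e : T2 *m e = 0.
  by rewrite !mulmxBr hT2.2 !mulmxA T2F2 T2F1 mul0mx subr0 hT2.1 subrr.
have ee : e *m e = e.
  by rewrite {1}/e !mulmxBl he.1 -!mulmxA T1e T2e !mulmx0 !subr0.
have eF1 : e *m F1 = 0.
  by rewrite !mulmxBl hF1.1 -!mulmxA T1F1 T2F1 mulmx0 subr0 hF1.2 subrr.
have eF2 : e *m F2 = 0.
  by rewrite !mulmxBl hF2.1 -!mulmxA T1F2 T2F2 mulmx0 subr0 hF2.2 subrr.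
have [c' [P' [Q' [hP' hQ' PQ' QP']]]] := free_obj_split pl (free_obj_id pl c) he ee.
have [P [Q [hP hQ PQ QP]]] := free_obj_scalar b.
have [P1 [Q1 [hP1 hQ1 PQ1 QP1]]] := freeE.
have hP'' : mhom pM pM P' by split; [exact: hP'.1 | rewrite -hP'.2 -mulmxA he.2].
have hQ'' : mhom pM pM Q' by split; [rewrite -hQ'.1 mulmxA he.1 | exact: hQ'.2].
have P'F1 : P' *m F1 = 0 by rewrite -hP'.2 -mulmxA eF1 mulmx0.
have P'F2 : P' *m F2 = 0 by rewrite -hP'.2 -mulmxA eF2 mulmx0.
have T1Q' : T1 *m Q' = 0 by rewrite -hQ'.1 mulmxA T1e mul0mx.
have T2Q' : T2 *m Q' = 0 by rewrite -hQ'.1 mulmxA T2e mul0mx.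
have hp0 m n : mhom EM pM (0 : 'M[R]_(m, n)) by exact: mhom0.
exists Q1, (ell * b + c')%N, (row_mx Q 0); split=> //.
  by apply: mhom_row.
have cid : cmat (EM : 'M_(1 + b)) qM by split=> //; rewrite (xM1 _).1 (xM1 _).2.
exists EM, qM, EM, qM, (col_mx (P1 *m T1) (col_mx (P *m T2) P')), (row_mx (F1 *m Q1) (row_mx (F2 *m Q) Q')).
split; first split=> //.
- apply: mhom_col; first exact: mhom_mul hP1 hT1.
  by apply: mhom_col => //; exact: mhom_mul hP hT2.
- apply: mhom_row; first exact: mhom_mul hF1 hQ1.
  by apply: mhom_row => //; exact: mhom_mul hF2 hQ.
split; first by rewrite -!scalar_mxM EE qq.
split.
- rewrite !mul_col_row mul_mx_row mul_col_mx.
  rewrite !mulmxA -!(mulmxA P1) -!(mulmxA P).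
  rewrite T1F1 T1F2 T2F1 T2F2 T1Q' T2Q' P'F1 P'F2 !mul0mx !mulmx0.
  rewrite hQ.1 hQ1.1 PQ PQ1 PQ' row_mx0 col_mx0 -!scalar_mx_block //.
- rewrite !mul_row_col QP' !mulmxA -(mulmxA F1) QP1 hF1.2 -(mulmxA F2) QP hF2.2.
  by rewrite addrA addrC /e -[pM - _ - _]addrA -opprD subrK.
rewrite hT.1 mul_block_col !mul0mx addr0 add0r mul_row_col mul0mx addr0 !mulmxA.
by rewrite QP1 QP hT1.1 hT2.1.
Qed.

Lemma corr0_block a b c a' b' c' (M : 'M[R]_(a, b)) (N : 'M[R]_(b, c))
    (M' : 'M[R]_(a', b')) (N' : 'M[R]_(b', c')) :
  corr0 M N -> corr0 M' N' -> corr0 (block_mx M 0 0 M') (block_mx N 0 0 N').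
Proof.
case=> F [S [T [[hF hS hT hN] [FM FS FN TN e]]]].
case=> F' [S' [T' [[hF' hS' hT' hN'] [FM' FS' FN' TN' e']]]].
have hz (e1 e2 : R) m n : mhom e1%:M e2%:M (0 : 'M[R]_(m, n)) by exact: mhom0.
exists (block_mx F 0 0 F'), (block_mx S 0 0 S'), (block_mx T 0 0 T'); split.
  by split; apply: mhom_col; apply: mhom_row.
by split; rewrite ?(@scalar_mx_block _ b b') ?(@scalar_mx_block _ a a')
  ?(@scalar_mx_block _ c c') !mulmx_block ?add_block_mx !mulmx0 !mul0mx
  ?addr0 ?add0r ?FM ?FM' ?FS ?FS' ?FN ?FN' ?TN ?TN' ?e ?e' ?block_mx0.
Qed.

(** Invertibility of a pair is decided by its second component. For matrices of size one this makes
    the corner of pairs local. *)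
Lemma cmat_inv b (K B B' : 'M[R]_b) : cmat K B -> mhom qM qM B' -> B *m B' = qM ->
  B' *m B = qM -> exists K', [/\ cmat K' B', K *m K' = EM & K' *m K = EM].
Proof.
move=> cK hB' BB' B'B; have [K1 cK1] := cmat_lift hB'.
have cKK := cmat_mul cK cK1; rewrite BB' in cKK.
have cKK' := cmat_mul cK1 cK; rewrite B'B in cKK'.
have [W1 [hW1 KW1 _]] := cmat_id_inv cKK.
have [W2 [hW2 _ WK2]] := cmat_id_inv cKK'.
have [hK hB Kx] := cK; have [hK1 _ _] := cK1.
have [K' EK'] : exists K', K' = K1 *m W1 by eexists.
have hK' : mhom EM EM K' by rewrite EK'; exact: mhom_mul hK1 hW1.
have KK' : K *m K' = EM by rewrite EK' mulmxA.
have K'K : K' *m K = EM.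
  have eW : W2 *m K1 = K'.
    by rewrite -(mhom_mul hW2 hK1).2 -KK' !mulmxA -(mulmxA W2 K1 K) WK2 hK'.1.
  by rewrite -eW -mulmxA.
exists K'; split=> //; split=> //.
by rewrite -{1}(xM1 b).2 -BB' !mulmxA -(mulmxA K') -Kx mulmxA K'K (xM1 b).1.
Qed.

(** The condition on [M] alone under which a partner exists; unlike [corr0] it can be passed to
    direct summands. *)
Definition epi_type a b (M : 'M[R]_(a, b)) := exists (F : 'M[R]_(a, b)) (S : 'M[R]_(b, a)),
  [/\ mhom pM EM F, mhom EM pM S, F *m xM = M & F *m S = pM].

Definition mono_type b c (N : 'M[R]_(b, c)) := exists T : 'M[R]_(c, b),
  mhom pM EM T /\ T *m N = pM.

Lemma corr0_epi a b c (M : 'M[R]_(a, b)) (N : 'M[R]_(b, c)) : corr0 M N -> epi_type M.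
Proof. by case=> F [S [T [[hF hS hT hN] [FM FS FN TN e]]]]; exists F, S. Qed.

Lemma corr0_mono a b c (M : 'M[R]_(a, b)) (N : 'M[R]_(b, c)) : corr0 M N -> mono_type N.
Proof. by case=> F [S [T [[hF hS hT hN] [FM FS FN TN e]]]]; exists T. Qed.

Lemma mono_type_retract b c b' c' (N : 'M[R]_(b, c)) (N' : 'M[R]_(b', c'))
    (Si : 'M[R]_(b, b')) (Ci : 'M[R]_(c, c')) (Cp : 'M[R]_(c', c)) :
  mhom EM EM Si -> mhom pM pM Ci -> mhom pM pM Cp -> Si *m N' = N *m Ci -> Cp *m Ci = pM ->
  mono_type N -> mono_type N'.
Proof.
move=> hS hC hC' SN CC [T [hT TN]]; exists (Cp *m T *m Si); split.
  by apply: mhom_mul hS; exact: mhom_mul hC' hT.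
by rewrite -!mulmxA SN (mulmxA T) TN hC.1.
Qed.

(** The retraction lifts to the [E] side only up to matrices killed by [x]. The transported lift and
    the transported section therefore compose to the identity only modulo the radical, and an
    invertible factor repairs this. *)
Lemma epi_type_retract a b a' b' (M : 'M[R]_(a, b)) (M' : 'M[R]_(a', b'))
    (Xi : 'M[R]_(a, a')) (Xp : 'M[R]_(a', a)) (Yi : 'M[R]_(b, b')) (Yp : 'M[R]_(b', b)) :
  mhom pM pM Xi -> mhom pM pM Xp -> mhom qM qM Yi -> mhom qM qM Yp -> mhom pM qM M' ->
  Xi *m M' = M *m Yi -> Xp *m M = M' *m Yp -> Xp *m Xi = pM -> Yp *m Yi = qM ->
  epi_type M -> epi_type M'.
Proof.
move=> hXi hXp hYi hYp hM' XM XM' XX YY [F [S [hF hS FM FS]]].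
have [Ki [hKi _ Kix]] := cmat_lift hYi; have [Kp [hKp _ Kpx]] := cmat_lift hYp.
have hF' : mhom pM EM (Xp *m F *m Ki) by apply: mhom_mul hKi; exact: mhom_mul hXp hF.
have Fx : Xp *m F *m Ki *m xM = M'.
  by rewrite -!mulmxA Kix (mulmxA F) FM (mulmxA Xp) XM' -mulmxA YY hM'.2.
have hS' : mhom EM pM (Kp *m S *m Xi) by apply: mhom_mul hXi; exact: mhom_mul hKp hS.
have hFK := mhom_mul hF (mhom_mul hKi hKp).
have hXF := mhom_mul (mhom_mul hXi hXp) hF.
have hD : mhom pM EM (F *m (Ki *m Kp) - Xi *m Xp *m F) by exact: mhom_sub.
have rD : radical_to EM (F *m (Ki *m Kp) - Xi *m Xp *m F).
  apply: kills_radical => //.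
  rewrite mulmxBl -!mulmxA Kpx (mulmxA Ki) Kix !mulmxA FM -XM.
  by rewrite -!(mulmxA Xi) -XM' -(mulmxA Xp F) FM !mulmxA subrr.
have hXD := mhom_mul hXp hD.
have rq : req p (Xp *m F *m Ki *m (Kp *m S *m Xi)) pM.
  split=> //; first exact: mhom_mul hF' hS'.
  have -> : Xp *m F *m Ki *m (Kp *m S *m Xi) - pM =
     Xp *m ((F *m (Ki *m Kp) - Xi *m Xp *m F) *m (S *m Xi)).
    rewrite mulmxBl mulmxBr -!mulmxA (mulmxA F S) FS hXi.1 XX (mulmxA Xp Xi) XX.
    by rewrite -scalar_mxM pl.1 !mulmxA.
  apply: (rad_mull pl) => //.
    by apply: mhom_mul hD _; exact: mhom_mul hS hXi.
  by apply: radical_to_mx => //; exact: mhom_mul hS hXi.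
have [W [[hW _ _] KW _]] := one_add_rad_inv pl rq.
exists (Xp *m F *m Ki), (Kp *m S *m Xi *m W); split=> //; first exact: mhom_mul hS' hW.
by rewrite mulmxA.
Qed.

End Correspondence.

(** * Two-term complexes up to homotopy *)

Lemma list_choice (X Y : Type) (x0 : X) (y0 : Y) (P : X -> Y -> Prop) s :
  (forall i, (i < size s)%N -> exists y, P (nth x0 s i) y) ->
  exists r, size r = size s /\
    forall i, (i < size s)%N -> P (nth x0 s i) (nth y0 r i).
Proof.
elim: s => [|x s IH] h; first by exists [::].
have [r [sz hr]] := IH (fun i hi => h i.+1 hi).
have [y hy] := h 0%N isT.
by exists (y :: r); split=> [|[|i]] //=; [rewrite sz | exact: hr].
Qed.

Lemma no_index (s : seq bool) (i : 'I_(size s)) : s = [::] -> False.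
Proof. by move=> e; case: i; rewrite e. Qed.

Section Complexes.
Variables (k : fieldType) (A : falgType k) (e1 e2 : A).
Hypothesis e11 : e1 * e1 = e1.
Hypothesis e22 : e2 * e2 = e2.

Local Notation idem := (idem e1 e2).
Local Notation id_ := (idmx e1 e2).
Local Notation cx := (cx A).

Lemma idem_idem b : idem b * idem b = idem b.
Proof. by case: b. Qed.

Lemma mul_idmx s n (M : 'M[A]_(size s, n)) i j :
  (id_ s *m M) i j = idem (nth false s i) * M i j.
Proof.
rewrite mxE (bigD1 i) //= big1 ?addr0 ?mxE ?eqxx // => l /negPf li.
by rewrite mxE eq_sym li mul0r.
Qed.

Lemma mulmx_id s n (M : 'M[A]_(n, size s)) i j :
  (M *m id_ s) i j = M i j * idem (nth false s j).
Proof.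
rewrite mxE (bigD1 j) //= big1 ?addr0 ?mxE ?eqxx // => l /negPf li.
by rewrite mxE li mulr0.
Qed.

Lemma is_homP s t (M : 'M[A]_(size t, size s)) :
  is_hom e1 e2 M <-> mhom (id_ t) (id_ s) M.
Proof.
split=> [h|[h1 h2] i j].
  split; apply/matrixP => i j; rewrite ?mul_idmx ?mulmx_id {1}h ?mulrA.
    by rewrite idem_idem -h.
  by rewrite -!mulrA idem_idem mulrA -h.
by rewrite -{1}h2 -{1}h1 mulmx_id mul_idmx.
Qed.

Lemma idmx_hom s : mhom (id_ s) (id_ s) (id_ s).
Proof.
by split; apply/matrixP => i j; rewrite mul_idmx mxE; case: eqP => [->|]; rewrite ?idem_idem ?mulr0.
Qed.
Hint Resolve idmx_hom : core.

Record cobj := CObj { cobj_cx :> cx; cobj_wf : wf e1 e2 cobj_cx }.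

Lemma cd_hom (T : cobj) : mhom (id_ (c0 T)) (id_ (cm1 T)) (cd T).
Proof. by apply/is_homP; apply: cobj_wf. Qed.
Hint Resolve cd_hom : core.

Record mor (T U : cobj) := Mor {
  m1 : 'M[A]_(size (cm1 U), size (cm1 T));
  m0 : 'M[A]_(size (c0 U), size (c0 T));
  m1_hom : mhom (id_ (cm1 U)) (id_ (cm1 T)) m1;
  m0_hom : mhom (id_ (c0 U)) (id_ (c0 T)) m0;
  m_comm : m0 *m cd T = cd U *m m1 }.
Arguments m1 {T U}. Arguments m0 {T U}.
Arguments m1_hom {T U}. Arguments m0_hom {T U}. Arguments m_comm {T U}.

Definition ht T U (f g : mor T U) :=
  exists h, [/\ mhom (id_ (cm1 U)) (id_ (c0 T)) h,
    m1 f - m1 g = h *m cd T & m0 f - m0 g = cd U *m h].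

Lemma ht_eq T U (f g : mor T U) : m1 f = m1 g -> m0 f = m0 g -> ht f g.
Proof.
by move=> h1 h0; exists 0; rewrite h1 h0 !subrr mul0mx mulmx0; split=> //; exact: mhom0.
Qed.

Local Notation "f =h g" := (ht f g) (at level 70).

#[local] Instance ht_equiv T U : Equivalence (@ht T U).
Proof.
split.
- by move=> f; apply: ht_eq.
- move=> f g [h [a b c]]; exists (- h); split; first exact: mhom_opp.
    by rewrite mulNmx -b opprB.
  by rewrite mulmxN -c opprB.
- move=> f g l [h [a b c]] [h' [a' b' c']]; exists (h + h'); split.
  + exact: mhom_add.
  + by rewrite mulmxDl -b -b' addrA subrK.
  + by rewrite mulmxDr -c -c' addrA subrK.
Qed.

Lemma ht_refl T U (f : mor T U) : f =h f.
Proof. reflexivity. Qed.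
Hint Resolve ht_refl : core.

Program Definition idm T : mor T T := @Mor T T (id_ (cm1 T)) (id_ (c0 T)) _ _ _.
Next Obligation. by rewrite (cd_hom T).1 (cd_hom T).2. Qed.

Program Definition mcomp T U V (g : mor U V) (f : mor T U) : mor T V :=
  @Mor T V (m1 g *m m1 f) (m0 g *m m0 f) _ _ _.
Next Obligation. by apply: mhom_mul (m1_hom g) (m1_hom f). Qed.
Next Obligation. by apply: mhom_mul (m0_hom g) (m0_hom f). Qed.
Next Obligation. by rewrite -mulmxA m_comm !mulmxA m_comm. Qed.

Program Definition addm T U (g f : mor T U) : mor T U :=
  @Mor T U (m1 g + m1 f) (m0 g + m0 f) _ _ _.
Next Obligation. by apply: mhom_add (m1_hom g) (m1_hom f). Qed.
Next Obligation. by apply: mhom_add (m0_hom g) (m0_hom f). Qed.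
Next Obligation. by rewrite mulmxDl mulmxDr !m_comm. Qed.

Program Definition zerom T U : mor T U := @Mor T U 0 0 _ _ _.
Next Obligation. exact: mhom0. Qed.
Next Obligation. exact: mhom0. Qed.
Next Obligation. by rewrite mul0mx mulmx0. Qed.

Local Notation "g ** f" := (mcomp g f) (at level 40, left associativity).
Local Notation "0m" := (zerom _ _).
Local Notation "1m" := (idm _).

#[local] Instance comp_proper T U V :
  Proper (@ht U V ==> @ht T U ==> @ht T V) (@mcomp T U V).
Proof.
move=> g g' [h [a b c]] f f' [h' [a' b' c']].
exists (h *m m0 f + m1 g' *m h'); split.
- by apply: mhom_add; [exact: mhom_mul a (m0_hom f) | exact: mhom_mul (m1_hom g') a'].
- rewrite /= mulmxDl -mulmxA m_comm mulmxA -b -mulmxA -b' mulmxBl mulmxBr.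
  by rewrite addrA subrK.
- rewrite /= mulmxDr !mulmxA -c -m_comm -mulmxA -c' mulmxBl mulmxBr.
  by rewrite addrA subrK.
Qed.

#[local] Instance addm_proper T U :
  Proper (@ht T U ==> @ht T U ==> @ht T U) (@addm T U).
Proof.
move=> g g' [h [a b c]] f f' [h' [a' b' c']]; exists (h + h'); split.
- exact: mhom_add.
- by rewrite /= mulmxDl -b -b' opprD addrACA.
- by rewrite /= mulmxDr -c -c' opprD addrACA.
Qed.

Lemma compA T U V W (h : mor V W) (g : mor U V) (f : mor T U) : h ** (g ** f) =h h ** g ** f.
Proof. by apply: ht_eq; rewrite /= mulmxA. Qed.
Lemma comp1m T U (f : mor T U) : 1m ** f =h f.
Proof. by apply: ht_eq; rewrite /= ?(m1_hom f).1 ?(m0_hom f).1. Qed.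
Lemma compm1 T U (f : mor T U) : f ** 1m =h f.
Proof. by apply: ht_eq; rewrite /= ?(m1_hom f).2 ?(m0_hom f).2. Qed.
Lemma comp0m T U V (f : mor T U) : (0m : mor U V) ** f =h 0m.
Proof. by apply: ht_eq; rewrite /= mul0mx. Qed.
Lemma compm0 T U V (f : mor U V) : f ** (0m : mor T U) =h 0m.
Proof. by apply: ht_eq; rewrite /= mulmx0. Qed.
Lemma compDl T U V (f g : mor U V) (h : mor T U) : addm f g ** h =h addm (f ** h) (g ** h).
Proof. by apply: ht_eq; rewrite /= mulmxDl. Qed.
Lemma compDr T U V (f g : mor T U) (h : mor U V) : h ** addm f g =h addm (h ** f) (h ** g).
Proof. by apply: ht_eq; rewrite /= mulmxDr. Qed.
Lemma addm0 T U (f : mor T U) : addm f 0m =h f.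
Proof. by apply: ht_eq; rewrite /= addr0. Qed.
Lemma add0m T U (f : mor T U) : addm 0m f =h f.
Proof. by apply: ht_eq; rewrite /= add0r. Qed.

Lemma compK W W' W'' W3 (y : mor W' W3) (z : mor W W') (w : mor W'' W) (v : mor W'' W') :
  z ** w =h v -> y ** z ** w =h y ** v.
Proof. by move=> h; rewrite -compA h. Qed.

Definition iso (T U : cobj) := exists (f : mor T U) (g : mor U T),
  g ** f =h 1m /\ f ** g =h 1m.

Lemma cx_isoP (T U : cobj) : cx_iso e1 e2 T U <-> iso T U.
Proof.
split.
  case=> f1 [f0 [g1 [g0 [[a [b c]] [[a' [b' c']] [[h [h1 [h2 h3]]] [h' [h1' [h2' h3']]]]]]]]].
  exists (Mor ((is_homP _).1 a) ((is_homP _).1 b) c).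
  exists (Mor ((is_homP _).1 a') ((is_homP _).1 b') c'); split.
    by exists h; split=> //; apply/is_homP.
  by exists h'; split=> //; apply/is_homP.
case=> f [g [[h [h1 h2 h3]] [h' [h1' h2' h3']]]].
exists (m1 f), (m0 f), (m1 g), (m0 g); split.
  split; first by apply/is_homP; apply: m1_hom.
  by split; [apply/is_homP; apply: m0_hom | apply: m_comm].
split.
  split; first by apply/is_homP; apply: m1_hom.
  by split; [apply/is_homP; apply: m0_hom | apply: m_comm].
split; first by exists h; split=> //; apply/is_homP.
by exists h'; split=> //; apply/is_homP.
Qed.

Lemma iso_refl T : iso T T.
Proof. by exists 1m, 1m; split; apply: comp1m. Qed.

Lemma iso_sym T U : iso T U -> iso U T.
Proof. by case=> f [g [a b]]; exists g, f. Qed.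

Lemma iso_trans T U V : iso T U -> iso U V -> iso T V.
Proof.
case=> f [g [a b]] [f' [g' [a' b']]]; exists (f' ** f), (g ** g'); split.
  by setoid_rewrite compA; setoid_rewrite <- (compA g g' f'); setoid_rewrite a';
     setoid_rewrite compm1.
by setoid_rewrite compA; setoid_rewrite <- (compA f' f g); setoid_rewrite b;
   setoid_rewrite compm1.
Qed.

(** The injections and projections absorb the casts along [size_cat], so that maps between direct
    sums can be handled by the biproduct equations. *)
Definition in_l s t : 'M[A]_(size (s ++ t), size s) :=
  castmx (esym (size_cat s t), erefl) (col_mx (id_ s) 0).
Definition in_r s t : 'M[A]_(size (s ++ t), size t) :=
  castmx (esym (size_cat s t), erefl) (col_mx 0 (id_ t)).
Definition pr_l s t : 'M[A]_(size s, size (s ++ t)) :=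
  castmx (erefl, esym (size_cat s t)) (row_mx (id_ s) 0).
Definition pr_r s t : 'M[A]_(size t, size (s ++ t)) :=
  castmx (erefl, esym (size_cat s t)) (row_mx 0 (id_ t)).

Lemma idmx_cat s t : id_ (s ++ t) =
  castmx (esym (size_cat s t), esym (size_cat s t)) (block_mx (id_ s) 0 0 (id_ t)).
Proof.
apply/matrixP => i j; rewrite castmxE mxE /= nth_cat.
rewrite -(inj_eq (@cast_ord_inj _ _ (esym (esym (size_cat s t))))).
set i' := cast_ord _ i; set j' := cast_ord _ j.
rewrite -[nat_of_ord i]/(nat_of_ord i').
case: (split_ordP i') => u ->; case: (split_ordP j') => v ->.
- by rewrite block_mxEul mxE (inj_eq (@lshift_inj _ _)).
- by rewrite block_mxEur mxE eq_lrshift.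
- by rewrite block_mxEdl mxE eq_rlshift.
- by rewrite block_mxEdr mxE (inj_eq (@rshift_inj _ _)) /= addKn.
Qed.

Lemma prl_inl s t : pr_l s t *m in_l s t = id_ s.
Proof.
rewrite /pr_l /in_l; move: (size (s ++ t)) (esym (size_cat s t)) => n e.
by case: n / e; rewrite !castmx_id mul_row_col mulmx0 addr0 (idmx_hom s).1.
Qed.
Lemma prr_inr s t : pr_r s t *m in_r s t = id_ t.
Proof.
rewrite /pr_r /in_r; move: (size (s ++ t)) (esym (size_cat s t)) => n e.
by case: n / e; rewrite !castmx_id mul_row_col mulmx0 add0r (idmx_hom t).1.
Qed.
Lemma prl_inr s t : pr_l s t *m in_r s t = 0.
Proof.
rewrite /pr_l /in_r; move: (size (s ++ t)) (esym (size_cat s t)) => n e.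
by case: n / e; rewrite !castmx_id mul_row_col mulmx0 mul0mx addr0.
Qed.
Lemma prr_inl s t : pr_r s t *m in_l s t = 0.
Proof.
rewrite /pr_r /in_l; move: (size (s ++ t)) (esym (size_cat s t)) => n e.
by case: n / e; rewrite !castmx_id mul_row_col mulmx0 mul0mx addr0.
Qed.
Lemma in_pr s t : in_l s t *m pr_l s t + in_r s t *m pr_r s t = id_ (s ++ t).
Proof.
rewrite idmx_cat /pr_l /in_l /pr_r /in_r.
move: (size (s ++ t)) (esym (size_cat s t)) => n e.
case: n / e; rewrite !castmx_id !mul_col_row add_block_mx !mulmx0 !mul0mx !addr0 !add0r.
by rewrite (idmx_hom s).1 (idmx_hom t).1.
Qed.

Lemma in_l_hom s t : mhom (id_ (s ++ t)) (id_ s) (in_l s t).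
Proof.
have h : in_l s t *m id_ s = in_l s t.
  rewrite /in_l; move: (size (s ++ t)) (esym (size_cat s t)) => n e.
  by case: n / e; rewrite castmx_id mul_col_mx mul0mx (idmx_hom s).1.
by split=> //; rewrite -in_pr mulmxDl -!mulmxA prl_inl prr_inl mulmx0 addr0.
Qed.
Lemma in_r_hom s t : mhom (id_ (s ++ t)) (id_ t) (in_r s t).
Proof.
have h : in_r s t *m id_ t = in_r s t.
  rewrite /in_r; move: (size (s ++ t)) (esym (size_cat s t)) => n e.
  by case: n / e; rewrite castmx_id mul_col_mx mul0mx (idmx_hom t).1.
by split=> //; rewrite -in_pr mulmxDl -!mulmxA prl_inr prr_inr mulmx0 add0r.
Qed.
Lemma pr_l_hom s t : mhom (id_ s) (id_ (s ++ t)) (pr_l s t).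
Proof.
have h : id_ s *m pr_l s t = pr_l s t.
  rewrite /pr_l; move: (size (s ++ t)) (esym (size_cat s t)) => n e.
  by case: n / e; rewrite castmx_id mul_mx_row mulmx0 (idmx_hom s).1.
by split=> //; rewrite -in_pr mulmxDr !mulmxA prl_inl prl_inr mul0mx addr0.
Qed.
Lemma pr_r_hom s t : mhom (id_ t) (id_ (s ++ t)) (pr_r s t).
Proof.
have h : id_ t *m pr_r s t = pr_r s t.
  rewrite /pr_r; move: (size (s ++ t)) (esym (size_cat s t)) => n e.
  by case: n / e; rewrite castmx_id mul_mx_row mulmx0 (idmx_hom t).1.
by split=> //; rewrite -in_pr mulmxDr !mulmxA prr_inl prr_inr mul0mx add0r.
Qed.
Hint Resolve in_l_hom in_r_hom pr_l_hom pr_r_hom : core.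

Lemma cd_dsum (T U : cobj) : cd (dsum T U) =
  in_l _ _ *m cd T *m pr_l _ _ + in_r _ _ *m cd U *m pr_r _ _.
Proof.
rewrite /= /pr_l /in_l /pr_r /in_r.
move: (size (c0 T ++ c0 U)) (esym (size_cat (c0 T) (c0 U))) => n e.
move: (size (cm1 T ++ cm1 U)) (esym (size_cat (cm1 T) (cm1 U))) => n' e'.
case: n / e; case: n' / e'; rewrite !castmx_id !mul_col_mx !mul0mx.
rewrite !mul_mx_row !mulmx0 add_col_mx addr0 add0r.
by rewrite (cd_hom T).1 (cd_hom T).2 (cd_hom U).1 (cd_hom U).2.
Qed.

Lemma dsum_wf (T U : cobj) : wf e1 e2 (dsum T U).
Proof.
apply/is_homP; rewrite cd_dsum; apply: mhom_add.
  by apply: mhom_mul (pr_l_hom _ _); apply: mhom_mul (in_l_hom _ _) (cd_hom T).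
by apply: mhom_mul (pr_r_hom _ _); apply: mhom_mul (in_r_hom _ _) (cd_hom U).
Qed.

Definition dsum_obj (T U : cobj) := CObj (@dsum_wf T U).

Program Definition inl_m T U : mor T (dsum_obj T U) :=
  @Mor T (dsum_obj T U) (in_l _ _) (in_l _ _) _ _ _.
Next Obligation.
have /= -> := cd_dsum T U; rewrite mulmxDl -!mulmxA prl_inl prr_inl !mulmx0 addr0.
by rewrite (cd_hom T).2.
Qed.
Program Definition inr_m T U : mor U (dsum_obj T U) :=
  @Mor U (dsum_obj T U) (in_r _ _) (in_r _ _) _ _ _.
Next Obligation.
have /= -> := cd_dsum T U; rewrite mulmxDl -!mulmxA prl_inr prr_inr !mulmx0 add0r.
by rewrite (cd_hom U).2.
Qed.
Program Definition prl_m T U : mor (dsum_obj T U) T :=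
  @Mor (dsum_obj T U) T (pr_l _ _) (pr_l _ _) _ _ _.
Next Obligation.
have /= -> := cd_dsum T U; rewrite mulmxDr !mulmxA prl_inl prl_inr !mul0mx addr0.
by rewrite (cd_hom T).1.
Qed.
Program Definition prr_m T U : mor (dsum_obj T U) U :=
  @Mor (dsum_obj T U) U (pr_r _ _) (pr_r _ _) _ _ _.
Next Obligation.
have /= -> := cd_dsum T U; rewrite mulmxDr !mulmxA prr_inl prr_inr !mul0mx add0r.
by rewrite (cd_hom U).1.
Qed.

(** Unlike the concrete [dsum], this notion is invariant under isomorphism in the homotopy category,
    so decompositions can be transported. *)
Definition biproduct (X U V : cobj) :=
  exists (i1 : mor U X) (p1 : mor X U) (i2 : mor V X) (p2 : mor X V),
  [/\ p1 ** i1 =h 1m, p2 ** i2 =h 1m, p1 ** i2 =h 0m & p2 ** i1 =h 0m] /\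
  addm (i1 ** p1) (i2 ** p2) =h 1m.

Lemma biproduct_dsum T U : biproduct (dsum_obj T U) T U.
Proof.
exists (inl_m T U), (prl_m T U), (inr_m T U), (prr_m T U).
split; last by apply: ht_eq; rewrite /= in_pr.
by split; apply: ht_eq; rewrite /= ?prl_inl ?prr_inr ?prl_inr ?prr_inl.
Qed.

Lemma biproduct_iso_summands X U V U' V' : biproduct X U V -> iso U U' -> iso V V' ->
  biproduct X U' V'.
Proof.
case=> i1 [p1 [i2 [p2 [[a b c d] e]]]] [f [g [gf fg]]] [f' [g' [gf' fg']]].
exists (i1 ** g), (f ** p1), (i2 ** g'), (f' ** p2).
split; first split.
- by rewrite compA (compK _ a) compm1.
- by rewrite compA (compK _ b) compm1.
- by rewrite compA (compK _ c) compm0 comp0m.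
- by rewrite compA (compK _ d) compm0 comp0m.
rewrite !compA (compK _ gf) (compK _ gf') !compm1.
exact: e.
Qed.

Lemma biproduct_iso X X' U V : biproduct X U V -> iso X X' -> biproduct X' U V.
Proof.
case=> i1 [p1 [i2 [p2 [[a b c d] e]]]] [f [g [gf fg]]].
exists (f ** i1), (p1 ** g), (f ** i2), (p2 ** g).
split; first by split; rewrite compA (compK _ gf) compm1.
by rewrite !compA -!(compA f) -compDr -compDl e comp1m.
Qed.

Lemma biproduct_unique X X' U V : biproduct X U V -> biproduct X' U V -> iso X X'.
Proof.
case=> i1 [p1 [i2 [p2 [[a b c d] e]]]] [j1 [q1 [j2 [q2 [[a' b' c' d'] e']]]]].
exists (addm (j1 ** p1) (j2 ** p2)), (addm (i1 ** q1) (i2 ** q2)); split.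
  rewrite compDl !compDr !compA (compK _ a') (compK _ b').
  by rewrite (compK _ c') (compK _ d') !compm1 !compm0 !comp0m addm0 add0m.
rewrite compDl !compDr !compA (compK _ a) (compK _ b).
by rewrite (compK _ c) (compK _ d) !compm1 !compm0 !comp0m addm0 add0m.
Qed.

Lemma zero_wf : wf e1 e2 (@zero_cx k A).
Proof. by case. Qed.
Definition zero_obj := CObj zero_wf.

Lemma iso_zeroP T : iso T zero_obj <-> (1m : mor T T) =h 0m.
Proof.
split=> [[f [g [gf _]]]|h].
  rewrite -gf; apply: ht_eq; apply/matrixP => i j; by rewrite !mxE big_ord0.
exists 0m, 0m; split; first by rewrite compm0 h.
by apply: ht_eq; apply/matrixP => -[].
Qed.

Definition indec (T : cobj) := ~ iso T zero_obj /\
  forall U V, biproduct T U V -> iso U zero_obj \/ iso V zero_obj.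

Lemma indecomposableP (T : cobj) : indecomposable e1 e2 T <-> indec T.
Proof.
have z (U : cobj) : cx_iso e1 e2 U (@zero_cx k A) <-> iso U zero_obj := cx_isoP U zero_obj.
split=> [[n h]|[n h]].
  split; first by move/z.
  move=> U V b; case: (h U V (@cobj_wf U) (@cobj_wf V)) => [|/z|/z]; try by [left|right].
  apply/(cx_isoP T (dsum_obj U V)); exact: biproduct_unique b (biproduct_dsum U V).
split; first by move/z.
move=> U V wU wV /(cx_isoP T (dsum_obj (CObj wU) (CObj wV))) i.
have b := biproduct_iso (biproduct_dsum _ _) (iso_sym i).
by case: (h _ _ b) => /(z (CObj _)); [left|right].
Qed.

Lemma indec_iso T T' : iso T T' -> indec T -> indec T'.
Proof.
move=> i [n h]; split; first by move=> i'; apply: n; apply: iso_trans i i'.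
move=> U V b; apply: h; exact: biproduct_iso b (iso_sym i).
Qed.

(** A decomposition yields the idempotent [i1 ** p1]: if it is zero the first summand is zero, and
    if it is the identity the second is. *)
Lemma indec_of_idempotents T : ~ iso T zero_obj ->
  (forall e : mor T T, e ** e =h e -> e =h 0m \/ e =h 1m) -> indec T.
Proof.
move=> n H; split=> // U V [i1 [p1 [i2 [p2 [[a b c d] e]]]]].
have ee : (i1 ** p1) ** (i1 ** p1) =h i1 ** p1.
  by rewrite compA (compK _ a) compm1.
case: (H _ ee) => h; [left|right]; apply/iso_zeroP.
  have E : p1 ** (i1 ** p1) ** i1 =h 1m by rewrite compA a comp1m a.
  by rewrite -E h compm0 comp0m.
have E : p2 ** (i1 ** p1) ** i2 =h 0m by rewrite compA d !comp0m.
by rewrite -E h compm1 b.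
Qed.

Definition homzero (T U : cobj) := forall f, mhom (id_ (c0 U)) (id_ (cm1 T)) f ->
  exists h1 h0, [/\ mhom (id_ (cm1 U)) (id_ (cm1 T)) h1,
    mhom (id_ (c0 U)) (id_ (c0 T)) h0 & f = cd U *m h1 + h0 *m cd T].

Lemma presiltingP (T : cobj) : presilting e1 e2 T <-> homzero T T.
Proof.
split=> h f /is_homP /h [h1 [h0]].
  by case=> /is_homP a [/is_homP b c]; exists h1, h0.
by case=> /is_homP a /is_homP b c; exists h1, h0.
Qed.

(** The map is transported to [T] and [U], decomposed there and transported back. The composites are
    identities only up to the homotopies [k'] and [l], which account for the two correction
    terms. *)
Lemma homzero_retract T T' U U' (a : mor T T') (a' : mor T' T) (b : mor U U') (b' : mor U' U) :
  a ** a' =h 1m -> b ** b' =h 1m -> homzero T U -> homzero T' U'.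
Proof.
move=> [k' [hk' k1 _]] [l [hl _ l0]] H f hf; rewrite /= in k1 l0.
have [h1 [h0 [H1 H0 ef]]] := H _ (mhom_mul (mhom_mul (m0_hom b') hf) (m1_hom a)).
exists (m1 b *m h1 *m m1 a' - l *m f), (m0 b *m h0 *m m0 a' - m0 b *m m0 b' *m f *m k').
split.
- apply: mhom_sub; last exact: mhom_mul hl hf.
  by apply: mhom_mul (m1_hom a'); apply: mhom_mul (m1_hom b) H1.
- apply: mhom_sub.
    by apply: mhom_mul (m0_hom a'); apply: mhom_mul (m0_hom b) H0.
  apply: mhom_mul hk'; apply: mhom_mul hf; exact: mhom_mul (m0_hom b) (m0_hom b').
have E : m0 b *m (m0 b' *m f *m m1 a) *m m1 a' =
    cd U' *m (m1 b *m h1 *m m1 a') + m0 b *m h0 *m m0 a' *m cd T'.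
  rewrite ef mulmxDr mulmxDl !mulmxA (m_comm b).
  by rewrite -!mulmxA (m_comm a') !mulmxA.
rewrite mulmxBr mulmxBl addrACA -E (mulmxA (cd U')) -l0 -(mulmxA _ k') -k1.
rewrite mulmxBl mulmxBr hf.1 -(mulmxA _ f (id_ _)) hf.2 !opprB !mulmxA.
by rewrite (addrA (f - _)) subrK addrC subrK.
Qed.

Lemma homzero_iso T T' U U' : iso T T' -> iso U U' -> homzero T U -> homzero T' U'.
Proof. by case=> a [a' [_ h]] [b [b' [_ h']]]; apply: homzero_retract h h'. Qed.

Lemma homzero_dsum_l T U W :
  homzero (dsum_obj T U) W <-> homzero T W /\ homzero U W.
Proof.
have r X Y (i : mor X Y) (p : mor Y X) : p ** i =h 1m -> homzero Y W -> homzero X W.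
  by move=> h; apply: homzero_retract h (comp1m 1m).
split=> [h|[hT hU] f hf].
  split; first apply: (r _ _ (inl_m T U) (prl_m T U)) h.
    by apply: ht_eq; rewrite /= prl_inl.
  by apply: (r _ _ (inr_m T U) (prr_m T U)) h; apply: ht_eq; rewrite /= prr_inr.
have [h1 [h0 [a b c]]] := hT _ (mhom_mul hf (in_l_hom (cm1 T) (cm1 U))).
have [h1' [h0' [a' b' c']]] := hU _ (mhom_mul hf (in_r_hom (cm1 T) (cm1 U))).
exists (h1 *m pr_l _ _ + h1' *m pr_r _ _), (h0 *m pr_l _ _ + h0' *m pr_r _ _); split.
- by apply: mhom_add; [exact: mhom_mul a (pr_l_hom _ _) | exact: mhom_mul a' (pr_r_hom _ _)].
- by apply: mhom_add; [exact: mhom_mul b (pr_l_hom _ _) | exact: mhom_mul b' (pr_r_hom _ _)].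
have E1 := m_comm (prl_m T U); have E2 := m_comm (prr_m T U).
rewrite -{1}hf.2 /= -in_pr mulmxDr !mulmxA c c' mulmxDl (mulmxDr (cd W)) mulmxDl.
rewrite (mulmxDl (cd W *m h1')) addrACA -!(mulmxA h0) -!(mulmxA h0') -E1 -E2 /=.
by rewrite !mulmxA.
Qed.

Lemma homzero_dsum_r T U W :
  homzero W (dsum_obj T U) <-> homzero W T /\ homzero W U.
Proof.
have r X Y (i : mor X Y) (p : mor Y X) : p ** i =h 1m -> homzero W Y -> homzero W X.
  by move=> h; apply: homzero_retract (comp1m 1m) h.
split=> [h|[hT hU] f hf].
  split; first apply: (r _ _ (inl_m T U) (prl_m T U)) h.
    by apply: ht_eq; rewrite /= prl_inl.
  by apply: (r _ _ (inr_m T U) (prr_m T U)) h; apply: ht_eq; rewrite /= prr_inr.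
have [h1 [h0 [a b c]]] := hT _ (mhom_mul (pr_l_hom (c0 T) (c0 U)) hf).
have [h1' [h0' [a' b' c']]] := hU _ (mhom_mul (pr_r_hom (c0 T) (c0 U)) hf).
exists (in_l _ _ *m h1 + in_r _ _ *m h1'), (in_l _ _ *m h0 + in_r _ _ *m h0'); split.
- by apply: mhom_add; [exact: mhom_mul (in_l_hom _ _) a | exact: mhom_mul (in_r_hom _ _) a'].
- by apply: mhom_add; [exact: mhom_mul (in_l_hom _ _) b | exact: mhom_mul (in_r_hom _ _) b'].
have E1 := m_comm (inl_m T U); have E2 := m_comm (inr_m T U).
rewrite -{1}hf.1 /= -in_pr mulmxDl -!mulmxA c c' !mulmxDr !mulmxDl !mulmxA -E1 -E2 /=.
by rewrite addrACA.
Qed.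

Fixpoint bigsum_obj (Os : seq cobj) : cobj :=
  if Os is T :: Os' then dsum_obj T (bigsum_obj Os') else zero_obj.

Lemma bigsum_objE Os : cobj_cx (bigsum_obj Os) = bigsum (map cobj_cx Os).
Proof. by elim: Os => //= T Os ->. Qed.

Lemma homzero_bigsum_l Os W : homzero (bigsum_obj Os) W <->
  forall i, (i < size Os)%N -> homzero (nth zero_obj Os i) W.
Proof.
elim: Os => [|T Os IH].
  split=> // _ f _; exists 0, 0; split; [exact: mhom0|exact: mhom0|].
  by apply/matrixP => i [].
rewrite homzero_dsum_l IH; split=> [[h h'] [|i]|h] //; first exact: h'.
by split; [exact: (h 0%N) | move=> i; exact: (h i.+1)].
Qed.

Lemma homzero_bigsum_r Os W : homzero W (bigsum_obj Os) <->
  forall i, (i < size Os)%N -> homzero W (nth zero_obj Os i).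
Proof.
elim: Os => [|T Os IH].
  split=> // _ f _; exists 0, 0; split; [exact: mhom0|exact: mhom0|].
  by apply/matrixP => -[].
rewrite homzero_dsum_r IH; split=> [[h h'] [|i]|h] //; first exact: h'.
by split; [exact: (h 0%N) | move=> i; exact: (h i.+1)].
Qed.

(** The presilting condition on the sum is spread over pairs of summands, because the correspondence
    acts on each summand separately. *)
Definition presilting_family (Os : seq cobj) :=
  [/\ forall i, (i < size Os)%N -> indec (nth zero_obj Os i),
      forall i j, (i < size Os)%N -> (j < size Os)%N -> i <> j ->
        ~ iso (nth zero_obj Os i) (nth zero_obj Os j)
    & forall i j, (i < size Os)%N -> (j < size Os)%N ->
        homzero (nth zero_obj Os i) (nth zero_obj Os j)].

Lemma presilting_familyP Os :
  basic_presilting e1 e2 (map cobj_cx Os) <-> presilting_family Os.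
Proof.
have nthE i : nth (zero_cx A) (map cobj_cx Os) i = cobj_cx (nth zero_obj Os i).
  case: (ltnP i (size Os)) => hi; first exact: nth_map.
  by rewrite !nth_default ?size_map.
have H : presilting e1 e2 (bigsum (map cobj_cx Os)) <->
    forall i j, (i < size Os)%N -> (j < size Os)%N ->
        homzero (nth zero_obj Os i) (nth zero_obj Os j).
  rewrite -bigsum_objE presiltingP homzero_bigsum_l; split=> h i; last first.
    by move=> hi; apply/homzero_bigsum_r => j hj; exact: h.
  by move=> j hi hj; exact: (homzero_bigsum_r _ _).1 (h i hi) j hj.
rewrite /basic_presilting size_map; split.
  case=> h1 [h2 /H h3]; split=> //.
    by move=> i /h1; rewrite nthE => -[_ /indecomposableP].
  by move=> i j hi hj ij /cx_isoP; rewrite -!nthE; apply: h2.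
case=> h1 h2 h3; split; last first.
  by split; [move=> i j hi hj ij; rewrite !nthE => /cx_isoP; apply: h2 | apply/H].
by move=> i hi; rewrite nthE; split; [apply: cobj_wf | apply/indecomposableP; apply: h1].
Qed.

Lemma gfanP C : gfan e1 e2 C <-> exists Os, presilting_family Os /\
  set_eq C (cone_gen (map (fun T : cobj => gvec T) Os)).
Proof.
split; last first.
  case=> Os [/presilting_familyP h hC]; exists (map cobj_cx Os); split=> //.
  by rewrite -map_comp.
case=> Ts [h hC].
have [Os E] : exists Os, Ts = map cobj_cx Os.
  have : forall i, (i < size Ts)%N -> wf e1 e2 (nth (zero_cx A) Ts i).
    by move=> i hi; case: h => /(_ i hi) [].
  elim: (Ts) => [|T Ts' IH] hw; first by exists [::].
  have [Os ->] := IH (fun i hi => hw i.+1 hi).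
  have wT : wf e1 e2 T := hw 0%N isT.
  by exists (CObj wT :: Os).
move: h hC; rewrite E => /presilting_familyP h; rewrite -map_comp => hC.
by exists Os.
Qed.

(** * Minimal complexes over a triangular algebra and their classification *)

Hypothesis loc1 : local_idem e1.
Hypothesis loc2 : local_idem e2.
Hypothesis tri : forall z, e2 * z * e1 = 0.

Lemma idem_local b : local_idem (idem b).
Proof. by case: b. Qed.

Lemma hom_corner s t (M : 'M[A]_(size t, size s)) (i : 'I_(size t)) (j : 'I_(size s)) : mhom (id_ t) (id_ s) M ->
  corner (idem (nth false t i)) (idem (nth false s j)) (M i j).
Proof. by case=> a b; split; [rewrite -mul_idmx a | rewrite -mulmx_id b]. Qed.

(** One of the two factors lies in the zero corner. *)
Lemma cross_zero s t a b : corner (idem t) (idem s) a -> corner (idem s) (idem t) b ->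
  s <> t -> a * b = 0.
Proof.
move=> /corner_eq <- /corner_eq <-; case: s t => [] [] //= _; rewrite tri ?mulr0 ?mul0r //.
Qed.

Lemma nonunit_prod s t a b : corner (idem t) (idem s) a -> corner (idem s) (idem t) b ->
  (s = t -> ~ corner_unit (idem t) a \/ ~ corner_unit (idem t) b) ->
  ~ corner_unit (idem t) (a * b).
Proof.
move=> ca cb H; case: (eqVneq s t) => [st|/eqP st].
  subst s; case: (H erefl) => h /(corner_unit_mul (idem_local t) ca cb) [] //.
by rewrite (cross_zero ca cb st); apply: corner_unit0; apply: idem_local.
Qed.

(** The differential is radical. Only entries between equal labels have to be tested, since a map
    between different projectives is never invertible here. *)
Definition minimal (T : cobj) := forall (i : 'I_(size (c0 T))) (j : 'I_(size (cm1 T))),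
  nth false (c0 T) i = nth false (cm1 T) j -> ~ corner_unit (idem (nth false (c0 T) i)) (cd T i j).

Lemma cd_nonunit (T : cobj) t (i : 'I_(size (c0 T))) (j : 'I_(size (cm1 T))) : minimal T -> nth false (c0 T) i = t ->
  nth false (cm1 T) j = t -> ~ corner_unit (idem t) (cd T i j).
Proof. by move=> h <- e; apply: h. Qed.

(** If [U] lacked the label [t], the diagonal entry of [g ** f] at such a label would vanish, and
    the homotopy would write [- idem t] as an entry of [cd T *m h], a nonunit by minimality. *)
Lemma minimal_retract_c0 T U (f : mor T U) (g : mor U T) : minimal T -> g ** f =h 1m ->
  {subset c0 T <= c0 U}.
Proof.
move=> mT [h [hh _ E]] t /(nthP false) [i' hi' it]; apply: contraT => tU; exfalso.
pose i := Ordinal hi'; rewrite -[i']/(val i) in it.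
have lt := idem_local t.
have /(corner_unitN) : corner_unit (idem t) (idem t) by apply: corner_unit_id.
suff : ~ corner_unit (idem t) (- idem t) by [].
have -> : - idem t = (cd T *m h) i i.
  rewrite -E /= !mxE eqxx it big1 ?sub0r // => m _.
  apply: (@cross_zero (nth false (c0 U) m) t).
  - by have := hom_corner i m (m0_hom g); rewrite it.
  - by have := hom_corner m i (m0_hom f); rewrite it.
  - by move=> mt; case/negP: tU; rewrite -mt mem_nth.
rewrite mxE => /(corner_unit_sum lt) [] => [m|m].
  apply: (corner_mul (f := idem (nth false (cm1 T) m))).
    by have := hom_corner i m (cd_hom T); rewrite it.
  by have := hom_corner m i hh; rewrite it.
apply: (@nonunit_prod (nth false (cm1 T) m) t).
- by have := hom_corner i m (cd_hom T); rewrite it.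
- by have := hom_corner m i hh; rewrite it.
- by move=> mt; left; apply: cd_nonunit.
Qed.

Lemma minimal_retract_cm1 T U (f : mor T U) (g : mor U T) : minimal T -> g ** f =h 1m ->
  {subset cm1 T <= cm1 U}.
Proof.
move=> mT [h [hh E _]] t /(nthP false) [i' hi' it]; apply: contraT => tU; exfalso.
pose i := Ordinal hi'; rewrite -[i']/(val i) in it.
have lt := idem_local t.
have /(corner_unitN) : corner_unit (idem t) (idem t) by apply: corner_unit_id.
suff : ~ corner_unit (idem t) (- idem t) by [].
have -> : - idem t = (h *m cd T) i i.
  rewrite -E /= !mxE eqxx it big1 ?sub0r // => m _.
  apply: (@cross_zero (nth false (cm1 U) m) t).
  - by have := hom_corner i m (m1_hom g); rewrite it.
  - by have := hom_corner m i (m1_hom f); rewrite it.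
  - by move=> mt; case/negP: tU; rewrite -mt mem_nth.
rewrite mxE => /(corner_unit_sum lt) [] => [m|m].
  apply: (corner_mul (f := idem (nth false (c0 T) m))).
    by have := hom_corner i m hh; rewrite it.
  by have := hom_corner m i (cd_hom T); rewrite it.
apply: (@nonunit_prod (nth false (c0 T) m) t).
- by have := hom_corner i m hh; rewrite it.
- by have := hom_corner m i (cd_hom T); rewrite it.
- by move=> mt; right; apply: cd_nonunit.
Qed.

Lemma minimal_iso_labels T U : minimal T -> iso T U ->
  {subset c0 T <= c0 U} /\ {subset cm1 T <= cm1 U}.
Proof.
move=> mT [f [g [gf _]]]; split; [exact: minimal_retract_c0 gf | exact: minimal_retract_cm1 gf].
Qed.

Lemma minimal_iso_zero T : minimal T -> iso T zero_obj -> c0 T = [::] /\ cm1 T = [::].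
Proof.
move=> mT /(minimal_iso_labels mT) [h0 h1]; split.
  by case: (c0 T) h0 => // a s /(_ a (mem_head _ _)).
by case: (cm1 T) h1 => // a s /(_ a (mem_head _ _)).
Qed.

(** The matrix unit between the two occurrences of [t] would be a combination of the differentials,
    whose entries at equal labels are nonunits by minimality. *)
Lemma homzero_disjoint T U t : minimal T -> minimal U -> homzero T U ->
  t \in cm1 T -> t \in c0 U -> False.
Proof.
move=> mT mU H /(nthP false) [j' hj' jt] /(nthP false) [i' hi' it].
pose i := Ordinal hi'; rewrite -[i']/(val i) in it.
pose j := Ordinal hj'; rewrite -[j']/(val j) in jt.
have lt := idem_local t.
pose f : 'M[A]_(size (c0 U), size (cm1 T)) :=
  \matrix_(a, b) if (a == i) && (b == j) then idem t else 0.
have hf : mhom (id_ (c0 U)) (id_ (cm1 T)) f.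
  split; apply/matrixP => a b; rewrite ?mul_idmx ?mulmx_id mxE; case: andP => [[/eqP ea /eqP eb]|_];
    by rewrite ?ea ?eb ?it ?jt ?mulr0 ?mul0r // idem_idem.
have [h1 [h0 [hh1 hh0 /matrixP /(_ i j)]]] := H f hf.
rewrite [in LHS]mxE !eqxx /= [in RHS]mxE => E.
have : corner_unit (idem t) (idem t) by apply: corner_unit_id.
have C1 (m : 'I_(size (cm1 U))) : corner (idem t) (idem (nth false (cm1 U) m)) (cd U i m).
  by have := hom_corner i m (cd_hom U); rewrite it.
have C2 (m : 'I_(size (cm1 U))) : corner (idem (nth false (cm1 U) m)) (idem t) (h1 m j).
  by have := hom_corner m j hh1; rewrite jt.
have C3 (m : 'I_(size (c0 T))) : corner (idem t) (idem (nth false (c0 T) m)) (h0 i m).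
  by have := hom_corner i m hh0; rewrite it.
have C4 (m : 'I_(size (c0 T))) : corner (idem (nth false (c0 T) m)) (idem t) (cd T m j).
  by have := hom_corner m j (cd_hom T); rewrite jt.
rewrite {2}E !mxE; case/(corner_unit_add lt).
- by apply: corner_sum => m _; apply: corner_mul (C1 m) (C2 m).
- by apply: corner_sum => m _; apply: corner_mul (C3 m) (C4 m).
- case/(corner_unit_sum lt) => [m|m]; first exact: corner_mul (C1 m) (C2 m).
  by apply: (nonunit_prod (C1 m) (C2 m)) => mt; left; apply: cd_nonunit.
- case/(corner_unit_sum lt) => [m|m]; first exact: corner_mul (C3 m) (C4 m).
  by apply: (nonunit_prod (C3 m) (C4 m)) => mt; right; apply: cd_nonunit.
Qed.

Lemma idmx_cons t s : id_ (t :: s) = block_mx (idem t)%:M 0 0 (id_ s) :> 'M_(1 + size s).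
Proof.
apply/matrixP => i j; rewrite -(splitK i) -(splitK j).
case: (split i) => u; case: (split j) => v /=.
- by rewrite block_mxEul !mxE !ord1.
- by rewrite block_mxEur !mxE ord1.
- by rewrite block_mxEdl !mxE ord1.
- by rewrite block_mxEdr !mxE -!val_eqE /=.
Qed.

Definition unit_mx s (i : 'I_(size s)) : 'M[A]_(size s) :=
  \matrix_(a, b) if (a == i) && (b == i) then idem (nth false s i) else 0.

(** [K] and [P] include and project the summands other than [i]. Knowing [s'] up to permutation
    suffices, because g-vectors only count labels. *)
Lemma delete_label s (i : 'I_(size s)) : exists s' (K : 'M[A]_(size s, size s'))
    (P : 'M[A]_(size s', size s)),
  [/\ perm_eq s (nth false s i :: s'), mhom (id_ s) (id_ s') K, mhom (id_ s') (id_ s) P,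
      P *m K = id_ s' & K *m P + unit_mx i = id_ s].
Proof.
elim: s i => [[]//|t s IH] i.
have ht : mhom (idem t)%:M (idem t)%:M ((idem t)%:M : 'M_1).
  by apply: mhom_scalar_id; exact: idem_idem.
have bB m n l (X : 'M[A]_(m, n)) (Y : 'M[A]_(n, l)) Z : X *m Y = Z ->
  (block_mx (idem t)%:M 0 0 X : 'M_(1 + m, 1 + n)) *m (block_mx (idem t)%:M 0 0 Y : 'M_(1 + n, 1 + l))
  = block_mx (idem t)%:M 0 0 Z.
  by move=> XY; rewrite mulmx_block !mulmx0 !mul0mx !addr0 !add0r ht.1 XY.
case: (unliftP ord0 i) => [i0|] ->; last first.
  exists s, (col_mx 0 (id_ s) : 'M_(1 + size s, _)), (row_mx 0 (id_ s) : 'M_(_, 1 + size s)).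
  have [h1 h2] := idmx_hom s.
  have hB : (block_mx (idem t)%:M 0 0 (id_ s) : 'M_(1 + size s)) *m col_mx (0 : 'M_(1, _)) (id_ s)
    = col_mx 0 (id_ s) by rewrite mul_block_col !mulmx0 mul0mx !add0r h1.
  have hB' : row_mx (0 : 'M_(_, 1)) (id_ s) *m (block_mx (idem t)%:M 0 0 (id_ s) : 'M_(1 + size s))
    = row_mx 0 (id_ s) by rewrite mul_row_block !mulmx0 mul0mx !add0r h1.
  have hC : col_mx (0 : 'M_(1, _)) (id_ s) *m id_ s = col_mx 0 (id_ s).
    by rewrite mul_col_mx mul0mx h1.
  have hC' : id_ s *m row_mx (0 : 'M_(_, 1)) (id_ s) = row_mx 0 (id_ s).
    by rewrite mul_mx_row mulmx0 h1.
  have hD : row_mx (0 : 'M_(_, 1)) (id_ s) *m col_mx (0 : 'M_(1, _)) (id_ s) = id_ s.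
    by rewrite mul_row_col mulmx0 add0r.
  have hD' : col_mx (0 : 'M_(1, _)) (id_ s) *m row_mx (0 : 'M_(_, 1)) (id_ s) = block_mx 0 0 0 (id_ s).
    by rewrite mul_col_row !mulmx0 mul0mx h1.
  split=> //=.
  - by split; [rewrite idmx_cons; exact: hB | exact: hC].
  - by split; [exact: hC' | rewrite idmx_cons; exact: hB'].
  - rewrite idmx_cons; transitivity ((block_mx 0 0 0 (id_ s) : 'M_(1 + size s)) + (unit_mx (s := t :: s) ord0 : 'M_(1 + size s))).
      by congr (_ + _); exact: hD'.
    have -> : unit_mx (s := t :: s) ord0 = block_mx (idem t)%:M 0 0 0 :> 'M_(1 + size s).
      apply/matrixP => a b; rewrite -(splitK a) -(splitK b).
      case: (split a) => u; case: (split b) => v /=.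
      + by rewrite block_mxEul !mxE !ord1.
      + by rewrite block_mxEur !mxE ord1.
      + by rewrite block_mxEdl !mxE.
      + by rewrite block_mxEdr !mxE.
    by rewrite add_block_mx !addr0 !add0r.
have [s' [K [P [ps hK hP PK KP]]]] := IH i0.
exists (t :: s'), (block_mx (idem t)%:M 0 0 K : 'M_(1 + size s, 1 + size s')),
  (block_mx (idem t)%:M 0 0 P : 'M_(1 + size s', 1 + size s)).
split=> /=.
- apply: (@perm_trans _ (t :: nth false s i0 :: s')); first by rewrite perm_cons.
  by apply/permP => a /=; rewrite addnCA.
- by split; rewrite !idmx_cons; [exact: (bB _ _ _ _ _ _ hK.1) | exact: (bB _ _ _ _ _ _ hK.2)].
- by split; rewrite !idmx_cons; [exact: (bB _ _ _ _ _ _ hP.1) | exact: (bB _ _ _ _ _ _ hP.2)].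
- by rewrite !idmx_cons; exact: (bB _ _ _ _ _ _ PK).
- rewrite idmx_cons; transitivity ((block_mx (idem t)%:M 0 0 (K *m P) : 'M_(1 + size s)) + (unit_mx (s := t :: s) (lift ord0 i0) : 'M_(1 + size s))).
    by congr (_ + _); exact: (bB _ _ _ _ _ _ erefl).
  have -> : unit_mx (s := t :: s) (lift ord0 i0) = block_mx 0 0 0 (unit_mx i0) :> 'M_(1 + size s).
    apply/matrixP => a b; rewrite -(splitK a) -(splitK b).
    case: (split a) => u; case: (split b) => v /=.
    + by rewrite block_mxEul !mxE ord1.
    + by rewrite block_mxEur !mxE ord1.
    + by rewrite block_mxEdl !mxE (ord1 v) andbC.
    + by rewrite block_mxEdr !mxE -!val_eqE /=.
  by rewrite add_block_mx !addr0 ?add0r KP.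
Qed.

Lemma split_label s (i : 'I_(size s)) t : nth false s i = t ->
  exists s' (K : 'M[A]_(size s, size s')) (P : 'M[A]_(size s', size s))
    (D : 'M[A]_(size s, 1)) (D' : 'M[A]_(1, size s)),
  [/\ perm_eq s (t :: s'), mhom (id_ s) (id_ s') K, mhom (id_ s') (id_ s) P,
      mhom (id_ s) (idem t)%:M D & mhom (idem t)%:M (id_ s) D'] /\
  [/\ P *m K = id_ s', K *m P + D *m D' = id_ s, P *m D = 0, D' *m K = 0 &
   (forall n (M : 'M[A]_(size s, n)), D' *m M = idem t *: row i M) /\
   (forall n (M : 'M[A]_(n, size s)) a, (M *m D) a 0 = M a i * idem t)].
Proof.
move=> it; have [s' [K [P [ps hK hP PK KP]]]] := delete_label i; rewrite it in ps.
pose D : 'M[A]_(size s, 1) := \col_a if a == i then idem t else 0.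
pose D' : 'M[A]_(1, size s) := \row_a if a == i then idem t else 0.
have D'M n (M : 'M[A]_(size s, n)) : D' *m M = idem t *: row i M.
  apply/rowP => a; rewrite !mxE (bigD1 i) //= big1 => [|b /negPf bi]; last by rewrite mxE bi mul0r.
  by rewrite mxE eqxx addr0.
have MD n (M : 'M[A]_(n, size s)) a : (M *m D) a 0 = M a i * idem t.
  rewrite !mxE (bigD1 i) //= big1 => [|b /negPf bi]; last by rewrite mxE bi mulr0.
  by rewrite mxE eqxx addr0.
have hD : mhom (id_ s) (idem t)%:M D.
  split; apply/matrixP => a b; rewrite ?mul_idmx ?mulmx_scalar !mxE; case: eqP => [ea|_];
    by rewrite ?ea ?it ?idem_idem ?mulr0 ?mul0r.
have hD' : mhom (idem t)%:M (id_ s) D'.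
  split; apply/matrixP => a b; rewrite ?mul_scalar_mx ?mulmx_id !mxE; case: eqP => [ea|_];
    by rewrite ?ea ?it ?idem_idem ?mulr0 ?mul0r.
have DD : D *m D' = unit_mx i.
  apply/matrixP => a b; rewrite !mxE big_ord1 !mxE it.
  by case: eqP => _; case: eqP => _; rewrite ?mulr0 ?mul0r ?idem_idem.
have D'D : D' *m D = (idem t)%:M.
  by apply/matrixP => a b; rewrite !ord1 MD !mxE eqxx idem_idem eqxx.
have KP' : K *m P + D *m D' = id_ s by rewrite DD.
exists s', K, P, D, D'; split=> //; split=> //.
  have : P *m (K *m P + D *m D') *m D = P *m D by rewrite KP' hP.2.
  rewrite mulmxDr mulmxDl !mulmxA PK hP.1 -!mulmxA D'D hD.2 => h.
  by apply: (addrI (P *m D)); rewrite h addr0.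
have : D' *m (K *m P + D *m D') *m K = D' *m K by rewrite KP' hD'.2.
rewrite mulmxDr mulmxDl !mulmxA -(mulmxA _ P K) PK -(mulmxA D' K) hK.2 D'D hD'.1 => h.
by apply: (addrI (D' *m K)); rewrite h addr0.
Qed.

Lemma gvec_perm (T U : cobj) t : perm_eq (c0 T) (t :: c0 U) -> perm_eq (cm1 T) (t :: cm1 U) ->
  gvec U = gvec T.
Proof.
move=> /permP h0 /permP h1; rewrite /gvec !h0 !h1 /= !plus_INR.
by congr pair; set a := INR _; set b := INR _; set c := INR _; rewrite /Rminus; ring.
Qed.

(** Gaussian elimination: a unit entry of the differential splits off a contractible summand, and
    the Schur complement [d - d *m h *m d] is the differential on the rest. *)
Lemma cancel_unit (T : cobj) (i : 'I_(size (c0 T))) (j : 'I_(size (cm1 T))) :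
  nth false (c0 T) i = nth false (cm1 T) j ->
  corner_unit (idem (nth false (c0 T) i)) (cd T i j) ->
  exists T' : cobj, [/\ (size (c0 T') < size (c0 T))%N, gvec T' = gvec T & iso T T'].
Proof.
have [t it] : exists t, nth false (c0 T) i = t by eexists.
rewrite it => /esym jt [y [cy [dy yd]]].
have [r [K0 [P0 [D0 [D0' [[pr hK0 hP0 hD0 hD0'] [PK0 KP0 PD0 DK0 [D0M _]]]]]]]] := split_label it.
have [s [K1 [P1 [D1 [D1' [[ps hK1 hP1 hD1 hD1'] [PK1 KP1 PD1 DK1 [_ MD1]]]]]]]] := split_label jt.
have hd := cd_hom T; have [d Ed] : exists d, d = cd T by eexists.
rewrite -Ed in hd dy yd.
have cd_ij : corner (idem t) (idem t) (d i j) by have := hom_corner i j hd; rewrite it jt.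
have u : D0' *m d *m D1 = (d i j)%:M.
  by apply/matrixP => a b; rewrite !ord1 MD1 D0M !mxE /= cd_ij.1 cd_ij.2.
(* The inverse of the pivot, sent from position [i] back to position [j]. Up to sign it is also the
   homotopy that makes the elimination an equivalence. *)
have [h Eh] : exists h, h = D1 *m y%:M *m D0' by eexists.
have hy : mhom (idem t)%:M (idem t)%:M (y%:M : 'M_1).
  by apply/mhom_scalarP => a b; rewrite !ord1 mxE eqxx.
have hh : mhom (id_ (cm1 T)) (id_ (c0 T)) h.
  by rewrite Eh; apply: mhom_mul hD0'; apply: mhom_mul hD1 hy.
have hdD : h *m d *m D1 = D1.
  by rewrite Eh -!mulmxA (mulmxA D0') u -scalar_mxM yd hD1.2.
have Ddh : D0' *m d *m h = D0'.
  by rewrite Eh !mulmxA u -scalar_mxM dy hD0'.1.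
have hK0z : h *m K0 = 0 by rewrite Eh -mulmxA DK0 mulmx0.
have P1h : P1 *m h = 0 by rewrite Eh !mulmxA PD1 !mul0mx.
pose D := d - d *m h *m d.
have hDh : mhom (id_ (c0 T)) (id_ (cm1 T)) D.
  by apply: mhom_sub => //; exact: (mhom_mul (mhom_mul hd hh) hd).
have DKP : D *m K1 *m P1 = D.
  rewrite -mulmxA -[K1 *m P1](addrK (D1 *m D1')) KP1 mulmxBr hDh.2 mulmxA.
  by rewrite /D mulmxBl -(mulmxA d h) -(mulmxA d _ D1) hdD subrr mul0mx subr0.
have KPD : K0 *m (P0 *m D) = D.
  rewrite mulmxA -[K0 *m P0](addrK (D0 *m D0')) KP0 mulmxBl hDh.1 -mulmxA.
  by rewrite /D mulmxBr !mulmxA Ddh subrr mulmx0 subr0.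
have w' : wf e1 e2 (Cx (P0 *m D *m K1)).
  by apply/is_homP; apply: mhom_mul hK1; apply: mhom_mul hP0 hDh.
exists (CObj w'); split => /=.
- by rewrite (perm_size pr).
- exact: (@gvec_perm T (CObj w') t pr ps).
have f0h : mhom (id_ r) (id_ (c0 T)) (P0 *m (id_ (c0 T) - d *m h)).
  by apply: mhom_mul hP0 _; apply: mhom_sub => //; apply: mhom_mul hd hh.
have g1h : mhom (id_ (cm1 T)) (id_ s) ((id_ (cm1 T) - h *m d) *m K1).
  by apply: mhom_mul hK1; apply: mhom_sub => //; apply: mhom_mul hh hd.
have fc : P0 *m (id_ (c0 T) - d *m h) *m cd T = P0 *m D *m K1 *m P1.
  by rewrite -!mulmxA (mulmxA D) DKP -Ed mulmxBl hd.1.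
have gc : K0 *m (P0 *m D *m K1) = cd T *m ((id_ (cm1 T) - h *m d) *m K1).
  by rewrite -(mulmxA P0) !mulmxA -(mulmxA K0) KPD -Ed mulmxBr hd.2 mulmxA.
have z1 : (id_ (cm1 T) - h *m d) *m D1 = 0 by rewrite mulmxBl hdD hD1.1 subrr.
have z0 : D0' *m (id_ (c0 T) - d *m h) = 0 by rewrite mulmxBr mulmxA Ddh hD0'.2 subrr.
exists (@Mor T (CObj w') _ _ hP1 f0h fc), (@Mor (CObj w') T _ _ g1h hK0 gc); split.
  exists (- h); split=> /=; first exact: mhom_opp.
    rewrite -mulmxA -[K1 *m P1](addrK (D1 *m D1')) KP1 mulmxBr (mulmxA _ D1) z1 mul0mx.
    rewrite subr0 mulmxBl (idmx_hom _).1 (mhom_mul hh hd).2 addrAC subrr add0r.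
    by rewrite mulNmx Ed.
  rewrite mulmxA -[K0 *m P0](addrK (D0 *m D0')) KP0 mulmxBl -(mulmxA D0) z0 mulmx0.
  rewrite subr0 mulmxBr (idmx_hom _).1 (mhom_mul hd hh).1 addrAC subrr add0r.
  by rewrite mulmxN Ed.
apply: ht_eq => /=.
  by rewrite mulmxA mulmxBr hP1.2 mulmxA P1h mul0mx subr0 PK1.
by rewrite -mulmxA mulmxBl hK0.1 -mulmxA hK0z mulmx0 subr0 PK0.
Qed.

Lemma exists_minimal (T : cobj) : exists T' : cobj, [/\ minimal T', gvec T' = gvec T & iso T T'].
Proof.
have [n] := ubnP (size (c0 T)); elim: n T => // n IH T ltn.
case: (classic (minimal T)) => [mT|]; first by exists T; split=> //; exact: iso_refl.
move=> nm; have [i [j [ij u]]] : exists (i : 'I_(size (c0 T))) (j : 'I_(size (cm1 T))),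
    nth false (c0 T) i = nth false (cm1 T) j /\
    corner_unit (idem (nth false (c0 T) i)) (cd T i j).
  apply: NNPP => h; apply: nm => i j ij u; apply: h; by exists i, j.
have [T' [lt gT iT]] := cancel_unit ij u.
have [T'' [mT gT' iT']] := IH T' (leq_trans lt ltn).
by exists T''; split=> //; [rewrite gT' | exact: iso_trans iT iT'].
Qed.

Lemma family_iso Os Ss : size Ss = size Os ->
  (forall i, (i < size Os)%N -> iso (nth zero_obj Os i) (nth zero_obj Ss i)) ->
  presilting_family Os -> presilting_family Ss.
Proof.
move=> sz H [h1 h2 h3]; split; rewrite sz.
- by move=> i hi; apply: indec_iso (H i hi) (h1 i hi).
- move=> i j hi hj ij isoij; apply: (h2 i j hi hj ij).
  exact: iso_trans (iso_trans (H i hi) isoij) (iso_sym (H j hj)).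
- by move=> i j hi hj; apply: homzero_iso (H i hi) (H j hj) (h3 i j hi hj).
Qed.

Lemma family_minimal Os : presilting_family Os -> exists Ss,
  [/\ presilting_family Ss, map (fun T : cobj => gvec T) Ss = map (fun T : cobj => gvec T) Os &
    forall i, (i < size Ss)%N -> minimal (nth zero_obj Ss i)].
Proof.
move=> h.
have [Ss [sz hS]] := @list_choice cobj cobj zero_obj zero_obj
  (fun O T => [/\ minimal T, gvec T = gvec O & iso O T]) Os
  (fun i _ => exists_minimal (nth zero_obj Os i)).
exists Ss; split.
- by apply: family_iso h => // i /hS [].
- apply: (@eq_from_nth _ (R0, R0)); rewrite ?size_map // => i hi.
  rewrite !(nth_map zero_obj) -?sz //; by have [] := hS i; rewrite -?sz.
- by move=> i; rewrite sz => /hS [].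
Qed.

(** Complexes with g-vector in the fourth quadrant and nothing cancelled: copies of [e2 A] in degree
    -1 and of [e1 A] in degree 0. *)
Definition plus_minus (T : cobj) := all negb (c0 T) /\ all id (cm1 T).

Lemma plus_minus_label0 (T : cobj) (i : 'I_(size (c0 T))) : plus_minus T -> nth false (c0 T) i = false.
Proof. by case=> /(all_nthP false) /(_ i (ltn_ord i)) /negbTE. Qed.

Lemma plus_minus_label1 (T : cobj) (i : 'I_(size (cm1 T))) : plus_minus T -> nth false (cm1 T) i = true.
Proof. by case=> _ /(all_nthP false) /(_ i (ltn_ord i)). Qed.

Lemma plus_minus_minimal T : plus_minus T -> minimal T.
Proof. by move=> h i j; rewrite plus_minus_label0 // plus_minus_label1. Qed.

Lemma iso_of_eq (T U : cobj) : cobj_cx T = cobj_cx U -> iso T U.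
Proof.
case: T U => [T wT] [U wU] /= E; subst U.
have h1 := idmx_hom (cm1 T); have h0 := idmx_hom (c0 T).
have c : id_ (c0 T) *m cd T = cd T *m id_ (cm1 T).
  by have [-> ->] := (is_homP _).1 wT.
exists (@Mor (CObj wT) (CObj wU) _ _ h1 h0 c), (@Mor (CObj wU) (CObj wT) _ _ h1 h0 c).
by split; apply: ht_eq; rewrite /= ?h1.1 ?h0.1.
Qed.

Lemma zero_hom_wf s r : wf e1 e2 (@Cx _ A s r 0).
Proof. by move=> i j; rewrite mxE mulr0 mul0r. Qed.

Definition stalks s r : cobj := CObj (@zero_hom_wf s r).

Lemma stalks_minimal s r : minimal (stalks s r).
Proof. by move=> i j _; rewrite mxE; apply: corner_unit0; apply: idem_local. Qed.

Lemma stalks_cat s r s' r' : biproduct (stalks (s ++ s') (r ++ r')) (stalks s r) (stalks s' r').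
Proof.
apply: biproduct_iso (biproduct_dsum _ _) (iso_of_eq _).
rewrite /= /dsum /=; congr Cx; rewrite block_mx0.
by apply/matrixP => i j; rewrite castmxE !mxE.
Qed.

Lemma stalks_indec s r : indec (stalks s r) -> (size s + size r = 1)%N.
Proof.
move=> [n h].
case: r s n h => [|t r] s n h; last first.
  have := h _ _ (stalks_cat [::] [:: t] s r).
  by case=> /(minimal_iso_zero (@stalks_minimal _ _)) [] //= -> ->.
case: s n h => [|t s] n h.
  by case: n; apply: iso_of_eq.
have := h _ _ (stalks_cat [:: t] [::] s [::]).
by case=> /(minimal_iso_zero (@stalks_minimal _ _)) [] //= _ ->.
Qed.

Lemma iso_stalks (T : cobj) : cd T = 0 -> iso T (stalks (cm1 T) (c0 T)).
Proof. by move=> d0; apply: iso_of_eq => /=; case: (cobj_cx T) d0 => s r d /= ->. Qed.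

Lemma local_idempotent (p z : A) : local_idem p -> corner p p z -> z * z = z -> z = 0 \/ z = p.
Proof.
move=> pl cz zz; have [[y [cy [zy yz]]]|[y [cy [zy yz]]]] := pl.2.2 z cz; [right|left].
  by rewrite -cz.1 -yz -mulrA zz.
by rewrite -cz.2 -zy mulrA mulrBr zz cz.2 subrr mul0r.
Qed.

(** The differential is zero, so homotopies change nothing, and an idempotent endomorphism is an
    idempotent of a local corner, which has only the trivial ones. *)
Lemma stalk_indec s r : (size s + size r = 1)%N -> indec (stalks s r).
Proof.
move=> sz; apply: indec_of_idempotents.
  move/(minimal_iso_zero (@stalks_minimal _ _)) => [/= a b].
  by move: sz; rewrite a b.
move=> e [h [hh E1 E0]].
have F1 : m1 e *m m1 e = m1 e by apply/eqP; rewrite -subr_eq0 E1 /= mulmx0.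
have F0 : m0 e *m m0 e = m0 e by apply/eqP; rewrite -subr_eq0 E0 /= mul0mx.
case: s r sz e {h hh E1 E0} F1 F0 => [|t [|? ?]] [|t' [|? ?]] //= _ e F1 F0.
  have ce : corner (idem t') (idem t') (m0 e 0 0) := @hom_corner [:: t'] [:: t'] (m0 e) ord0 ord0 (m0_hom e).
  have ee : m0 e 0 0 * m0 e 0 0 = m0 e 0 0.
    by rewrite -[in RHS]F0 mxE big_ord1.
  case: (local_idempotent (idem_local t') ce ee) => h; [left|right]; apply: ht_eq => /=;
    apply/matrixP => i j; rewrite ?(ord1 i) ?(ord1 j) ?h ?mxE //; by case: i.
have ce : corner (idem t) (idem t) (m1 e 0 0) := @hom_corner [:: t] [:: t] (m1 e) ord0 ord0 (m1_hom e).
have ee : m1 e 0 0 * m1 e 0 0 = m1 e 0 0.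
  by rewrite -[in RHS]F1 mxE big_ord1.
case: (local_idempotent (idem_local t) ce ee) => h; [left|right]; apply: ht_eq => /=;
  apply/matrixP => i j; rewrite ?(ord1 i) ?(ord1 j) ?h ?mxE //; by case: i.
Qed.

Lemma homzero_from_degree0 (T U : cobj) : cm1 T = [::] -> homzero T U.
Proof.
move=> h f hf; exists 0, 0; split; try exact: mhom0.
by apply/matrixP => i j; case: (no_index j).
Qed.

Lemma homzero_to_shift (T U : cobj) : c0 U = [::] -> homzero T U.
Proof.
move=> h f hf; exists 0, 0; split; try exact: mhom0.
by apply/matrixP => i j; case: (no_index i).
Qed.

Lemma family1 T : indec T -> homzero T T -> presilting_family [:: T].
Proof. by move=> h1 h2; split=> [[|]|[|] [|]|[|] [|]]. Qed.

Lemma family2 T U : indec T -> indec U -> ~ iso T U -> homzero T T -> homzero T U ->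
  homzero U T -> homzero U U -> presilting_family [:: T; U].
Proof.
move=> h1 h2 h3 h4 h5 h6 h7.
by split=> [[|[|]]|[|[|]] [|[|]]|[|[|]] [|[|]]] //= _ _ _ /iso_sym.
Qed.

Definition special_pair (v w : point) :=
  [\/ v = (R1, R0) /\ w = (R0, R1), v = (Ropp R1, R0) /\ w = (R0, Ropp R1)
    | v = (Ropp R1, R0) /\ w = (R0, R1)].

(** By [homzero_disjoint], no label occurs in both degrees anywhere in the family, so all its
    g-vectors share one closed quadrant. In the first and third quadrants the complexes sit in a
    single degree; in the second the differentials vanish. Only the fourth leaves a real problem. *)
Lemma classification Os : presilting_family Os ->
  (exists Ss, [/\ presilting_family Ss,
     map (fun T : cobj => gvec T) Ss = map (fun T : cobj => gvec T) Os &
     forall i, (i < size Ss)%N -> plus_minus (nth zero_obj Ss i)]) \/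
  (exists v w, special_pair v w /\
     forall i, (i < size Os)%N -> gvec (nth zero_obj Os i) = v \/ gvec (nth zero_obj Os i) = w).
Proof.
move=> /family_minimal [Ss [fS eS mS]].
have sz : size Os = size Ss by rewrite -(size_map (fun T : cobj => gvec T)) -eS size_map.
have gE i : (i < size Ss)%N -> gvec (nth zero_obj Os i) = gvec (nth zero_obj Ss i).
  move=> hi; have /(congr1 (fun l => nth (R0, R0) l i)) := eS.
  by rewrite !(nth_map zero_obj) ?sz.
have [ind _ hz] := fS.
have dis i j t : (i < size Ss)%N -> (j < size Ss)%N -> t \in cm1 (nth zero_obj Ss i) ->
   t \in c0 (nth zero_obj Ss j) -> False.
  by move=> hi hj; apply: homzero_disjoint; [exact: mS|exact: mS|exact: hz].
pose has0 t := exists2 i, (i < size Ss)%N & t \in c0 (nth zero_obj Ss i).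
pose has1 t := exists2 i, (i < size Ss)%N & t \in cm1 (nth zero_obj Ss i).
have excl t : has0 t -> has1 t -> False by move=> [i hi h] [j hj h']; exact: dis hj hi h' h.
have none0 t i : ~ has0 t -> (i < size Ss)%N -> all (predC1 t) (c0 (nth zero_obj Ss i)).
  move=> n hi; apply/allP => b hb /=; apply/eqP => bt; apply: n; exists i => //.
  by rewrite -bt.
have none1 t i : ~ has1 t -> (i < size Ss)%N -> all (predC1 t) (cm1 (nth zero_obj Ss i)).
  move=> n hi; apply/allP => b hb /=; apply/eqP => bt; apply: n; exists i => //.
  by rewrite -bt.
have nil_of (s : seq bool) : all (predC1 true) s -> all (predC1 false) s -> s = [::].
  by case: s => // -[].
have stalk i : (i < size Ss)%N -> cd (nth zero_obj Ss i) = 0 ->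
   (size (cm1 (nth zero_obj Ss i)) + size (c0 (nth zero_obj Ss i)) = 1)%N.
  by move=> hi d0; apply: stalks_indec; apply: indec_iso (iso_stalks d0) (ind i hi).
case: (classic (has1 false)) => [h1f|n1f]; last first.
  case: (classic (has0 true)) => [h0t|n0t]; last first.
    left; exists Ss; split=> // i hi; split.
      by have := none0 _ _ n0t hi; apply: sub_all => -[].
    by have := none1 _ _ n1f hi; apply: sub_all => -[].
  have n1t : ~ has1 true by move=> h; exact: excl h0t h.
  right; exists (R1, R0), (R0, R1); split; first by constructor 1.
  rewrite sz => i hi; rewrite gE //.
  have c1 := nil_of _ (none1 _ _ n1t hi) (none1 _ _ n1f hi).
  have d0 : cd (nth zero_obj Ss i) = 0.
    by apply/matrixP => a b; case: (no_index b).
  have := stalk i hi d0; rewrite /gvec c1.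
  case: (c0 _) => [|t [|]] //= _; case: t => /=; [right|left]; congr pair; rewrite /Rminus; ring.
have n0f : ~ has0 false by move=> h; exact: excl h h1f.
right; case: (classic (has0 true)) => [h0t|n0t].
  have n1t : ~ has1 true by move=> h; exact: excl h0t h.
  exists (Ropp R1, R0), (R0, R1); split; first by constructor 3.
  rewrite sz => i hi; rewrite gE //.
  (* The differential goes from copies of [e1 A] to copies of [e2 A], so its entries lie in the zero
     corner. *)
  have d0 : cd (nth zero_obj Ss i) = 0.
    apply/matrixP => a b; have := hom_corner a b (cd_hom (nth zero_obj Ss i)).
    have /(all_nthP false) /(_ a (ltn_ord a)) /= := none0 _ _ n0f hi.
    have /(all_nthP false) /(_ b (ltn_ord b)) /= := none1 _ _ n1t hi.
    rewrite mxE; case: nth => //; case: nth => //= _ _ /corner_eq <-; exact: tri.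
  have := stalk i hi d0.
  have := none0 _ _ n0f hi; have := none1 _ _ n1t hi; rewrite /gvec.
  case: (cm1 _) => [|t [|? ?]]; case: (c0 _) => [|t' [|? ?]] //=.
    case: t' => //= *; right; congr pair; rewrite /Rminus; ring.
  case: t => //= *; left; congr pair; rewrite /Rminus; ring.
exists (Ropp R1, R0), (R0, Ropp R1); split; first by constructor 2.
rewrite sz => i hi; rewrite gE //.
have c1 := nil_of _ (none0 _ _ n0t hi) (none0 _ _ n0f hi).
have d0 : cd (nth zero_obj Ss i) = 0.
  by apply/matrixP => a b; case: (no_index a).
have := stalk i hi d0; rewrite /gvec c1.
case: (cm1 _) => [|t [|]] //= _; case: t => /=; [right|left]; congr pair; rewrite /Rminus; ring.
Qed.

Lemma plus_minus_iso_zero T : plus_minus T ->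
  iso T zero_obj <-> size (c0 T) = 0%N /\ size (cm1 T) = 0%N.
Proof.
move=> hT; split=> [/(minimal_iso_zero (plus_minus_minimal hT)) [-> ->]|[h0 h1]] //.
apply/iso_zeroP; apply: ht_eq => /=; apply/matrixP => i; case: (no_index i).
  exact: size0nil.
exact: size0nil.
Qed.

Lemma stalk_sizes T : indec T -> cd T = 0 -> (size (cm1 T) + size (c0 T) = 1)%N.
Proof. by move=> h /iso_stalks i; apply: stalks_indec; exact: indec_iso i h. Qed.

End Complexes.

(** * The algebra of the generators *)

Section MatrixAlgebra.
Variables (k : fieldType) (J : finType) (L : falgType k).

Local Notation I := (J + bool)%type.

(* The indices [inr false] and [inr true] stand for [e1] and [e2]; the indices
   [inl j] provide one further copy of [e1 L] for each generator [j]. *)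
Definition mxalg := {ffun I * I -> L}.
HB.instance Definition _ := Vector.copy mxalg {ffun I * I -> L}.
Implicit Types f g h : mxalg.

Definition mxa_of (F : I -> I -> L) : mxalg := [ffun ij => F ij.1 ij.2].
Definition ent f i j : L := fun_of_fin (f : {ffun I * I -> L}) (i, j).

Lemma entE F i j : ent (mxa_of F) i j = F i j.
Proof. by rewrite /ent ffunE. Qed.

Lemma mxaP f g : (forall i j, ent f i j = ent g i j) -> f = g.
Proof. by move=> h; apply/ffunP => -[i j]; apply: h. Qed.

Lemma entD f g i j : ent (f + g) i j = ent f i j + ent g i j.
Proof. by rewrite /ent ffunE. Qed.
Lemma ent0 i j : ent 0 i j = 0.
Proof. by rewrite /ent ffunE. Qed.
Lemma entZ (a : k) f i j : ent (a *: f) i j = a *: ent f i j.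
Proof. by rewrite /ent ffunE. Qed.

Definition mxa_mul f g := mxa_of (fun i j => \sum_m ent f i m * ent g m j).
Definition mxa_one := mxa_of (fun i j => if i == j then 1 else 0).

Lemma mxa_mulA : associative mxa_mul.
Proof.
move=> f g h; apply: mxaP => i j; rewrite !entE.
under eq_bigr => m _ do rewrite entE mulr_sumr.
rewrite exchange_big; apply: eq_bigr => m _.
by rewrite entE mulr_suml; apply: eq_bigr => l _; rewrite mulrA.
Qed.

Lemma mxa_mul1l : left_id mxa_one mxa_mul.
Proof.
move=> f; apply: mxaP => i j; rewrite entE (bigD1 i) //= entE eqxx mul1r.
by rewrite big1 ?addr0 // => m /negPf mi; rewrite entE eq_sym mi mul0r.
Qed.

Lemma mxa_mul1r : right_id mxa_one mxa_mul.
Proof.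
move=> f; apply: mxaP => i j; rewrite entE (bigD1 j) //= entE eqxx mulr1.
by rewrite big1 ?addr0 // => m /negPf mi; rewrite entE mi mulr0.
Qed.

Lemma mxa_mulDl : left_distributive mxa_mul +%R.
Proof.
move=> f g h; apply: mxaP => i j; rewrite entD !entE -big_split /=.
by apply: eq_bigr => m _; rewrite entD mulrDl.
Qed.

Lemma mxa_mulDr : right_distributive mxa_mul +%R.
Proof.
move=> f g h; apply: mxaP => i j; rewrite entD !entE -big_split /=.
by apply: eq_bigr => m _; rewrite entD mulrDr.
Qed.

Lemma mxa_one_neq0 : mxa_one != 0.
Proof.
apply/eqP => /(congr1 (fun f => ent f (inr true) (inr true))).
by rewrite entE eqxx ent0; apply/eqP/oner_neq0.
Qed.

HB.instance Definition _ := GRing.Zmodule_isNzRing.Build mxalg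
  mxa_mulA mxa_mul1l mxa_mul1r mxa_mulDl mxa_mulDr mxa_one_neq0.

Lemma entM f g i j : ent (f * g) i j = \sum_m ent f i m * ent g m j.
Proof. exact: entE. Qed.

Lemma mxa_scaleAl (a : k) f g : a *: (f * g) = (a *: f) * g.
Proof.
apply: mxaP => i j; rewrite entZ !entM scaler_sumr.
by apply: eq_bigr => m _; rewrite entZ scalerAl.
Qed.
HB.instance Definition _ := GRing.Lmodule_isLalgebra.Build k mxalg mxa_scaleAl.

Lemma mxa_scaleAr (a : k) f g : a *: (f * g) = f * (a *: g).
Proof.
apply: mxaP => i j; rewrite entZ !entM scaler_sumr.
by apply: eq_bigr => m _; rewrite entZ scalerAr.
Qed.
HB.instance Definition _ := GRing.Lalgebra_isAlgebra.Build k mxalg mxa_scaleAr.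
HB.instance Definition _ := Algebra_isFalgebra.Build k mxalg.

Definition diag (d : I -> L) := mxa_of (fun i j => if i == j then d i else 0).

Lemma diag_mull d f i j : ent (diag d * f) i j = d i * ent f i j.
Proof.
rewrite entM (bigD1 i) //= entE eqxx big1 ?addr0 // => m /negPf mi.
by rewrite entE eq_sym mi mul0r.
Qed.

Lemma diag_mulr d f i j : ent (f * diag d) i j = ent f i j * d j.
Proof.
rewrite entM (bigD1 j) //= entE eqxx big1 ?addr0 // => m /negPf mi.
by rewrite entE mi mulr0.
Qed.

Lemma corner_diagP d d' f : corner (diag d) (diag d') f <->
  forall i j, d i * ent f i j = ent f i j /\ ent f i j * d' j = ent f i j.
Proof.
split=> [[a b] i j|h].
  by rewrite -{2}a -{4}b diag_mull diag_mulr.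
by split; apply: mxaP => i j; rewrite ?diag_mull ?diag_mulr; case: (h i j).
Qed.

End MatrixAlgebra.

(** * The embedding of the algebra and the column of generators *)

Section GeneratorAlgebra.
Variables (k : fieldType) (L : falgType k) (e1 e2 : L).
Hypothesis loc1 : local_idem e1.
Hypothesis loc2 : local_idem e2.
Hypothesis e12 : e1 * e2 = 0.
Hypothesis e21 : e2 * e1 = 0.
Hypothesis e1D2 : e1 + e2 = 1.
Hypothesis tri : forall z, e2 * z * e1 = 0.

Let e11 : e1 * e1 = e1 := loc1.1.
Let e22 : e2 * e2 = e2 := loc2.1.
Local Notation idem := (idem e1 e2).

Variables (n : nat) (y : 'I_n -> L).
Hypothesis cy : forall i, corner e1 e2 (y i).
Hypothesis gen_y : forall m, corner e1 e2 m ->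
  exists2 u : 'I_n -> L, (forall i, corner e1 e1 (u i)) & m = \sum_i u i * y i.
Hypothesis min_y : forall u : 'I_n -> L, (forall i, corner e1 e1 (u i)) ->
  \sum_i u i * y i = 0 -> forall i, ~ corner_unit e1 (u i).

Local Notation R := (mxalg 'I_n L).
Local Notation ent := (@ent _ _ _).
Local Notation mxa_of := (@mxa_of k 'I_n L).

(** The Peirce decomposition of [a], placed in the block of the two indices [inr]. It does not
    preserve the unit: [emb 1] is the idempotent of that block. *)
Definition emb (a : L) : R := mxa_of (fun i j =>
  match i, j with inr b, inr c => idem b * a * idem c | _, _ => 0 end).

Lemma sum_index (F : 'I_n + bool -> L) :
  \sum_m F m = \sum_(i < n) F (inl i) + (F (inr false) + F (inr true)).
Proof. by rewrite big_sumType /= big_bool /= [F (inr true) + _]addrC. Qed.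

Lemma emb_is_additive a b : emb (a + b) = emb a + emb b.
Proof.
apply: mxaP => i j; rewrite entD !entE; case: i => i; case: j => j; rewrite ?addr0 //.
by rewrite mulrDr mulrDl.
Qed.

Lemma emb0 : emb 0 = 0.
Proof.
by apply: mxaP => i j; rewrite ent0 entE; case: i => i; case: j => j //; rewrite mulr0 mul0r.
Qed.

Lemma embN a : emb (- a) = - emb a.
Proof. by apply/eqP; rewrite -addr_eq0 -emb_is_additive addNr emb0. Qed.

Lemma embM a b : emb (a * b) = emb a * emb b.
Proof.
apply: mxaP => i j; rewrite entM sum_index big1 ?add0r => [|m _]; last first.
  by rewrite !entE; case: i => i; rewrite mul0r.
rewrite !entE; case: i => i; case: j => j; rewrite ?mul0r ?mulr0 ?addr0 //.
have H c : idem i * a * idem c * (idem c * b * idem j) = idem i * a * idem c * b * idem j.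
  by rewrite !mulrA -(mulrA _ (idem c) (idem c)); case: c; rewrite /= ?e11 ?e22.
rewrite !H -!mulrDl -mulrDr /= e1D2 mulr1 !mulrA.
by [].
Qed.

Lemma ent_emb a b c : ent (emb a) (inr b) (inr c) = idem b * a * idem c.
Proof. exact: entE. Qed.

Lemma emb_inj a b : emb a = emb b -> a = b.
Proof.
move=> E; have H c d : idem c * a * idem d = idem c * b * idem d by rewrite -!ent_emb E.
rewrite -[a]mul1r -[a in LHS]mulr1 -[b]mul1r -[b in RHS]mulr1 -e1D2 !mulrDl !mulrDr !mulrA.
have := H false false; have := H false true; have := H true false; have := H true true.
by move=> /= -> -> -> ->.
Qed.

Definition d_p (i : 'I_n + bool) : L := if i is inr false then e1 else 0.
Definition d_q (i : 'I_n + bool) : L := if i is inr true then e2 else 0.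
Definition d_E (i : 'I_n + bool) : L := if i is inl _ then e1 else 0.
Definition Rp : R := diag d_p.
Definition Rq : R := diag d_q.
Definition RE : R := diag d_E.
Definition Rx : R := mxa_of (fun i j =>
  match i, j with inl i, inr true => y i | _, _ => 0 end).

Lemma emb_e1 : emb e1 = Rp.
Proof.
apply: mxaP => i j; rewrite !entE; case: i => [i|[]]; case: j => [j|[]] //=;
  rewrite ?e11 ?e12 ?e21 ?mul0r ?mulr0 //; by case: eqP.
Qed.

Lemma emb_e2 : emb e2 = Rq.
Proof.
apply: mxaP => i j; rewrite !entE; case: i => [i|[]]; case: j => [j|[]] //=;
  rewrite ?e22 ?e12 ?e21 ?mul0r ?mulr0 //; by case: eqP.
Qed.

Lemma emb_corner b c a : corner (idem b) (idem c) a ->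
  corner (emb (idem b)) (emb (idem c)) (emb a).
Proof. by move=> [h1 h2]; split; rewrite -embM ?h1 ?h2. Qed.

Lemma emb_corner_onto b c (z : R) : corner (emb (idem b)) (emb (idem c)) z ->
  exists2 a, corner (idem b) (idem c) a & emb a = z.
Proof.
have hd d : emb (idem d) = diag (fun i => if i == inr d then idem d else 0).
  by case: d => /=; rewrite ?emb_e1 ?emb_e2; apply: mxaP => i j; rewrite !entE;
    case: i => [i|[]].
rewrite !hd => /corner_diagP h; exists (ent z (inr b) (inr c)).
  by have := h (inr b) (inr c); rewrite !eqxx.
apply: mxaP => i j; have [h1 h2] := h i j; rewrite entE.
case: i h1 h2 => [i|b'] h1 h2; first by rewrite -h1 mul0r.
case: j h1 h2 => [j|c'] h1 h2; first by rewrite -h2 mulr0.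
have [h3 h4] := h (inr b) (inr c); rewrite !eqxx in h3 h4.
have orth d d' : d' != d -> idem d' * idem d = 0 by case: d d' => [] [].
case: (eqVneq b' b) => bb; last first.
  have bn : (inr b' == inr b :> 'I_n + bool) = false by apply/eqP => -[/eqP]; apply/negP.
  by rewrite -h1 bn mul0r -h3 mulrA orth // !mul0r.
case: (eqVneq c' c) => cc; last first.
  have cn : (inr c' == inr c :> 'I_n + bool) = false by apply/eqP => -[/eqP]; apply/negP.
  by rewrite -h2 cn mulr0 -h4 -!mulrA orth ?mulr0 // eq_sym.
by rewrite bb cc h3 h4.
Qed.

Lemma emb_unit b a : corner (idem b) (idem b) a ->
  (corner_unit (emb (idem b)) (emb a) <-> corner_unit (idem b) a).
Proof.
move=> ca; split=> -[z [cz [h1 h2]]].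
  have [c cc ec] := emb_corner_onto cz; subst z.
  by exists c; split=> //; rewrite -!embM in h1 h2; split; apply: emb_inj.
by exists (emb z); split; [exact: emb_corner | rewrite -!embM h1 h2].
Qed.

Lemma emb_idem_local b : local_idem (emb (idem b)).
Proof.
have lb : local_idem (idem b) := idem_local loc1 loc2 b.
split; first by rewrite -embM lb.1.
split; first by rewrite -emb0 => /emb_inj; exact: lb.2.1.
move=> z /emb_corner_onto [a ca <-].
rewrite -embN -emb_is_additive !emb_unit //; first exact: lb.2.2.
by apply: corner_add; [exact: corner_id lb.1 | apply: corner_opp].
Qed.

Lemma Rp_local : local_idem Rp.
Proof. by rewrite -emb_e1; exact: (emb_idem_local false). Qed.

Lemma Rq_local : local_idem Rq.
Proof. by rewrite -emb_e2; exact: (emb_idem_local true). Qed.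

Lemma diag_orth (d d' : 'I_n + bool -> L) : (forall i, d i * d' i = 0) ->
  (diag d : R) * diag d' = 0.
Proof.
move=> h; apply: mxaP => i j; rewrite diag_mull !entE ent0.
by case: eqP => [->|_]; rewrite ?h ?mulr0.
Qed.

Lemma RE_idem : RE * RE = RE.
Proof.
apply: mxaP => i j; rewrite diag_mull !entE; case: eqP => [->|]; rewrite ?mulr0 //.
by case: j => j /=; rewrite ?e11 ?mulr0.
Qed.

Lemma Rx_corner : corner RE Rq Rx.
Proof.
apply/corner_diagP => -[i|[]] [j|[]]; rewrite entE /= ?mulr0 ?mul0r //.
by have [-> ->] := cy i.
Qed.

Definition rowel (u : 'I_n -> L) : R := mxa_of (fun i j =>
  match i, j with inr false, inl i => u i | _, _ => 0 end).
Definition colel (u : 'I_n -> L) : R := mxa_of (fun i j =>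
  match i, j with inl i, inr false => u i | _, _ => 0 end).

Lemma rowelP z : corner Rp RE z ->
  exists2 u, (forall i, corner e1 e1 (u i)) & z = rowel u.
Proof.
move=> /corner_diagP h; exists (fun i => ent z (inr false) (inl i)).
  by move=> i; have := h (inr false) (inl i).
apply: mxaP => i j; have [h1 h2] := h i j; rewrite entE.
case: i h1 h2 => [i|[]] /= h1 h2; try by rewrite -h1 mul0r.
by case: j h1 h2 => [j|j] //= h1 h2; rewrite -h2 mulr0.
Qed.

Lemma colelP z : corner RE Rp z ->
  exists2 u, (forall i, corner e1 e1 (u i)) & z = colel u.
Proof.
move=> /corner_diagP h; exists (fun i => ent z (inl i) (inr false)).
  by move=> i; have := h (inl i) (inr false).
apply: mxaP => i j; have [h1 h2] := h i j; rewrite entE.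
case: j h1 h2 => [j|[]] /= h1 h2; try by rewrite -h2 mulr0; case: i {h1 h2}.
by case: i h1 h2 => [i|i] //= h1 h2; rewrite -h1 mul0r.
Qed.

Lemma rowel_corner u : (forall i, corner e1 e1 (u i)) -> corner Rp RE (rowel u).
Proof.
move=> h; apply/corner_diagP => -[i|[]] [j|[]]; rewrite entE /= ?mulr0 ?mul0r //.
exact: h.
Qed.

Lemma colel_corner u : (forall i, corner e1 e1 (u i)) -> corner RE Rp (colel u).
Proof.
move=> h; apply/corner_diagP => -[i|[]] [j|[]]; rewrite entE /= ?mulr0 ?mul0r //.
exact: h.
Qed.

Lemma rowel_mul_x u : (forall i, corner e1 e1 (u i)) ->
  rowel u * Rx = emb (\sum_i u i * y i).
Proof.
move=> h.
have [h1 h2] : corner e1 e2 (\sum_i u i * y i).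
  by apply: corner_sum => i _; apply: corner_mul (h i) (cy i).
have z1 : e2 * (\sum_i u i * y i) = 0 by rewrite -h1 mulrA e21 mul0r.
have z2 : (\sum_i u i * y i) * e1 = 0 by rewrite -h2 -mulrA e21 mulr0.
apply: mxaP => i j; rewrite entM sum_index !entE.
case: i => [i|[]]; case: j => [j|[]]; rewrite ?mul0r ?mulr0 ?addr0 /= ?z1 ?mul0r;
  rewrite ?h1 ?h2 ?z2.
all: try by rewrite big1 // => m _; rewrite !entE ?mul0r ?mulr0.
by apply: eq_bigr => m _; rewrite !entE.
Qed.

Lemma rowel_mul_colel u s : (forall i, corner e1 e1 (u i)) -> (forall i, corner e1 e1 (s i)) ->
  rowel u * colel s = emb (\sum_i u i * s i).
Proof.
move=> h h'.
have [h1 h2] : corner e1 e1 (\sum_i u i * s i).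
  by apply: corner_sum => i _; apply: corner_mul (h i) (h' i).
have z1 : e2 * (\sum_i u i * s i) = 0 by rewrite -h1 mulrA e21 mul0r.
have z2 : (\sum_i u i * s i) * e2 = 0 by rewrite -h2 -mulrA e12 mulr0.
apply: mxaP => i j; rewrite entM sum_index !entE.
case: i => [i|[]]; case: j => [j|[]]; rewrite ?mul0r ?mulr0 ?addr0 /= ?z1 ?mul0r;
  rewrite ?h1 ?h2 ?z2.
all: try by rewrite big1 // => m _; rewrite !entE ?mul0r ?mulr0.
by apply: eq_bigr => m _; rewrite !entE.
Qed.

Lemma Rx_gen m : corner Rp Rq m -> exists2 u, corner Rp RE u & u * Rx = m.
Proof.
rewrite -emb_e1 -emb_e2 => /(@emb_corner_onto false true) [/= a ca <-].
have [u cu ->] := gen_y ca; exists (rowel u).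
  by rewrite emb_e1; apply: rowel_corner.
exact: rowel_mul_x.
Qed.

(** The product is the sum of the [v i * w i]; if it were a unit, some coefficient [v i] of a
    relation would be one. *)
Lemma Rx_min u : corner Rp RE u -> u * Rx = 0 -> forall s, corner RE Rp s ->
  ~ corner_unit Rp (u * s).
Proof.
move=> /rowelP [v cv ->]; rewrite rowel_mul_x // -emb0 => /emb_inj v0.
move=> s /colelP [w cw ->]; rewrite rowel_mul_colel // -emb_e1 (@emb_unit false); last first.
  by apply: corner_sum => i _; apply: corner_mul (cv i) (cw i).
case/(corner_unit_sum loc1) => [i|i]; first exact: corner_mul (cv i) (cw i).
by case/(corner_unit_mul loc1 (cv i) (cw i)) => h _; exact: min_y h.
Qed.

(** The unit vectors, as rows and as columns, are the projections and injections for the [n] copies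
    of [e1]. *)
Lemma RE_free : free_obj Rp n (RE%:M : 'M[R]_1).
Proof.
pose u i (j : 'I_n) := if i == j then e1 else 0.
have cu i j : corner e1 e1 (u i j) by rewrite /u; case: eqP => _; [split|exact: corner0].
exists (\col_i rowel (u i)), (\row_i colel (u i)); split.
- by apply/mhom_scalarP => i j; rewrite mxE; apply: rowel_corner.
- by apply/mhom_scalarP => i j; rewrite mxE; apply: colel_corner.
- apply/matrixP => i j; rewrite !mxE big_ord1 !mxE rowel_mul_colel // -emb_e1.
  rewrite (bigD1 i) //= big1 ?addr0 => [|m /negPf mi]; last by rewrite /u eq_sym mi mul0r.
  by rewrite /u eqxx eq_sym; case: eqP => _; rewrite ?mulr1n ?mulr0n ?e11 // mulr0 emb0.
apply/matrixP => i j; rewrite !ord1 !mxE eqxx mulr1n.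
under eq_bigr => m _ do rewrite !mxE.
apply: mxaP => a b.
have es (F : 'I_n -> R) : ent (\sum_m F m) a b = \sum_m ent (F m) a b.
  by apply: (big_morph (fun f : R => ent f a b)) => [f g|]; rewrite ?entD ?ent0.
rewrite es entE.
under eq_bigr => m _ do rewrite entM sum_index !entE.
case: a {es} => [a|a]; last first.
  rewrite big1 => [|m _]; last by rewrite big1 ?add0r ?mul0r ?addr0 // => l _; rewrite entE mul0r.
  by case: eqP.
case: b => [b|b]; last first.
  rewrite big1 => [|m _]; last by rewrite big1 ?add0r ?mulr0 ?addr0 // => l _; rewrite !entE mul0r.
  by case: eqP.
rewrite (bigD1 a) //= big1 => [|l _]; last by rewrite entE mul0r.
rewrite big1 => [|m ma]; last first.
  rewrite big1 ?add0r => [|l _]; last by rewrite entE mul0r.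
  by rewrite /u (negPf ma) !mul0r addr0.
rewrite add0r mul0r !addr0 /u eqxx (inj_eq (@inl_inj _ _)).
by case: eqP => _; rewrite ?e11 ?mulr0.
Qed.

End GeneratorAlgebra.

Lemma least_nat (P : nat -> Prop) : (exists n, P n) ->
  exists n, P n /\ forall m, (m < n)%N -> ~ P m.
Proof.
case=> n Pn; have [b] := ubnP n; elim: b n Pn => // b IH n Pn nb.
case: (classic (exists m, (m < n)%N /\ P m)) => [[m [mn Pm]]|h].
  by apply: (IH m Pm); apply: leq_trans mn nb.
by exists n; split=> // m mn Pm; apply: h; exists m.
Qed.

(** * Minimal families of generators *)

Section MinimalGenerators.
Variables (k : fieldType) (L : falgType k) (e1 e2 : L).
Hypothesis loc1 : local_idem e1.
Hypothesis e22 : e2 * e2 = e2.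
Let e11 : e1 * e1 = e1 := loc1.1.

Definition generates n (y : 'I_n -> L) := (forall i, corner e1 e2 (y i)) /\
  forall m, corner e1 e2 m ->
    exists2 u : 'I_n -> L, (forall i, corner e1 e1 (u i)) & m = \sum_i u i * y i.

Lemma exists_generators : exists n (y : 'I_n -> L), generates y.
Proof.
pose b := vbasis (fullv : {vspace L}).
exists (\dim (fullv : {vspace L})), (fun i => e1 * b`_i * e2); split=> [i|m cm].
  exact: corner_sand.
exists (fun i => coord b i m *: e1).
  by move=> i; split; rewrite -?scalerAr -?scalerAl e11.
rewrite -{1}(corner_eq cm) {1}(coord_vbasis (memvf m)) mulr_sumr mulr_suml.
by apply: eq_bigr => i _; rewrite -scalerAr -!scalerAl !mulrA e11.
Qed.

(** A relation with a unit coefficient is solved for the corresponding generator, which is then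
    substituted away. *)
Lemma drop_generator n (y : 'I_n.+1 -> L) (u : 'I_n.+1 -> L) i : generates y ->
  (forall i, corner e1 e1 (u i)) -> \sum_i u i * y i = 0 -> corner_unit e1 (u i) ->
  generates (fun j => y (lift i j)).
Proof.
move=> [cy gy] cu u0 [v [cv [_ vu]]]; split=> [j|m /gy [w cw ->]]; first exact: cy.
exists (fun j => w (lift i j) - w i * v * u (lift i j)).
  move=> j; apply: corner_add => //; apply: corner_opp.
  by apply: corner_mul (cu _); apply: corner_mul (cw _) cv.
rewrite (bigD1_ord i) //=.
under [in RHS]eq_bigr => j _ do rewrite mulrBl -(mulrA (w i * v)).
rewrite sumrB -mulr_sumr addrC; congr (_ + _).
move: u0; rewrite (bigD1_ord i) //= => /eqP; rewrite addr_eq0 => /eqP h.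
by rewrite -[\sum_(_ < n) _]opprK -h mulrN opprK -mulrA (mulrA v) vu (cy i).1.
Qed.

(** Take a generating family of least cardinality. This cardinality will turn out to be the
    parameter of the adjacent cone. *)
Lemma exists_minimal_generators : exists n (y : 'I_n -> L), generates y /\
  forall u : 'I_n -> L, (forall i, corner e1 e1 (u i)) ->
  \sum_i u i * y i = 0 -> forall i, ~ corner_unit e1 (u i).
Proof.
have [n [[y gy] mn]] := least_nat exists_generators.
exists n, y; split=> // u cu u0 i ui.
case: n y gy mn u cu u0 i ui => [|n] y gy mn u cu u0 i ui; first by case: i {ui}.
by apply: (mn n) => //; exists (fun j => y (lift i j)); apply: drop_generator ui.
Qed.

End MinimalGenerators.

(** * The subalgebra that becomes the rotated algebra *)

Section SubAlgebra.
Variables (k : fieldType) (R : falgType k) (p q E x : R).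
Hypothesis pp : p * p = p.
Hypothesis qq : q * q = q.
Hypothesis EE : E * E = E.
Hypothesis pq : p * q = 0.
Hypothesis qp : q * p = 0.
Hypothesis pE : p * E = 0.
Hypothesis Ep : E * p = 0.
Hypothesis qE : q * E = 0.
Hypothesis Eq : E * q = 0.
Hypothesis p0 : p <> 0.
Hypothesis cx : corner E q x.

(* In the Peirce decomposition for [p], [q], [E], only the corners [p p], [E p],
   [q q] and [E E] survive, and the last two parts are tied through [x]. *)
Definition in_rot (g : R) :=
  [/\ (p + q + E) * g * (p + q + E) = g, E * g * x = x * g * q,
      [/\ p * g * E = 0, p * g * q = 0 & E * g * q = 0] &
      [/\ q * g * p = 0 & q * g * E = 0]].

Definition sandv (a b : R) : 'End(R) := (amulr b \o amull a)%VF.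

Lemma sandvE a b g : sandv a b g = a * g * b.
Proof. by rewrite /sandv lfunE /= lfunE /= lfunE. Qed.

(** Each condition of [in_rot] is linear, so an intersection of kernels presents the set as a
    subspace, from which the algebra structure is obtained. *)
Definition rot_vspace : {vspace R} :=
  (lker (sandv (p + q + E)%R (p + q + E)%R - \1)%VF :&: lker (sandv E x - sandv x q)%VF :&:
   lker (sandv p E) :&: lker (sandv p q) :&: lker (sandv E q) :&: lker (sandv q p)
   :&: lker (sandv q E))%VS.

Lemma rot_vspaceP g : reflect (in_rot g) (g \in rot_vspace).
Proof.
rewrite /rot_vspace !memv_cap !memv_ker !add_lfunE !opp_lfunE !id_lfunE !sandvE !subr_eq0.
apply: (iffP idP) => [/andP [/andP [/andP [/andP [/andP [/andP [/eqP a /eqP b] /eqP c] /eqP d] /eqP e] /eqP f] /eqP h]|].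
  by [].
by case=> -> -> [-> -> ->] [-> ->]; rewrite !eqxx.
Qed.

Local Notation f := (p + q + E).

Lemma rot_one_idem : f * f = f.
Proof.
by rewrite !mulrDl !mulrDr pp qq EE pq qp pE Ep qE Eq !addr0 !add0r.
Qed.
Let pf : p * f = p. Proof. by rewrite !mulrDr pp pq pE !addr0. Qed.
Let qf : q * f = q. Proof. by rewrite !mulrDr qq qp qE addr0 add0r. Qed.
Let fq : f * q = q. Proof. by rewrite !mulrDl qq pq Eq addr0 add0r. Qed.
Let Ef : E * f = E. Proof. by rewrite !mulrDr EE Ep Eq !add0r. Qed.

Lemma in_rot_one : in_rot f.
Proof.
split; rewrite ?rot_one_idem ?pf ?qf ?Ef ?pE ?pq ?Eq ?qp ?qE //.
by rewrite cx.1 -mulrA fq cx.2.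
Qed.

Lemma in_rot_mul g h : in_rot g -> in_rot h -> in_rot (g * h).
Proof.
move=> [g1 g2 [g3 g4 g5] [g6 g7]] [h1 h2 [h3 h4 h5] [h6 h7]].
have gf : g * f = g by rewrite -{1}g1 -mulrA rot_one_idem g1.
have fg : f * g = g by rewrite -{1}g1 !mulrA rot_one_idem g1.
have fh : f * h = h by rewrite -{1}h1 !mulrA rot_one_idem h1.
have hf : h * f = h by rewrite -{1}h1 -mulrA rot_one_idem h1.
(* Insert [p + q + E] between [g] and [h]; most of the resulting terms contain a vanishing
   corner. *)
have split_mid a b : a * (g * h) * b =
    a * g * p * (p * h * b) + a * g * q * (q * h * b) + a * g * E * (E * h * b).
  have i1 : a * g * p * (p * h * b) = a * g * p * h * b by rewrite !mulrA -(mulrA (a * g) p) pp.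
  have i2 : a * g * q * (q * h * b) = a * g * q * h * b by rewrite !mulrA -(mulrA (a * g) q) qq.
  have i3 : a * g * E * (E * h * b) = a * g * E * h * b by rewrite !mulrA -(mulrA (a * g) E) EE.
  by rewrite i1 i2 i3 -!mulrDl -!mulrDr -(mulrA a g f) gf !mulrA.
have phx : p * h * x = 0 by rewrite -cx.1 mulrA h3 mul0r.
split.
- by rewrite !mulrA fg -!mulrA hf.
- rewrite !split_mid phx g5 h2 h4 h5 mul0r !mulr0 !addr0 !add0r.
  by rewrite !mulrA -(mulrA (E * g) E) cx.1 g2 -(mulrA (x * g) q q) qq.
- by split; rewrite split_mid ?g3 ?g4 ?g5 ?h3 ?h4 ?h5 ?h6 ?h7 ?mul0r ?mulr0 ?addr0.
- by split; rewrite split_mid ?g6 ?g7 ?h3 ?h4 ?h5 ?h6 ?h7 ?mul0r ?mulr0 ?addr0.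
Qed.

Lemma rot_is_aspace : is_aspace rot_vspace.
Proof.
apply/andP; split.
  (* The unit of the subalgebra is [p + q + E], which need not be the unit of [R]. *)
  apply/has_algidP; exists f; split.
  - by apply/rot_vspaceP; exact: in_rot_one.
  - by apply/eqP => f0; apply: p0; rewrite -pf f0 mulr0.
  - move=> u /rot_vspaceP [u1 _ _ _].
    by split; [rewrite -{1}u1 !mulrA rot_one_idem u1 | rewrite -{1}u1 -mulrA rot_one_idem u1].
apply/prodvP => u v /rot_vspaceP hu /rot_vspaceP hv; apply/rot_vspaceP.
exact: in_rot_mul.
Qed.

Definition rot_alg : falgType k := subvs_of (ASpace rot_is_aspace).

End SubAlgebra.

(** * Complexes as matrices *)

Section Dictionary.
Variables (k : fieldType) (A : falgType k) (e1 e2 : A).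
Hypothesis loc1 : local_idem e1.
Hypothesis loc2 : local_idem e2.
Hypothesis tri : forall z, e2 * z * e1 = 0.
Let e11 : e1 * e1 = e1 := loc1.1.
Let e22 : e2 * e2 = e2 := loc2.1.

Variables (R : nzRingType) (phi : A -> R).
Hypothesis phiD : forall a b, phi (a + b) = phi a + phi b.
Hypothesis phiM : forall a b, phi (a * b) = phi a * phi b.
Hypothesis phi_inj : forall a b, phi a = phi b -> a = b.

Local Notation idem := (idem e1 e2).
Local Notation id_ := (idmx e1 e2).
Local Notation cobj := (cobj e1 e2).
Implicit Types T U : cobj.

(** The image of a corner is kept as a predicate because it need not be a full corner of [R]: for
    the rotated algebra one of them consists of the sums of compatible pairs. *)
Definition img b c z := exists2 a, corner (idem b) (idem c) a & phi a = z.
Definition mximg b c m n (M : 'M[R]_(m, n)) := forall i j, img b c (M i j).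

Lemma phi0 : phi 0 = 0.
Proof. by apply: (addrI (phi 0)); rewrite -phiD !addr0. Qed.

Lemma phi_sum (I : finType) (F : I -> A) : phi (\sum_i F i) = \sum_i phi (F i).
Proof. exact: (big_morph phi phiD phi0). Qed.

Lemma map_phiM m n l (M : 'M[A]_(m, n)) (N : 'M[A]_(n, l)) :
  map_mx phi (M *m N) = map_mx phi M *m map_mx phi N.
Proof.
by apply/matrixP => i j; rewrite !mxE phi_sum; apply: eq_bigr => a _; rewrite phiM !mxE.
Qed.

Lemma map_phiD m n (M N : 'M[A]_(m, n)) :
  map_mx phi (M + N) = map_mx phi M + map_mx phi N.
Proof. by apply/matrixP => i j; rewrite !mxE phiD. Qed.

Lemma map_phi0 m n : map_mx phi (0 : 'M_(m, n)) = 0.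
Proof. by apply/matrixP => i j; rewrite !mxE phi0. Qed.

Lemma map_phi_inj m n (M N : 'M[A]_(m, n)) : map_mx phi M = map_mx phi N -> M = N.
Proof. by move=> /matrixP h; apply/matrixP => i j; apply: phi_inj; have := h i j; rewrite !mxE. Qed.

Lemma mhom_idP s t (M : 'M[A]_(size t, size s)) : mhom (id_ t) (id_ s) M <->
  forall (i : 'I_(size t)) (j : 'I_(size s)), corner (idem (nth false t i)) (idem (nth false s j)) (M i j).
Proof.
split=> [h i j|h]; first exact: hom_corner.
by split; apply/matrixP => i j; rewrite ?mul_idmx ?mulmx_id; case: (h i j).
Qed.

Lemma mximg_lift b c m n (M : 'M[R]_(m, n)) : mximg b c M ->
  exists2 M0 : 'M[A]_(m, n), forall i j, corner (idem b) (idem c) (M0 i j) & map_mx phi M0 = M.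
Proof.
move=> h.
have [F hF] : exists F : 'I_m -> 'I_n -> A, forall i j, corner (idem b) (idem c) (F i j) /\ phi (F i j) = M i j.
  have h' i j : exists a, corner (idem b) (idem c) a /\ phi a = M i j.
    by have [a a1 a2] := h i j; exists a.
  by have [F hF] := fin_all_exists (fun i => fin_all_exists (h' i)); exists F.
exists (\matrix_(i, j) F i j); first by move=> i j; rewrite mxE; case: (hF i j).
by apply/matrixP => i j; rewrite !mxE; case: (hF i j).
Qed.

Lemma mximg_map b c m n (M : 'M[A]_(m, n)) :
  (forall i j, corner (idem b) (idem c) (M i j)) -> mximg b c (map_mx phi M).
Proof. by move=> h i j; exists (M i j); rewrite ?mxE. Qed.

Lemma map_id_const s b : (forall i : 'I_(size s), nth false s i = b) ->
  map_mx phi (id_ s) = (phi (idem b))%:M.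
Proof.
move=> h; apply/matrixP => i j; rewrite !mxE h.
by case: eqP => _; rewrite ?mulr1n ?mulr0n ?phi0.
Qed.

Definition imgmx (T : cobj) : 'M[R]_(size (c0 T), size (cm1 T)) := map_mx phi (cd T).

Lemma imgmx_img T : plus_minus T -> mximg false true (imgmx T).
Proof.
move=> h; apply: mximg_map => i j; have := hom_corner i j (cd_hom e11 e22 T).
by rewrite (plus_minus_label0 _ h) (plus_minus_label1 _ h).
Qed.

Lemma hom00P T U (M : 'M[A]_(size (c0 U), size (c0 T))) : plus_minus T -> plus_minus U ->
  mhom (id_ (c0 U)) (id_ (c0 T)) M <-> forall i j, corner (idem false) (idem false) (M i j).
Proof.
move=> hT hU; rewrite mhom_idP.
by split=> h i j; have := h i j; rewrite (plus_minus_label0 _ hT) (plus_minus_label0 _ hU).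
Qed.

Lemma hom11P T U (M : 'M[A]_(size (cm1 U), size (cm1 T))) : plus_minus T -> plus_minus U ->
  mhom (id_ (cm1 U)) (id_ (cm1 T)) M <-> forall i j, corner (idem true) (idem true) (M i j).
Proof.
move=> hT hU; rewrite mhom_idP.
by split=> h i j; have := h i j; rewrite (plus_minus_label1 _ hT) (plus_minus_label1 _ hU).
Qed.

Lemma hom01P T U (M : 'M[A]_(size (c0 U), size (cm1 T))) : plus_minus T -> plus_minus U ->
  mhom (id_ (c0 U)) (id_ (cm1 T)) M <-> forall i j, corner (idem false) (idem true) (M i j).
Proof.
move=> hT hU; rewrite mhom_idP.
by split=> h i j; have := h i j; rewrite (plus_minus_label1 _ hT) (plus_minus_label0 _ hU).
Qed.

(** A homotopy has entries in the zero corner, so homotopic maps between such complexes are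
    equal. *)
Lemma ht_plus_minus T U (f g : mor T U) : plus_minus T -> plus_minus U -> ht f g ->
  m1 f = m1 g /\ m0 f = m0 g.
Proof.
move=> hT hU [h [hh E1 E0]].
have h0 : h = 0.
  apply/matrixP => i j; have := hom_corner i j hh.
  rewrite (plus_minus_label1 _ hU) (plus_minus_label0 _ hT) mxE => /corner_eq <-; exact: tri.
split; apply/eqP; rewrite -subr_eq0 ?E1 ?E0 h0 ?mul0mx ?mulmx0 //.
Qed.

Lemma imgmx_iso T U : plus_minus T -> plus_minus U ->
  iso e11 e22 T U <-> exists (X : 'M[R]_(size (c0 U), size (c0 T))) (X' : 'M[R]_(size (c0 T), size (c0 U)))
    (Y : 'M[R]_(size (cm1 U), size (cm1 T))) (Y' : 'M[R]_(size (cm1 T), size (cm1 U))),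
    [/\ mximg false false X, mximg false false X', mximg true true Y & mximg true true Y'] /\
    [/\ X *m X' = (phi e1)%:M, X' *m X = (phi e1)%:M, Y *m Y' = (phi e2)%:M, Y' *m Y = (phi e2)%:M
     & X *m imgmx T = imgmx U *m Y].
Proof.
move=> hT hU.
have idT0 : map_mx phi (id_ (c0 T)) = (phi e1)%:M.
  by apply: (@map_id_const _ false) => i; apply: plus_minus_label0.
have idU0 : map_mx phi (id_ (c0 U)) = (phi e1)%:M.
  by apply: (@map_id_const _ false) => i; apply: plus_minus_label0.
have idT1 : map_mx phi (id_ (cm1 T)) = (phi e2)%:M.
  by apply: (@map_id_const _ true) => i; apply: plus_minus_label1.
have idU1 : map_mx phi (id_ (cm1 U)) = (phi e2)%:M.
  by apply: (@map_id_const _ true) => i; apply: plus_minus_label1.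
split.
  case=> f [g [/(ht_plus_minus hT hT) [/= gf1 gf0] /(ht_plus_minus hU hU) [/= fg1 fg0]]].
  exists (map_mx phi (m0 f)), (map_mx phi (m0 g)), (map_mx phi (m1 f)), (map_mx phi (m1 g)).
  split.
    split; apply: mximg_map.
    - by apply/hom00P => //; apply: m0_hom.
    - by apply/hom00P => //; apply: m0_hom.
    - by apply/hom11P => //; apply: m1_hom.
    - by apply/hom11P => //; apply: m1_hom.
  by rewrite -!map_phiM gf1 gf0 fg1 fg0 idT0 idU0 idT1 idU1 (m_comm f).
case=> X [X' [Y [Y' [[/mximg_lift [X0 cX <-] /mximg_lift [X0' cX' <-] /mximg_lift [Y0 cY <-] /mximg_lift [Y0' cY' <-]]]]]].
rewrite -!map_phiM -idT0 -{1}idU0 -idU1 -{1}idT1.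
case=> /map_phi_inj a /map_phi_inj b /map_phi_inj c /map_phi_inj d /map_phi_inj e.
have hX : mhom (id_ (c0 U)) (id_ (c0 T)) X0 by apply/hom00P.
have hX' : mhom (id_ (c0 T)) (id_ (c0 U)) X0' by apply/hom00P.
have hY : mhom (id_ (cm1 U)) (id_ (cm1 T)) Y0 by apply/hom11P.
have hY' : mhom (id_ (cm1 T)) (id_ (cm1 U)) Y0' by apply/hom11P.
have e' : X0' *m cd U = cd T *m Y0'.
  by rewrite -(cd_hom e11 e22 U).2 -c !mulmxA -(mulmxA X0') -e mulmxA b (cd_hom e11 e22 T).1.
by exists (Mor hY hX e), (Mor hY' hX' e'); split; apply: ht_eq.
Qed.

Lemma imgmx_retract T U (i : mor U T) (r : mor T U) : plus_minus T -> plus_minus U ->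
  ht (mcomp r i) (idm e11 e22 U) ->
  exists (Xi : 'M[R]_(size (c0 T), size (c0 U))) (Xr : 'M[R]_(size (c0 U), size (c0 T)))
    (Yi : 'M[R]_(size (cm1 T), size (cm1 U))) (Yr : 'M[R]_(size (cm1 U), size (cm1 T))),
    [/\ mximg false false Xi, mximg false false Xr, mximg true true Yi & mximg true true Yr] /\
    [/\ Xr *m Xi = (phi e1)%:M, Yr *m Yi = (phi e2)%:M, Xi *m imgmx U = imgmx T *m Yi
     & Xr *m imgmx T = imgmx U *m Yr].
Proof.
move=> hT hU /(ht_plus_minus hU hU) [/= ri1 ri0].
exists (map_mx phi (m0 i)), (map_mx phi (m0 r)), (map_mx phi (m1 i)), (map_mx phi (m1 r)).
split.
  split; apply: mximg_map.
  - by apply/hom00P => //; apply: m0_hom.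
  - by apply/hom00P => //; apply: m0_hom.
  - by apply/hom11P => //; apply: m1_hom.
  - by apply/hom11P => //; apply: m1_hom.
rewrite -!map_phiM ri1 ri0 !m_comm (@map_id_const _ false) => [|j]; last exact: plus_minus_label0.
by rewrite (@map_id_const _ true) => [|j]; last exact: plus_minus_label1.
Qed.

Lemma imgmx_homzero T U : plus_minus T -> plus_minus U ->
  homzero T U <-> forall V : 'M[R]_(size (c0 U), size (cm1 T)), mximg false true V ->
   exists (X : 'M[R]_(size (c0 U), size (c0 T))) (Y : 'M[R]_(size (cm1 U), size (cm1 T))),
    [/\ mximg false false X, mximg true true Y & V = X *m imgmx T + imgmx U *m Y].
Proof.
move=> hT hU; split=> [H V /mximg_lift [V0 cV <-]|H V hV].
  have [|h1 [h0 [hh1 hh0 ->]]] := H V0; first exact/hom01P.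
  exists (map_mx phi h0), (map_mx phi h1); split.
  - by apply: mximg_map; apply/hom00P.
  - by apply: mximg_map; apply/hom11P.
  - by rewrite -!map_phiM -map_phiD addrC.
have [|X [Y [/mximg_lift [X0 cX <-] /mximg_lift [Y0 cY <-]]]] := H (map_mx phi V).
  by apply: mximg_map; apply/hom01P.
rewrite -!map_phiM -map_phiD => /map_phi_inj ->.
exists Y0, X0; split; [exact/hom11P|exact/hom00P|exact: addrC].
Qed.

Lemma imgmx_onto a b (M : 'M[R]_(a, b)) : mximg false true M ->
  exists T : cobj, plus_minus T /\ exists (ea : size (c0 T) = a) (eb : size (cm1 T) = b),
    castmx (ea, eb) (imgmx T) = M.
Proof.
have [s [hs hs']] : exists s, size s = a /\ all negb s.
  by exists (nseq a false); rewrite size_nseq all_nseq /= orbT.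
have [r [hr hr']] : exists r, size r = b /\ all id r.
  by exists (nseq b true); rewrite size_nseq all_nseq /= orbT.
subst a b => /mximg_lift [M0 cM <-].
have w : wf e1 e2 (@Cx _ A r s M0).
  apply/(is_homP e11 e22)/mhom_idP => i j /=.
  have /(all_nthP false) /(_ i (ltn_ord i)) /negbTE -> := hs'.
  have /(all_nthP false) /(_ j (ltn_ord j)) -> := hr'.
  exact: cM.
by exists (CObj w); split=> //; exists erefl, erefl; rewrite castmx_id.
Qed.

Lemma gvec_plus_minus T : plus_minus T ->
  gvec T = (INR (size (c0 T)), Ropp (INR (size (cm1 T)))).
Proof.
case=> h0 h1; rewrite /gvec.
have E s : all negb s -> count negb s = size s /\ count id s = 0%N.
  by elim: s => //= -[] s IH //= /IH [-> ->].
have E' s : all id s -> count id s = size s /\ count negb s = 0%N.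
  by elim: s => //= -[] s IH //= /IH [-> ->].
have [-> ->] := E _ h0; have [-> ->] := E' _ h1.
by congr pair; rewrite /Rminus /=; ring.
Qed.

Lemma imgmx_dsum T U : imgmx (dsum_obj e11 e22 T U) =
  castmx (esym (size_cat _ _), esym (size_cat _ _)) (block_mx (imgmx T) 0 0 (imgmx U)).
Proof.
by rewrite /imgmx /= map_castmx map_block_mx !map_phi0.
Qed.

Lemma dsum_plus_minus T U : plus_minus T -> plus_minus U -> plus_minus (dsum_obj e11 e22 T U).
Proof. by move=> [a b] [c d]; split; rewrite /= all_cat ?a ?b. Qed.

(** The summands are replaced by minimal complexes. The labels of a minimal retract occur among
    those of [T], which keeps the replacements in the fourth quadrant. *)
Lemma biproduct_plus_minus T U V : plus_minus T -> biproduct e11 e22 T U V ->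
  exists U' V', [/\ plus_minus U', plus_minus V', iso e11 e22 U U', iso e11 e22 V V'
    & iso e11 e22 T (dsum_obj e11 e22 U' V')].
Proof.
move=> hT bT.
have [U' [mU _ iU]] := exists_minimal e11 e22 U.
have [V' [mV _ iV]] := exists_minimal e11 e22 V.
have bT' := biproduct_iso_summands bT iU iV.
exists U', V'; split=> //; last exact: biproduct_unique bT' (biproduct_dsum _ _ _ _).
  case: bT' => i1 [p1 [i2 [p2 [[a b c d] e]]]]; case: hT => h0 h1; split.
    by apply/allP => t /(minimal_retract_c0 loc1 loc2 tri mU a); exact: (allP h0).
  by apply/allP => t /(minimal_retract_cm1 loc1 loc2 tri mU a); exact: (allP h1).
case: bT' => i1 [p1 [i2 [p2 [[a b c d] e]]]]; case: hT => h0 h1; split.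
  by apply/allP => t /(minimal_retract_c0 loc1 loc2 tri mV b); exact: (allP h0).
by apply/allP => t /(minimal_retract_cm1 loc1 loc2 tri mV b); exact: (allP h1).
Qed.

End Dictionary.

(** * Transport of the matrix notions along equalities of sizes *)

Section Casts.
Variable R : nzRingType.
Variables p q E x : R.

Lemma homzeroM_cast a b a' b' b1 b1' (M : 'M[R]_(a, b)) (M' : 'M[R]_(a', b'))
  (e : b = b1) (e' : b' = b1') :
  homzeroM p q (castmx (erefl, e) M) (castmx (erefl, e') M') <-> homzeroM p q M M'.
Proof. by case: _ / e; case: _ / e'; rewrite !castmx_id. Qed.

Lemma isoM_cast a b a' b' b1 b1' (M : 'M[R]_(a, b)) (M' : 'M[R]_(a', b'))
  (e : b = b1) (e' : b' = b1') :
  isoM p q (castmx (erefl, e) M) (castmx (erefl, e') M') <-> isoM p q M M'.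
Proof. by case: _ / e; case: _ / e'; rewrite !castmx_id. Qed.

Lemma epi_type_cast a b b1 (M : 'M[R]_(a, b)) (e : b = b1) :
  epi_type p E x (castmx (erefl, e) M) <-> epi_type p E x M.
Proof. by case: _ / e; rewrite castmx_id. Qed.

Lemma corr0_cast a b c a' b' c' (M : 'M[R]_(a, b)) (N : 'M[R]_(b, c)) (ea : a = a')
  (eb eb' : b = b') (ec : c = c') : corr0 p E x M N ->
  corr0 p E x (castmx (ea, eb) M) (castmx (eb', ec) N).
Proof.
rewrite (eq_irrelevance eb' eb); case: _ / ea; case: _ / eb; case: _ / ec.
by rewrite !castmx_id.
Qed.

Lemma corr0_uncast_left a b c b1 c1 (M : 'M[R]_(a, b)) (N : 'M[R]_(b1, c1)) (eb : b1 = b)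
  (ec : c1 = c) : corr0 p E x M (castmx (eb, ec) N) ->
  corr0 p E x (castmx (erefl, esym eb) M) N.
Proof.
by move: (eb) M; case: _ / ec; case: _ / eb => eb M; rewrite !(eq_irrelevance eb erefl) !castmx_id.
Qed.

Lemma corr0_uncast_right a b c a1 (M : 'M[R]_(a1, b)) b1 (N1 : 'M[R]_(b1, c))
  (ea : a1 = a) (eb : b = b1) : corr0 p E x (castmx (ea, eb) M) N1 ->
  corr0 p E x (castmx (erefl, eb) M) N1.
Proof. by move: N1; case: _ / ea. Qed.

Lemma cast_block a a' b1 b1' b2 b2' m n1 n2 (M : 'M[R]_(a, b1)) (M' : 'M[R]_(a', b1'))
  (e : b1 = b2) (e' : b1' = b2') (ea : a + a' = m) (en : b1 + b1' = n1) (en' : n1 = n2)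
  (f : b2 + b2' = n2) :
  castmx (erefl, en') (castmx (ea, en) (block_mx M 0 0 M')) =
  castmx (ea, f) (block_mx (castmx (erefl, e) M) 0 0 (castmx (erefl, e') M')).
Proof.
move: f; case: _ / e; case: _ / e' => f; rewrite !castmx_id castmx_comp.
by case: _ / ea; congr castmx; congr pair; apply: eq_irrelevance.
Qed.

Lemma isoM_block_cast a b a1 b1 a2 b2 m n (M : 'M[R]_(a, b)) (M1 : 'M[R]_(a1, b1))
  (M2 : 'M[R]_(a2, b2)) (ea : a1 + a2 = m) (eb : b1 + b2 = n) :
  isoM p q M (castmx (ea, eb) (block_mx M1 0 0 M2)) <-> isoM p q M (block_mx M1 0 0 M2).
Proof. by case: _ / ea; case: _ / eb; rewrite castmx_id. Qed.

Lemma isoN_block_cast a b a1 b1 a2 b2 m n (M : 'M[R]_(a, b)) (M1 : 'M[R]_(a1, b1))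
  (M2 : 'M[R]_(a2, b2)) (ea : a1 + a2 = m) (eb : b1 + b2 = n) :
  isoN p q E x M (castmx (ea, eb) (block_mx M1 0 0 M2)) <-> isoN p q E x M (block_mx M1 0 0 M2).
Proof. by case: _ / ea; case: _ / eb; rewrite castmx_id. Qed.

Lemma isoM_cast_left a b b1 a' b' (M : 'M[R]_(a, b)) (M' : 'M[R]_(a', b')) (e : b = b1) :
  isoM p q (castmx (erefl, e) M) M' <-> isoM p q M M'.
Proof. by case: _ / e; rewrite castmx_id. Qed.

Lemma isoN_cast_left a b a1 a' b' (M : 'M[R]_(a, b)) (M' : 'M[R]_(a', b')) (e : a = a1) :
  isoN p q E x (castmx (e, erefl) M) M' <-> isoN p q E x M M'.
Proof. by case: _ / e; rewrite castmx_id. Qed.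

Lemma isoM_cast_summands a b a1 b1 a2 b2 m1 n1 m2 n2 (M : 'M[R]_(a, b)) (M1 : 'M[R]_(a1, b1))
  (M2 : 'M[R]_(a2, b2)) (ea1 : a1 = m1) (eb1 : b1 = n1) (ea2 : a2 = m2) (eb2 : b2 = n2) :
  isoM p q M (block_mx (castmx (ea1, eb1) M1) 0 0 (castmx (ea2, eb2) M2)) <->
  isoM p q M (block_mx M1 0 0 M2).
Proof.
by case: _ / ea1; case: _ / eb1; case: _ / ea2; case: _ / eb2; rewrite !castmx_id.
Qed.

Lemma isoN_cast_summands a b a1 b1 a2 b2 m1 n1 m2 n2 (M : 'M[R]_(a, b)) (M1 : 'M[R]_(a1, b1))
  (M2 : 'M[R]_(a2, b2)) (ea1 : a1 = m1) (eb1 : b1 = n1) (ea2 : a2 = m2) (eb2 : b2 = n2) :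
  isoN p q E x M (block_mx (castmx (ea1, eb1) M1) 0 0 (castmx (ea2, eb2) M2)) <->
  isoN p q E x M (block_mx M1 0 0 M2).
Proof.
by case: _ / ea1; case: _ / eb1; case: _ / ea2; case: _ / eb2; rewrite !castmx_id.
Qed.

Lemma cogenerated_cast a b b1 (M : 'M[R]_(a, b)) (e : b = b1) :
  cogenerated p E x (castmx (erefl, e) M) <-> cogenerated p E x M.
Proof. by case: _ / e; rewrite castmx_id. Qed.

Lemma split_epi_cast b b1 c (N : 'M[R]_(b, c)) (e : b = b1) :
  (exists Z, mhom p%:M E%:M Z /\ castmx (e, erefl) N *m Z = E%:M) <->
  (exists Z, mhom p%:M E%:M Z /\ N *m Z = E%:M).
Proof. by case: _ / e; rewrite castmx_id. Qed.

Lemma mhom_EM_cast b b1 c (N : 'M[R]_(b, c)) (e : b = b1) : mhom E%:M p%:M N ->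
  mhom E%:M p%:M (castmx (e, erefl) N).
Proof. by case: _ / e; rewrite castmx_id. Qed.

End Casts.

(** * Comparison of complexes over the two algebras *)

Section Comparison.
Variables (R : nzRingType) (p q E x : R) (n : nat).
Hypothesis pl : local_idem p.
Hypothesis qq : q * q = q.
Hypothesis EE : E * E = E.
Hypothesis Eq : E * q = 0.
Hypothesis qE : q * E = 0.
Hypothesis cx : corner E q x.
Hypothesis freeE : free_obj p n (E%:M : 'M[R]_1).
Hypothesis gen_x : forall m, corner p q m -> exists2 u, corner p E u & u * x = m.
Hypothesis min_x : forall u, corner p E u -> u * x = 0 ->
  forall s, corner E p s -> ~ corner_unit p (u * s).

Variables (k : fieldType) (A : falgType k) (e1 e2 : A).
Hypothesis loc1 : local_idem e1.
Hypothesis loc2 : local_idem e2.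
Hypothesis tri : forall z, e2 * z * e1 = 0.
Variable iota : A -> R.
Hypothesis iotaD : forall a b, iota (a + b) = iota a + iota b.
Hypothesis iotaM : forall a b, iota (a * b) = iota a * iota b.
Hypothesis iota_inj : forall a b, iota a = iota b -> a = b.
Hypothesis iota1 : iota e1 = p.
Hypothesis iota2 : iota e2 = q.
Hypothesis img_iota : forall b c z, img e1 e2 iota b c z <->
  corner (if b then q else p) (if c then q else p) z.

Variables (G : falgType k) (g1 g2 : G).
Hypothesis locg1 : local_idem g1.
Hypothesis locg2 : local_idem g2.
Hypothesis trig : forall z, g2 * z * g1 = 0.
Variable phi : G -> R.
Hypothesis phiD : forall a b, phi (a + b) = phi a + phi b.
Hypothesis phiM : forall a b, phi (a * b) = phi a * phi b.
Hypothesis phi_inj : forall a b, phi a = phi b -> a = b.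
Hypothesis phi1 : phi g1 = E + q.
Hypothesis phi2 : phi g2 = p.
Hypothesis img_phi00 : forall z, img g1 g2 phi false false z <->
  exists s b, [/\ corner E E s, corner q q b, s * x = x * b & z = s + b].
Hypothesis img_phi01 : forall z, img g1 g2 phi false true z <-> corner E p z.
Hypothesis img_phi11 : forall z, img g1 g2 phi true true z <-> corner p p z.

Local Notation pM := (p%:M).
Local Notation qM := (q%:M).
Local Notation EM := (E%:M).
Local Notation xM := (x%:M).
Let e11 : e1 * e1 = e1 := loc1.1.
Let e22 : e2 * e2 = e2 := loc2.1.
Let g11 : g1 * g1 = g1 := locg1.1.
Let g22 : g2 * g2 = g2 := locg2.1.
Local Notation Lobj := (cobj e1 e2).
Local Notation Gobj := (cobj g1 g2).
Implicit Types (T U : Lobj) (S W : Gobj).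
Local Notation RT := (imgmx iota).
Local Notation RS := (imgmx phi).
Local Notation Liso := (iso e11 e22).
Local Notation Giso := (iso g11 g22).

Lemma mximg_iota b c m l (M : 'M[R]_(m, l)) : mximg e1 e2 iota b c M <->
  mhom (if b then q else p)%:M (if c then q else p)%:M M.
Proof. by rewrite mhom_scalarP; split=> h i j; apply/img_iota. Qed.

Lemma mximg_phi01 m l (M : 'M[R]_(m, l)) : mximg g1 g2 phi false true M <-> mhom EM pM M.
Proof. by rewrite mhom_scalarP; split=> h i j; apply/img_phi01. Qed.

Lemma mximg_phi11 m l (M : 'M[R]_(m, l)) : mximg g1 g2 phi true true M <-> mhom pM pM M.
Proof. by rewrite mhom_scalarP; split=> h i j; apply/img_phi11. Qed.

Lemma mximg_phi00 m l (M : 'M[R]_(m, l)) : mximg g1 g2 phi false false M <->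
  exists K B, cmat q E x K B /\ M = K + B.
Proof.
split=> [h|[K [B [[/mhom_scalarP hK /mhom_scalarP hB KB] ->]]] i j]; last first.
  apply/img_phi00; exists (K i j), (B i j); split=> //; last by rewrite mxE.
  by move/matrixP: KB => /(_ i j); rewrite mulmx_scalar mul_scalar_mx mxE.
have h' i j : exists sb, [/\ corner E E sb.1, corner q q sb.2, sb.1 * x = x * sb.2 &
    M i j = sb.1 + sb.2].
  by have /img_phi00 [s [b [a1 a2 a3 a4]]] := h i j; exists (s, b).
have [F hF] := fin_all_exists (fun i => fin_all_exists (h' i)).
exists (\matrix_(i, j) (F i j).1), (\matrix_(i, j) (F i j).2); split; first split.
- by apply/mhom_scalarP => i j; rewrite mxE; case: (hF i j).
- by apply/mhom_scalarP => i j; rewrite mxE; case: (hF i j).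
- by apply/matrixP => i j; rewrite mulmx_scalar mul_scalar_mx !mxE; case: (hF i j).
- by apply/matrixP => i j; rewrite !mxE; case: (hF i j).
Qed.

Lemma RT_hom T : plus_minus T -> mhom pM qM (RT T).
Proof. by move=> h; apply/(mximg_iota false true); exact: (imgmx_img loc1 loc2). Qed.

Lemma RS_hom S : plus_minus S -> mhom EM pM (RS S).
Proof. by move=> h; apply/mximg_phi01; exact: (imgmx_img locg1 locg2). Qed.

Lemma zero_mul a b c (B : 'M[R]_(a, b)) (N : 'M[R]_(b, c)) : mhom qM qM B -> mhom EM pM N ->
  B *m N = 0.
Proof.
by move=> hB hN; rewrite -hB.2 -hN.1 mulmxA -(mulmxA B) -scalar_mxM qE raddf0 mulmx0 mul0mx.
Qed.

Lemma cross_Eq a b c (K : 'M[R]_(a, b)) (B : 'M[R]_(b, c)) : mhom EM EM K -> mhom qM qM B ->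
  K *m B = 0.
Proof.
by move=> hK hB; rewrite -hK.2 -hB.1 mulmxA -(mulmxA K) -scalar_mxM Eq raddf0 mulmx0 mul0mx.
Qed.

Lemma cross_qE a b c (B : 'M[R]_(a, b)) (K : 'M[R]_(b, c)) : mhom qM qM B -> mhom EM EM K ->
  B *m K = 0.
Proof.
by move=> hB hK; rewrite -hB.2 -hK.1 mulmxA -(mulmxA B) -scalar_mxM qE raddf0 mulmx0 mul0mx.
Qed.

Lemma homzero_L T U : plus_minus T -> plus_minus U ->
  homzero T U <-> homzeroM p q (RT T) (RT U).
Proof.
move=> hT hU; rewrite (imgmx_homzero iotaD iotaM iota_inj hT hU).
split=> h V hV.
  have [|X [Y [/mximg_iota a /mximg_iota b c]]] := h V; first exact/mximg_iota.
  by exists X, Y.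
have [|X [Y [a b c]]] := h V; first exact/(mximg_iota false true).
by exists X, Y; split=> //; apply/mximg_iota.
Qed.

Lemma iso_L T U : plus_minus T -> plus_minus U -> Liso T U <-> isoM p q (RT T) (RT U).
Proof.
move=> hT hU; rewrite (imgmx_iso loc1 loc2 tri iotaD iotaM iota_inj hT hU) iota1 iota2.
split=> -[X [X' [Y [Y' [[a b c d] e]]]]]; exists X, X', Y, Y'; split=> //.
  by split; [exact/(mximg_iota false false)|exact/(mximg_iota false false)|exact/(mximg_iota true true)|exact/(mximg_iota true true)].
by split; apply/mximg_iota.
Qed.

Lemma homzero_G S W : plus_minus S -> plus_minus W ->
  homzero S W <-> homzeroN p q E x (RS S) (RS W).
Proof.
move=> hS hW; rewrite (imgmx_homzero phiD phiM phi_inj hS hW).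
have hN := RS_hom hS.
split=> h V hV.
  have [|X [Y [/mximg_phi00 [K [B [cK ->]]] /mximg_phi11 b c]]] := h V; first exact/mximg_phi01.
  exists K, B, Y; split=> //; rewrite c mulmxDl; have [_ hB _] := cK.
  by rewrite (zero_mul hB hN) addr0.
have [|K [B [C [cK hC c]]]] := h V; first exact/mximg_phi01.
exists (K + B), C; split; [by apply/mximg_phi00; exists K, B | exact/mximg_phi11 |].
by rewrite c mulmxDl; have [_ hB _] := cK; rewrite (zero_mul hB hN) addr0.
Qed.

Lemma iso_G S W : plus_minus S -> plus_minus W -> Giso S W <-> isoN p q E x (RS S) (RS W).
Proof.
move=> hS hW; rewrite (imgmx_iso locg1 locg2 trig phiD phiM phi_inj hS hW) phi1 phi2.
have hN := RS_hom hS; have hN' := RS_hom hW.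
have key a b c (K : 'M[R]_(a, b)) B (K' : 'M[R]_(b, c)) B' : cmat q E x K B -> cmat q E x K' B' ->
   (K + B) *m (K' + B') = K *m K' + B *m B'.
  move=> [hK hB _] [hK' hB' _]; rewrite mulmxDl !mulmxDr.
  by rewrite (cross_Eq hK hB') (cross_qE hB hK') addr0 add0r.
(* The two components of a pair are recovered by multiplying with the orthogonal idempotents [E] and
   [q]. *)
have key2 a (K : 'M[R]_a) B : mhom EM EM K -> mhom qM qM B -> K + B = (E + q)%:M ->
   K = EM /\ B = qM.
  move=> hK hB e; split.
    have := congr1 (mulmx EM) e; rewrite mulmxDr hK.1.
    rewrite -{1}hB.1 mulmxA -!scalar_mxM Eq mulrDr EE Eq addr0 raddf0 mul0mx addr0.
    by [].
  have := congr1 (mulmx qM) e; rewrite mulmxDr hB.1.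
  rewrite -{1}hK.1 mulmxA -!scalar_mxM qE mulrDr qq qE add0r raddf0 mul0mx add0r.
  by [].
split.
  case=> X [X' [Y [Y' [[/mximg_phi00 [K [B [cK ->]]] /mximg_phi00 [K' [B' [cK' ->]]]
    /mximg_phi11 hY /mximg_phi11 hY'] [e1' e2' e3' e4' e5']]]]].
  have [hK hB _] := cK; have [hK' hB' _] := cK'.
  rewrite (key _ _ _ _ _ _ _ cK cK') in e1'; rewrite (key _ _ _ _ _ _ _ cK' cK) in e2'.
  have [a1 a2] := key2 _ _ _ (mhom_mul hK hK') (mhom_mul hB hB') e1'.
  have [b1 b2] := key2 _ _ _ (mhom_mul hK' hK) (mhom_mul hB' hB) e2'.
  exists K, B, K', B', Y, Y'; do 2 split=> //; split=> //.
  by rewrite -e5' mulmxDl (zero_mul hB hN) addr0.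
case=> K [B [K' [B' [Y [Y' [[cK cK' hY hY'] [[a1 a2 a3 a4] [b1 b2 b3]]]]]]]].
have [hK hB _] := cK; have [hK' hB' _] := cK'.
exists (K + B), (K' + B'), Y, Y'; split.
  split; [by apply/mximg_phi00; exists K, B | by apply/mximg_phi00; exists K', B'|exact/mximg_phi11|exact/mximg_phi11].
split=> //.
- by rewrite (key _ _ _ _ _ _ _ cK cK') a1 a3 raddfD.
- by rewrite (key _ _ _ _ _ _ _ cK' cK) a2 a4 raddfD.
- by rewrite mulmxDl (zero_mul hB hN) addr0.
Qed.

(** The equality [e] matches degree -1 of [T] with degree 0 of [S]: copies of the second projective
    on one side become copies of the first on the other. *)
Definition Corr T S := [/\ plus_minus T, plus_minus S &
  exists e : size (cm1 T) = size (c0 S), corr0 p E x (castmx (erefl, e) (RT T)) (RS S)].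

Lemma Corr_homzero T S U W : Corr T S -> Corr U W -> (homzero T U <-> homzero S W).
Proof.
move=> [hT hS [e c]] [hU hW [e' c']]; rewrite homzero_L // homzero_G //.
split=> [h|h].
  by apply: (homzeroM_N cx freeE gen_x c c'); apply/homzeroM_cast.
by apply/(homzeroM_cast _ _ _ _ e e'); apply: (homzeroN_M gen_x c c').
Qed.

Lemma Corr_iso T S U W : Corr T S -> Corr U W -> (Liso T U <-> Giso S W).
Proof.
move=> [hT hS [e c]] [hU hW [e' c']]; rewrite iso_L // iso_G //.
split=> [h|h].
  by apply: (isoM_N pl cx freeE gen_x min_x c c'); apply/isoM_cast.
by apply/(isoM_cast _ _ _ _ e e'); apply: (isoN_M c c').
Qed.

Lemma Corr_size T S : Corr T S ->
  (size (c0 T) + size (cm1 S) = n * size (c0 S))%N /\ size (cm1 T) = size (c0 S).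
Proof. by case=> _ _ [e c]; split=> //; exact: (corr0_size pl freeE c). Qed.

Lemma Corr_dsum T S U W : Corr T S -> Corr U W ->
  Corr (dsum_obj e11 e22 T U) (dsum_obj g11 g22 S W).
Proof.
move=> [hT hS [e c]] [hU hW [e' c']]; split; try exact: dsum_plus_minus.
have E' : size (cm1 (dsum_obj e11 e22 T U)) = size (c0 (dsum_obj g11 g22 S W)).
  by rewrite /= !size_cat e e'.
exists E'; rewrite (imgmx_dsum loc1 loc2 iotaD) (imgmx_dsum locg1 locg2 phiD).
rewrite (cast_block _ _ e e' _ _ _ (esym (size_cat (c0 S) (c0 W)))).
by apply: corr0_cast; apply: corr0_block.
Qed.

Lemma Corr_of_epi T : plus_minus T -> epi_type p E x (RT T) -> exists S, Corr T S.
Proof.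
move=> hT [F [Sg [hF hSg FM FS]]].
have [c [N cN]] := corr0_of_epi x pl freeE hF hSg FS; rewrite FM in cN.
have hN : mhom EM pM N by case: cN => ? [? [? [[]]]].
have [S [hS [ea [eb eN]]]] := imgmx_onto locg1 locg2 ((mximg_phi01 N).2 hN).
exists S; split=> //; exists (esym ea).
by apply: (corr0_uncast_left (ec := eb)); rewrite eN.
Qed.

Lemma Corr_of_mono S : plus_minus S -> mono_type p E (RS S) -> exists T, Corr T S.
Proof.
move=> hS [T' [hT' TN]].
have [a [M [hM cM]]] := corr0_of_mono pl cx freeE (RS_hom hS) hT' TN.
have [T [hT [ea [eb eM]]]] := imgmx_onto loc1 loc2 ((mximg_iota false true M).2 hM).
exists T; split=> //; exists eb; rewrite -eM in cM.
exact: (corr0_uncast_right cM).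
Qed.

Lemma mono_type_summand S W (i : mor W S) (r : mor S W) : plus_minus S -> plus_minus W ->
  ht (mcomp r i) (idm g11 g22 W) -> mono_type p E (RS S) -> mono_type p E (RS W).
Proof.
move=> hS hW hr.
have [Xi [Xr [Yi [Yr [[/mximg_phi00 [K [B [[hK hB _] ->]]] _ /mximg_phi11 hYi /mximg_phi11 hYr]
  [_ e2' e3' _]]]]]] := imgmx_retract trig phiD phiM hS hW hr.
rewrite phi2 in e2'; rewrite mulmxDl (zero_mul hB (RS_hom hW)) addr0 in e3'.
exact: mono_type_retract hK hYi hYr e3' e2'.
Qed.

Lemma epi_type_summand T U (i : mor U T) (r : mor T U) : plus_minus T -> plus_minus U ->
  ht (mcomp r i) (idm e11 e22 U) -> epi_type p E x (RT T) -> epi_type p E x (RT U).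
Proof.
move=> hT hU hr.
have [Xi [Xr [Yi [Yr [[/mximg_iota a1 /mximg_iota a2 /mximg_iota a3 /mximg_iota a4]
  [b1 b2 b3 b4]]]]]] := imgmx_retract tri iotaD iotaM hT hU hr.
rewrite iota1 in b1; rewrite iota2 in b2.
exact: (epi_type_retract pl cx freeE gen_x min_x a1 a2 a3 a4 (RT_hom hU) b3 b4 b1 b2).
Qed.

Lemma Corr_iso_zero T S : Corr T S ->
  Liso T (zero_obj e1 e2) <-> Giso S (zero_obj g1 g2).
Proof.
move=> c; have [s1 s2] := Corr_size c; case: c => hT hS _.
rewrite (plus_minus_iso_zero _ _ loc1 loc2 tri) // (plus_minus_iso_zero _ _ locg1 locg2 trig) //.
split=> [[h0 h1]|[h0 h1]].
  rewrite -s2 h1; split=> //; apply/eqP.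
  by move: s1; rewrite -s2 h1 muln0 h0 add0n => ->.
rewrite s2 h0; split=> //; apply/eqP.
by move: s1; rewrite h0 h1 muln0 addn0 => ->.
Qed.

(** A decomposition of one partner must be carried to the other. Its summands have partners because
    [epi_type] and [mono_type] pass to summands, and [Corr_dsum] with [Corr_iso] then compares the
    sums. *)
Lemma Corr_indec T S : Corr T S -> (indec e11 e22 T <-> indec g11 g22 S).
Proof.
move=> c; have [hT hS _] := c.
split=> -[nz ind]; (split; first by move/(Corr_iso_zero c)).
  move=> V W b.
  have [V' [W' [hV hW iV iW iS]]] := biproduct_plus_minus trig hS b.
  have mS : mono_type p E (RS S) by case: c => _ _ [e /corr0_mono].
  have bS := biproduct_iso_summands b iV iW.
  have [i1 [p1 [i2 [p2 [[h1 h2 _ _] _]]]]] := bS.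
  have [T1 c1] := Corr_of_mono hV (mono_type_summand hS hV h1 mS).
  have [T2 c2] := Corr_of_mono hW (mono_type_summand hS hW h2 mS).
  have iT := (Corr_iso c (Corr_dsum c1 c2)).2 iS.
  have bT := biproduct_iso (biproduct_dsum e11 e22 T1 T2) (iso_sym iT).
  case: (ind _ _ bT) => [/(Corr_iso_zero c1)|/(Corr_iso_zero c2)] h; [left|right].
    exact: iso_trans iV h.
  exact: iso_trans iW h.
move=> V W b.
have [V' [W' [hV hW iV iW iT]]] := biproduct_plus_minus tri hT b.
have mT : epi_type p E x (RT T).
  by case: c => _ _ [e /corr0_epi /epi_type_cast].
have bT := biproduct_iso_summands b iV iW.
have [i1 [p1 [i2 [p2 [[h1 h2 _ _] _]]]]] := bT.
have [S1 c1] := Corr_of_epi hV (epi_type_summand hT hV h1 mT).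
have [S2 c2] := Corr_of_epi hW (epi_type_summand hT hW h2 mT).
have iS := (Corr_iso c (Corr_dsum c1 c2)).1 iT.
have bS := biproduct_iso (biproduct_dsum g11 g22 S1 S2) (iso_sym iS).
case: (ind _ _ bS) => [/(Corr_iso_zero c1)|/(Corr_iso_zero c2)] h; [left|right].
  exact: iso_trans iV h.
exact: iso_trans iW h.
Qed.

Lemma Corr_gvec T S : Corr T S -> gvec S = rho_map n (gvec T).
Proof.
move=> c; have [s1 s2] := Corr_size c; have [hT hS _] := c.
rewrite !gvec_plus_minus // /rho_map /= s2; congr pair; first by rewrite Ropp_involutive.
have := congr1 INR s1; rewrite plus_INR mult_INR; lra.
Qed.

(** With nothing in degree -1 the complex is the stalk [e1]. Otherwise one copy of the generator
    column splits off by [cogenerated_split], and indecomposability leaves nothing else. *)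
Lemma cogenerated_gvec T : plus_minus T -> indec e11 e22 T -> cogenerated p E x (RT T) ->
  gvec T = (R1, R0) \/ gvec T = (INR n, Ropp R1).
Proof.
move=> hT ind cog; rewrite gvec_plus_minus //.
have [b e] : exists b, size (cm1 T) = b by eexists.
case: b e => [|b] e.
  have d0 : cd T = 0 by apply/matrixP => i j; case: (no_index j); apply: size0nil.
  have := stalk_sizes loc1 loc2 tri ind d0; rewrite e add0n => ->; left.
  by congr pair; rewrite /= Ropp_0.
right.
have [M1 [a2 [M2 [hM1 hM2 iM]]]] := cogenerated_split pl qq cx freeE
  ((cogenerated_cast _ _ _ _ (e : _ = (1 + b)%N)).2 cog).
have [X [X' [Y [Y' [[hX hX' _ _] [XX XX' _ _ _]]]]]] := iM.
(* Isomorphic free objects have equal rank, so the isomorphism of matrices fixes the number of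
   rows. *)
have sa : size (c0 T) = (n + a2)%N.
  apply/eqP; rewrite eqn_leq (phom_retract_size pl hX' hX XX').
  exact: (phom_retract_size pl hX hX' XX).
have [T1 [hT1 [ea1 [eb1 eM1]]]] := imgmx_onto loc1 loc2 ((mximg_iota false true M1).2 hM1).
have [T2 [hT2 [ea2 [eb2 eM2]]]] := imgmx_onto loc1 loc2 ((mximg_iota false true M2).2 hM2).
rewrite -eM1 -eM2 in iM.
have iT : Liso T (dsum_obj e11 e22 T1 T2).
  apply/iso_L => //; first exact: dsum_plus_minus.
  rewrite (imgmx_dsum loc1 loc2 iotaD); apply/isoM_block_cast.
  by move: iM => /isoM_cast_left /isoM_cast_summands.
have bT := biproduct_iso (biproduct_dsum e11 e22 T1 T2) (iso_sym iT).
case: ind => _ /(_ _ _ bT) []; rewrite (plus_minus_iso_zero _ _ loc1 loc2 tri) //.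
  by rewrite eb1 => -[].
rewrite ea2 eb2 => -[a20 b0].
by rewrite sa e a20 b0 addn0.
Qed.

Lemma split_epi_gvec S : plus_minus S -> indec g11 g22 S ->
  (exists Z, mhom pM EM Z /\ RS S *m Z = EM) ->
  gvec S = (R0, Ropp R1) \/ gvec S = (R1, Ropp (INR n)).
Proof.
move=> hS ind spl; rewrite gvec_plus_minus //.
have [b e] : exists b, size (c0 S) = b by eexists.
case: b e => [|b] e.
  have d0 : cd S = 0 by apply/matrixP => i j; case: (no_index i); apply: size0nil.
  by have := stalk_sizes locg1 locg2 trig ind d0; rewrite e addn0 => ->; left.
right.
have [Z [hZ NZ]] := (split_epi_cast _ _ _ (e : _ = (1 + b)%N)).2 spl.
have [M1 [a2 [M2 [hM1 hM2 iM]]]] := split_epi_split pl qq cx freeE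
  (mhom_EM_cast e (RS_hom hS)) hZ NZ.
have [? [? [? [? [X [X' [[_ _ hX hX'] [_ [XX XX' _]]]]]]]]] := iM.
have sa : size (cm1 S) = (n + a2)%N.
  apply/eqP; rewrite eqn_leq (phom_retract_size pl hX' hX XX').
  exact: (phom_retract_size pl hX hX' XX).
have [T1 [hT1 [ea1 [eb1 eM1]]]] := imgmx_onto locg1 locg2 ((mximg_phi01 M1).2 hM1).
have [T2 [hT2 [ea2 [eb2 eM2]]]] := imgmx_onto locg1 locg2 ((mximg_phi01 M2).2 hM2).
rewrite -eM1 -eM2 in iM.
have iS : Giso S (dsum_obj g11 g22 T1 T2).
  apply/iso_G => //; first exact: dsum_plus_minus.
  rewrite (imgmx_dsum locg1 locg2 phiD); apply/isoN_block_cast.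
  by move: iM => /isoN_cast_left /isoN_cast_summands.
have bS := biproduct_iso (biproduct_dsum g11 g22 T1 T2) (iso_sym iS).
case: ind => _ /(_ _ _ bS) []; rewrite (plus_minus_iso_zero _ _ locg1 locg2 trig) //.
  by rewrite ea1 => -[].
rewrite ea2 eb2 => -[a20 b0].
by rewrite sa e a20 b0 addn0.
Qed.

Lemma Corr_or_cogenerated T : plus_minus T -> (exists S, Corr T S) \/
  forall U, plus_minus U -> homzero U T -> cogenerated p E x (RT U).
Proof.
move=> hT; have [[c [N c0]]|h] := epi_or_cogenerated pl cx freeE gen_x min_x (RT_hom hT).
  by left; apply: Corr_of_epi => //; apply: corr0_epi c0.
by right=> U hU /(homzero_L hU hT) H; apply: h H; exact: RT_hom.
Qed.

Lemma Corr_or_split S : plus_minus S -> (exists T, Corr T S) \/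
  forall W, plus_minus W -> homzero S W -> exists Z, mhom pM EM Z /\ RS W *m Z = EM.
Proof.
move=> hS; have [[a [M [hM c0]]]|h] := mono_or_split_epi pl cx freeE (RS_hom hS).
  by left; apply: Corr_of_mono => //; apply: corr0_mono c0.
by right=> W hW /(homzero_G hS hW) H; apply: h H; exact: RS_hom.
Qed.

Local Notation "0L" := (zero_obj e1 e2).
Local Notation "0G" := (zero_obj g1 g2).

(** One member without a partner suffices for the second alternative: Hom from every member to its
    shift vanishes, which makes every member cogenerated. *)
Lemma family_to_G Os : presilting_family e11 e22 Os ->
  (forall i, (i < size Os)%N -> plus_minus (nth 0L Os i)) ->
  (exists Ss, [/\ presilting_family g11 g22 Ss,
     size Ss = size Os & forall i, (i < size Os)%N ->
       plus_minus (nth 0G Ss i) /\ gvec (nth 0G Ss i) = rho_map n (gvec (nth 0L Os i))]) \/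
  (forall i, (i < size Os)%N ->
     gvec (nth 0L Os i) = (R1, R0) \/ gvec (nth 0L Os i) = (INR n, Ropp R1)).
Proof.
move=> [h1 h2 h3] pm.
case: (classic (forall i, (i < size Os)%N -> exists S, Corr (nth 0L Os i) S)) => [H|H].
  left; have [Ss [sz hS]] := @list_choice _ _ 0L 0G Corr Os H; exists Ss; split=> //.
    split; rewrite sz.
    - by move=> i hi; apply/(Corr_indec (hS i hi)); apply: h1.
    - by move=> i j hi hj ij /(Corr_iso (hS i hi) (hS j hj)); apply: h2.
    - by move=> i j hi hj; apply/(Corr_homzero (hS i hi) (hS j hj)); apply: h3.
  by move=> i hi; split; [case: (hS i hi) | exact: Corr_gvec (hS i hi)].
right=> j hj.
have [i [hi ni]] : exists i, (i < size Os)%N /\ ~ exists S, Corr (nth 0L Os i) S.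
  by apply: NNPP => h; apply: H => i hi; apply: NNPP => h'; apply: h; exists i.
case: (Corr_or_cogenerated (pm i hi)) => // cog.
by apply: cogenerated_gvec; [exact: pm | exact: h1 | apply: cog; [exact: pm | exact: h3]].
Qed.

Lemma family_to_L Ss : presilting_family g11 g22 Ss ->
  (forall i, (i < size Ss)%N -> plus_minus (nth 0G Ss i)) ->
  (exists Os, [/\ presilting_family e11 e22 Os,
     size Os = size Ss & forall i, (i < size Ss)%N ->
       plus_minus (nth 0L Os i) /\ gvec (nth 0G Ss i) = rho_map n (gvec (nth 0L Os i))]) \/
  (forall i, (i < size Ss)%N ->
     gvec (nth 0G Ss i) = (R0, Ropp R1) \/ gvec (nth 0G Ss i) = (R1, Ropp (INR n))).
Proof.
move=> [h1 h2 h3] pm.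
case: (classic (forall i, (i < size Ss)%N -> exists T, Corr T (nth 0G Ss i))) => [H|H].
  left; have [Os [sz hO]] := @list_choice _ _ 0G 0L (fun S T => Corr T S) Ss H.
  exists Os; split=> //.
    split; rewrite sz.
    - by move=> i hi; apply/(Corr_indec (hO i hi)); apply: h1.
    - by move=> i j hi hj ij /(Corr_iso (hO i hi) (hO j hj)); apply: h2.
    - by move=> i j hi hj; apply/(Corr_homzero (hO i hi) (hO j hj)); apply: h3.
  by move=> i hi; split; [case: (hO i hi) | exact: Corr_gvec (hO i hi)].
right=> j hj.
have [i [hi ni]] : exists i, (i < size Ss)%N /\ ~ exists T, Corr T (nth 0G Ss i).
  by apply: NNPP => h; apply: H => i hi; apply: NNPP => h'; apply: h; exists i.
case: (Corr_or_split (pm i hi)) => // spl.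
by apply: split_epi_gvec; [exact: pm | exact: h1 | apply: spl; [exact: pm | exact: h3]].
Qed.

(** [U] is the partner of the stalk [g1] in degree 0, namely the minimal left approximation of the
    second projective by copies of the first. With the stalk [e1] it spans the adjacent cone. *)
Lemma exists_generator_complex : exists U, [/\ plus_minus U, indec e11 e22 U, homzero U U,
  gvec U = (INR n, Ropp R1) & presilting_family e11 e22 [:: stalks e1 e2 [::] [:: false]; U]].
Proof.
pose S := stalks g1 g2 [::] [:: false].
have hS : plus_minus S by [].
have mS : mono_type p E (RS S).
  by exists 0; split; [exact: mhom0 | apply/matrixP => -[]].
have [U cU] := Corr_of_mono hS mS; have [hU _ _] := cU; have [s1 s2] := Corr_size cU.
have iS : indec g11 g22 S by exact: stalk_indec.
have zS : homzero S S by exact: homzero_from_degree0.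
have iU := (Corr_indec cU).2 iS; have zU := (Corr_homzero cU cU).2 zS.
have cog : cogenerated p E x (RT U).
  case: cU => _ _ [e [F [Sg [T [[hF hSg hT hN] [FM _ _ _ ee]]]]]].
  apply/(cogenerated_cast _ _ _ _ e); exists F, Sg; split=> //.
  (* The partner has nothing in degree -1, so [T] has no rows and [Sg] is a two-sided inverse of
     [F]. *)
  rewrite -ee; have -> : T = 0 by apply/matrixP => -[].
  by rewrite mulmx0 addr0.
exists U; split=> //.
  by rewrite gvec_plus_minus // s2 -[size (c0 U)]addn0 s1 /= muln1.
have hP : plus_minus (stalks e1 e2 [::] [:: false]) by [].
apply: family2 => //.
- exact: stalk_indec.
- move=> /iso_sym /(minimal_iso_labels loc1 loc2 tri (plus_minus_minimal hU)) [_ h].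
  by move: s2 h => /=; case: (cm1 U) => // t s _ /(_ t (mem_head _ _)).
- exact: homzero_from_degree0.
- exact: homzero_from_degree0.
(* The approximation property: a map to copies of [e1] lifts through the generators and so factors
   through the differential of [U]. *)
apply/homzero_L => // V hV.
have [v hv <-] := lift_rows gen_x hV.
case: cog => F [T [hF hT FM TF]].
exists (v *m T), 0; split; [exact: mhom_mul hv hT | exact: mhom0 |].
by rewrite mulmx0 addr0 -FM mulmxA -(mulmxA v) TF hv.2.
Qed.

(** [W] is the partner of the shifted stalk [e2]. With the shifted stalk [g2] it spans the image
    under the rotation of the negative of [sigma_plus]. *)
Lemma exists_cogenerator_complex : exists W, [/\ plus_minus W,
  gvec W = (R1, Ropp (INR n)) & presilting_family g11 g22 [:: stalks g1 g2 [:: true] [::]; W]].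
Proof.
pose T := stalks e1 e2 [:: true] [::].
have hT : plus_minus T by [].
have mT : epi_type p E x (RT T).
  exists 0, 0; split; try exact: mhom0; by apply/matrixP => -[].
have [W cW] := Corr_of_epi hT mT; have [_ hW _] := cW; have [s1 s2] := Corr_size cW.
have iT : indec e11 e22 T by exact: stalk_indec.
have zT : homzero T T by exact: homzero_to_shift.
have iW := (Corr_indec cW).1 iT; have zW := (Corr_homzero cW cW).1 zT.
have hP : plus_minus (stalks g1 g2 [:: true] [::]) by [].
exists W; split=> //.
  by rewrite gvec_plus_minus // -s2 -[size (cm1 W)]add0n s1 -s2 /= muln1.
apply: family2 => //.
- exact: stalk_indec.
- move=> /iso_sym /(minimal_iso_labels locg1 locg2 trig (plus_minus_minimal hW)) [h _].
  by move: s2 h => /=; case: (c0 W) => // t s _ /(_ t (mem_head _ _)).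
- exact: homzero_to_shift.
- apply/homzero_G => // V hV.
  case: cW => _ _ [e [F [Sg [T' [[hF hSg hT' hN] [FM _ _ _ ee]]]]]].
  exists 0, 0, (T' *m V); split.
  + by split; rewrite ?mul0mx ?mulmx0 //; exact: mhom0.
  + exact: mhom_mul hT' hV.
  + rewrite mul0mx add0r mulmxA; have F0 : F = 0 by apply/matrixP => -[].
    by move: ee; rewrite F0 mulmx0 add0r => ->; rewrite hV.1.
- exact: homzero_to_shift.
Qed.

End Comparison.

(** * Cones in the plane *)

Lemma cone_gen_scale vs t x : Rle R0 t -> cone_gen vs x -> cone_gen vs (pscale t x).
Proof.
elim: vs x => [|v vs IH] x t0 /=.
  by move=> ->; rewrite /pscale /pt_origin /=; congr pair; ring.
case=> s [y [s0 [cy ->]]]; exists (Rmult t s), (pscale t y); split; first exact: Rmult_le_pos.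
split; first exact: IH.
by rewrite /pscale /padd /=; congr pair; ring.
Qed.

Lemma cone_gen_add vs x y : cone_gen vs x -> cone_gen vs y -> cone_gen vs (padd x y).
Proof.
elim: vs x y => [|v vs IH] x y /=.
  by move=> -> ->; rewrite /padd /pt_origin /=; congr pair; ring.
case=> s [x' [s0 [cx ->]]] [t [y' [t0 [cy ->]]]].
exists (Rplus s t), (padd x' y'); split; first by lra.
split; first exact: IH.
by rewrite /pscale /padd /=; congr pair; ring.
Qed.

Lemma cone_gen0 vs : cone_gen vs pt_origin.
Proof.
elim: vs => //= v vs IH; exists R0, pt_origin; split; first by lra.
by split=> //; rewrite /padd /pscale /pt_origin /=; congr pair; ring.
Qed.

Lemma cone_gen_nth vs i : (i < size vs)%N -> cone_gen vs (nth pt_origin vs i).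
Proof.
elim: vs i => // v vs IH [|i] hi /=.
  exists R1, pt_origin; split; first by lra.
  split; first exact: cone_gen0.
  by case: v {hi} => a b; rewrite /padd /pscale /pt_origin /=; congr pair; ring.
exists R0, (nth pt_origin vs i); split; first by lra.
split; first exact: IH.
by case: (nth _ _ _) => a b; rewrite /padd /pscale /=; congr pair; ring.
Qed.

Lemma cone_gen_sub vs ws : (forall i, (i < size vs)%N -> cone_gen ws (nth pt_origin vs i)) ->
  forall x, cone_gen vs x -> cone_gen ws x.
Proof.
elim: vs => [|v vs IH] h x /=; first by move=> ->; exact: cone_gen0.
case=> t [y [t0 [cy ->]]]; apply: cone_gen_add.
  by apply: cone_gen_scale => //; exact: (h 0%N).
by apply: IH => // i; exact: (h i.+1).
Qed.

Lemma set_eq_sym C D : set_eq C D -> set_eq D C.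
Proof. by move=> h x; split=> /h. Qed.

Lemma set_eq_trans C D H : set_eq C D -> set_eq D H -> set_eq C H.
Proof. by move=> h h' x; rewrite h h'. Qed.

Lemma cone_gen1P v x : cone_gen [:: v] x <->
  exists t, Rle R0 t /\ x = (Rmult t v.1, Rmult t v.2).
Proof.
split=> [[t [y [t0 [/= -> ->]]]]|[t [t0 ->]]]; exists t.
  by split=> //; rewrite /padd /pscale /=; congr pair; ring.
exists pt_origin; split=> //; split=> //.
by rewrite /padd /pscale /=; congr pair; ring.
Qed.

Lemma cone_gen2P v w x : cone_gen [:: v; w] x <->
  exists s t, [/\ Rle R0 s, Rle R0 t &
    x = (Rplus (Rmult s v.1) (Rmult t w.1), Rplus (Rmult s v.2) (Rmult t w.2))].
Proof.
split=> [[s [y [s0 [/cone_gen1P [t [t0 ->]] ->]]]]|[s [t [s0 t0 ->]]]].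
  by exists s, t.
exists s, (Rmult t w.1, Rmult t w.2); split=> //; split=> //.
by apply/cone_gen1P; exists t.
Qed.

Lemma cone_gen2C v w : set_eq (cone_gen [:: v; w]) (cone_gen [:: w; v]).
Proof.
by move=> x; rewrite !cone_gen2P; split=> -[s [t [s0 t0 ->]]]; exists t, s; split=> //;
  congr pair; ring.
Qed.

Lemma set_eq_cone_gen vs ws :
  (forall i, (i < size vs)%N -> cone_gen ws (nth pt_origin vs i)) ->
  (forall i, (i < size ws)%N -> cone_gen vs (nth pt_origin ws i)) ->
  set_eq (cone_gen vs) (cone_gen ws).
Proof. by move=> h1 h2 x; split; apply: cone_gen_sub. Qed.

Lemma cone_two_values vs v w :
  (forall i, (i < size vs)%N -> nth pt_origin vs i = v \/ nth pt_origin vs i = w) ->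
  [\/ set_eq (cone_gen vs) (cone_gen [::]), set_eq (cone_gen vs) (cone_gen [:: v]),
     set_eq (cone_gen vs) (cone_gen [:: w]) | set_eq (cone_gen vs) (cone_gen [:: v; w])].
Proof.
move=> h.
have mv ws u i : (i < size ws)%N -> nth pt_origin ws i = u -> cone_gen ws u.
  by move=> hi <-; exact: cone_gen_nth.
case: (classic (exists2 i, (i < size vs)%N & nth pt_origin vs i = v)) => [[i hi iv]|nv];
case: (classic (exists2 i, (i < size vs)%N & nth pt_origin vs i = w)) => [[j hj jw]|nw].
- constructor 4; apply: set_eq_cone_gen.
    by move=> l /h [] ->; [exact: (mv _ v 0%N) | exact: (mv _ w 1%N)].
  by move=> [|[|]] //= _; [exact: mv iv | exact: mv jw].
- constructor 2; apply: set_eq_cone_gen.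
    move=> l hl; case: (h l hl) => e; rewrite e; first exact: (mv _ v 0%N).
    by case: nw; exists l.
  by move=> [|] //= _; exact: mv iv.
- constructor 3; apply: set_eq_cone_gen.
    move=> l hl; case: (h l hl) => e; rewrite e; last exact: (mv _ w 0%N).
    by case: nv; exists l.
  by move=> [|] //= _; exact: mv jw.
constructor 1; apply: (@set_eq_cone_gen vs [::]) => // l hl; case: (h l hl) => e.
  by case: nv; exists l.
by case: nw; exists l.
Qed.

Lemma rho_map_cone l vs : set_eq (image_cone (rho_map l) (cone_gen vs))
  (cone_gen (map (rho_map l) vs)).
Proof.
have lin t v y : rho_map l (padd (pscale t v) y) = padd (pscale t (rho_map l v)) (rho_map l y).
  by rewrite /rho_map /padd /pscale /=; congr pair; ring.
elim: vs => [|v vs IH] x /=.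
  split=> [[y [-> ->]]|->]; first by rewrite /rho_map /pt_origin /=; congr pair; ring.
  by exists pt_origin; split=> //; rewrite /rho_map /pt_origin /=; congr pair; ring.
split=> [[y [[t [z [t0 [cz ->]]]] ->]]|[t [y [t0 [/IH [z [cz ->]] ->]]]]].
  by exists t, (rho_map l z); split=> //; split; [apply/IH; exists z | rewrite lin].
by exists (padd (pscale t v) z); split; [exists t, z | rewrite lin].
Qed.

Lemma image_cone_eq f C D : set_eq C D -> set_eq (image_cone f C) (image_cone f D).
Proof. by move=> h x; split=> -[y [/h cy ->]]; exists y. Qed.

Lemma ray_not_twodim C : is_ray C -> is_twodim C -> False.
Proof.
move=> [v [_ e]] [u [w [/e /cone_gen1P [s [_ ->]] [/e /cone_gen1P [t [_ ->]] d]]]].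
by apply: d; rewrite /pdet /=; ring.
Qed.

Lemma is_ray_cone v : v <> pt_origin -> is_ray (cone_gen [:: v]).
Proof. by move=> h; exists v; split. Qed.

Lemma is_twodim_cone v w : pdet v w <> R0 -> is_twodim (cone_gen [:: v; w]).
Proof.
move=> h; exists v, w; split; first exact: (@cone_gen_nth [:: v; w] 0).
by split=> //; exact: (@cone_gen_nth [:: v; w] 1).
Qed.

Lemma is_ray_eq C D : set_eq C D -> is_ray C -> is_ray D.
Proof. by move=> e [v [n h]]; exists v; split=> // x; rewrite -e. Qed.

Lemma is_twodim_eq C D : set_eq C D -> is_twodim C -> is_twodim D.
Proof. by move=> e [v [w [/e hv [/e hw h]]]]; exists v, w. Qed.

Definition in_quadrant (v : point) := Rle R0 v.1 /\ Rle v.2 R0.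

Lemma cone_in_quadrant vs x : (forall i, (i < size vs)%N -> in_quadrant (nth pt_origin vs i)) ->
  cone_gen vs x -> in_quadrant x.
Proof.
elim: vs x => [|v vs IH] x h /=.
  by move=> ->; split=> /=; lra.
case=> t [y [t0 [cy ->]]]; have [y1 y2] := IH y (fun i => h i.+1) cy.
have [/= v1 v2] := h 0%N isT; split=> /=; nra.
Qed.

(** A single quadrant contains no two opposite nonzero vectors: if all generators are proportional
    to the first, they are nonnegative multiples of it and span a ray rather than a line. *)
Lemma quadrant_cone_cases vs :
  (forall i, (i < size vs)%N -> in_quadrant (nth pt_origin vs i) /\ nth pt_origin vs i <> pt_origin) ->
  [\/ set_eq (cone_gen vs) (cone_gen [::]), is_ray (cone_gen vs) | is_twodim (cone_gen vs)].
Proof.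
case: vs => [|v vs] h; first by constructor 1.
case: (classic (exists2 i, (i < size (v :: vs))%N & pdet v (nth pt_origin (v :: vs) i) <> R0)).
  case=> i hi d; constructor 3; exists v, (nth pt_origin (v :: vs) i); split.
    exact: (@cone_gen_nth (v :: vs) 0).
  by split=> //; exact: cone_gen_nth.
move=> nd; constructor 2; have [[/= v1 v2] vn] := h 0%N isT.
exists v; split; first exact: vn.
apply: (@set_eq_cone_gen (v :: vs) [:: v]); last first.
  by move=> [|] // _; exact: (@cone_gen_nth (v :: vs) 0).
move=> i hi; have [[w1 w2] _] := h i hi.
have d : pdet v (nth pt_origin (v :: vs) i) = R0.
  by apply: NNPP => h'; apply: nd; exists i.
move: (nth _ _ _) w1 w2 d => [a b] /= a0 b0; rewrite /pdet /=.
case: v v1 v2 vn {h nd hi} => [x y] /= x0 y0 vn d; apply/cone_gen1P => /=.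
case: (Rle_lt_or_eq_dec _ _ x0) => [xp|xz].
  exists (Rdiv a x); split; first by apply: Rmult_le_pos => //; left; exact: Rinv_0_lt_compat.
  by congr pair; apply: (Rmult_eq_reg_l x); try lra; field_simplify; try lra.
have yn : Rlt y R0.
  by case: (Rle_lt_or_eq_dec _ _ y0) => // yz; case: vn; rewrite -xz yz.
exists (Rdiv b y); split.
  have -> : Rdiv b y = Rdiv (Ropp b) (Ropp y) by field; lra.
  by apply: Rmult_le_pos; [lra | left; apply: Rinv_0_lt_compat; lra].
have a00 : a = R0 by apply: (Rmult_eq_reg_l y); [rewrite -xz in d; lra | lra].
by congr pair; [rewrite -xz a00; ring | field; lra].
Qed.

(** The positive axis is an extreme ray of the quadrant, so a sum lies on it only if its terms
    do. *)
Lemma cone_axis_generator vs x : (forall i, (i < size vs)%N -> in_quadrant (nth pt_origin vs i)) ->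
  cone_gen vs x -> x.2 = R0 -> Rlt R0 x.1 ->
  exists2 i, (i < size vs)%N & (nth pt_origin vs i).2 = R0 /\ Rlt R0 (nth pt_origin vs i).1.
Proof.
elim: vs x => [|v vs IH] x h /=.
  by move=> -> _ /=; lra.
case=> t [y [t0 [cy ->]]] /= e l.
have [/= v1 v2] := h 0%N isT.
have [y1 y2] := cone_in_quadrant (fun i => h i.+1) cy.
have tv : Rle (Rmult t v.2) R0 by nra.
case: (Rle_lt_or_eq_dec _ _ y1) => [yp|yz].
  have [|i hi H] := IH y (fun i => h i.+1) cy _ yp; first by lra.
  by exists i.+1.
exists 0%N => //=.
have tp : Rlt R0 (Rmult t v.1) by lra.
by split; nra.
Qed.

Lemma cone_below_generator vs x : cone_gen vs x -> Rlt x.2 R0 ->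
  exists2 i, (i < size vs)%N & Rlt (nth pt_origin vs i).2 R0.
Proof.
elim: vs x => [|v vs IH] x /=; first by move=> -> /=; lra.
case=> t [y [t0 [cy ->]]] /= l.
case: (Rlt_le_dec v.2 R0) => [h|h]; first by exists 0%N.
have [|i hi H] := IH y cy; first by nra.
by exists i.+1.
Qed.

(** Generators of the cones common to the g-fans of all triangular algebras: the first, second and
    third quadrants and their faces. *)
Inductive special_gens : seq point -> Prop :=
| special_zero : special_gens [::]
| special_e1 : special_gens [:: (R1, R0)]
| special_e2 : special_gens [:: (R0, R1)]
| special_Ne1 : special_gens [:: (Ropp R1, R0)]
| special_Ne2 : special_gens [:: (R0, Ropp R1)]
| special_pp : special_gens [:: (R1, R0); (R0, R1)]
| special_mm : special_gens [:: (Ropp R1, R0); (R0, Ropp R1)]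
| special_mp : special_gens [:: (Ropp R1, R0); (R0, R1)].

(** * The g-fan of a triangular algebra *)

Section TriangularFan.
Variables (k : fieldType) (A : falgType k) (e1 e2 : A).
Hypothesis loc1 : local_idem e1.
Hypothesis loc2 : local_idem e2.
Hypothesis tri : forall z, e2 * z * e1 = 0.
Let e11 : e1 * e1 = e1 := loc1.1.
Let e22 : e2 * e2 = e2 := loc2.1.
Local Notation zobj := (zero_obj e1 e2).
Local Notation gv := (map (fun T : cobj e1 e2 => gvec T)).

Definition pm_family Os := presilting_family e11 e22 Os /\
  forall i, (i < size Os)%N -> plus_minus (nth zobj Os i).

Lemma gfan_eq C D : set_eq C D -> gfan e1 e2 D -> gfan e1 e2 C.
Proof. by move=> h [Ts [a b]]; exists Ts; split=> // x; rewrite h b. Qed.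

Lemma family_gfan Os vs : presilting_family e11 e22 Os -> gv Os = vs ->
  gfan e1 e2 (cone_gen vs).
Proof. by move=> h <-; apply/(gfanP e11 e22); exists Os. Qed.

Lemma family_tail T U : presilting_family e11 e22 [:: T; U] -> presilting_family e11 e22 [:: U].
Proof. by case=> h1 h2 h3; apply: family1; [exact: (h1 1%N) | exact: (h3 1%N 1%N)]. Qed.

Lemma stalk_families t :
  [/\ presilting_family e11 e22 [:: stalks e1 e2 [::] [:: t]],
      presilting_family e11 e22 [:: stalks e1 e2 [:: t] [::]],
      presilting_family e11 e22 [:: stalks e1 e2 [::] [:: false]; stalks e1 e2 [::] [:: true]],
      presilting_family e11 e22 [:: stalks e1 e2 [:: false] [::]; stalks e1 e2 [:: true] [::]] &
      presilting_family e11 e22 [:: stalks e1 e2 [:: false] [::]; stalks e1 e2 [::] [:: true]]].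
Proof.
have ind s r : (size s + size r = 1)%N -> indec e11 e22 (stalks e1 e2 s r).
  exact: stalk_indec.
have lab s r s' r' : iso e11 e22 (stalks e1 e2 s r) (stalks e1 e2 s' r') ->
   {subset r <= r'} /\ {subset s <= s'}.
  exact: (minimal_iso_labels loc1 loc2 tri (@stalks_minimal _ _ _ _ loc1 loc2 s r)).
split.
- by apply: family1; [exact: ind | exact: homzero_from_degree0].
- by apply: family1; [exact: ind | exact: homzero_to_shift].
- apply: family2; try exact: ind; try exact: homzero_from_degree0.
  by move=> /lab [/(_ false (mem_head _ _))].
- apply: family2; try exact: ind; try exact: homzero_to_shift.
  by move=> /lab [_ /(_ false (mem_head _ _))].
apply: family2; try exact: ind; try exact: homzero_to_shift; try exact: homzero_from_degree0.
  by move=> /lab [_ /(_ false (mem_head _ _))].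
move=> f hf; exists 0, 0; split; try exact: mhom0.
rewrite mulmx0 ?mul0mx addr0; apply/matrixP => i j.
have := hom_corner i j hf; rewrite !ord1 /= mxE => /corner_eq <-.
exact: tri.
Qed.

Lemma special_gfan vs : special_gens vs -> gfan e1 e2 (cone_gen vs).
Proof.
have g s r : gvec (stalks e1 e2 s r) = (Rminus (INR (count negb r)) (INR (count negb s)),
   Rminus (INR (count id r)) (INR (count id s))) by [].
have [f1 f2 f3 f4 f5] := stalk_families false; have [f6 f7 _ _ _] := stalk_families true.
have e : presilting_family e11 e22 [::] by split.
case; [apply: family_gfan e _|apply: family_gfan f1 _|apply: family_gfan f6 _|
  apply: family_gfan f2 _|apply: family_gfan f7 _|apply: family_gfan f3 _|
  apply: family_gfan f4 _|apply: family_gfan f5 _] => //=;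
  rewrite !g /= /Rminus; repeat (congr cons || congr pair); ring.
Qed.

(** By [classification], whatever depends on the algebra is contained in the families of
    [plus_minus] complexes. *)
Lemma gfan_char C : gfan e1 e2 C <->
  (exists2 vs, special_gens vs & set_eq C (cone_gen vs)) \/
  (exists2 Os, pm_family Os & set_eq C (cone_gen (gv Os))).
Proof.
split; last first.
  case=> [[vs h e]|[Os [h _] e]]; apply: gfan_eq e _; first exact: special_gfan.
  exact: family_gfan h _.
move=> /(gfanP e11 e22) [Os [h e]].
case: (classification loc1 loc2 tri h) => [[Ss [hS eS pS]]|[v [w [sp H]]]].
  by right; exists Ss => //; rewrite eS.
left; case: (@cone_two_values (gv Os) v w) => [i hi|e'|e'|e'|e'].
- by move: hi; rewrite size_map => hi; rewrite (nth_map zobj) //; exact: H.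
- by exists [::]; [constructor | exact: set_eq_trans e e'].
- exists [:: v]; last exact: set_eq_trans e e'.
  by case: sp => -[-> _]; constructor.
- exists [:: w]; last exact: set_eq_trans e e'.
  by case: sp => -[_ ->]; constructor.
exists [:: v; w]; last exact: set_eq_trans e e'.
by case: sp => -[-> ->]; constructor.
Qed.

Lemma pm_family_gvec Os i : pm_family Os -> (i < size (gv Os))%N ->
  in_quadrant (nth pt_origin (gv Os) i) /\ nth pt_origin (gv Os) i <> pt_origin.
Proof.
rewrite size_map => -[[h _ _] pm] hi; rewrite (nth_map zobj) //.
have pmi := pm i hi; have [nz _] := h i hi.
rewrite (gvec_plus_minus pmi); split.
  by split=> /=; [exact: pos_INR | have := pos_INR (size (cm1 (nth zobj Os i))); lra].
case=> a b; apply: nz; apply/(plus_minus_iso_zero _ _ loc1 loc2 tri pmi).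
by split; apply: INR_eq; rewrite /=; lra.
Qed.

End TriangularFan.

(** * Rotation of the fan *)

Section RotatedFan.
Variables (k : fieldType) (A G : falgType k) (e1 e2 : A) (g1 g2 : G) (n : nat).
Hypothesis loc1 : local_idem e1.
Hypothesis loc2 : local_idem e2.
Hypothesis tri : forall z, e2 * z * e1 = 0.
Hypothesis locg1 : local_idem g1.
Hypothesis locg2 : local_idem g2.
Hypothesis trig : forall z, g2 * z * g1 = 0.
Local Notation "0L" := (zero_obj e1 e2).
Local Notation "0G" := (zero_obj g1 g2).
Local Notation gvL := (map (fun T : cobj e1 e2 => gvec T)).
Local Notation gvG := (map (fun T : cobj g1 g2 => gvec T)).
Local Notation FL := (gfan e1 e2).
Local Notation FG := (gfan g1 g2).
Local Notation rho_cone C := (image_cone (rho_map n) C).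

Hypothesis to_G : forall Os, pm_family loc1 loc2 Os ->
  (exists2 Ss, pm_family locg1 locg2 Ss & gvG Ss = map (rho_map n) (gvL Os)) \/
  (forall i, (i < size (gvL Os))%N ->
     nth pt_origin (gvL Os) i = (R1, R0) \/ nth pt_origin (gvL Os) i = (INR n, Ropp R1)).
Hypothesis to_L : forall Ss, pm_family locg1 locg2 Ss ->
  (exists2 Os, pm_family loc1 loc2 Os & gvG Ss = map (rho_map n) (gvL Os)) \/
  (forall i, (i < size (gvG Ss))%N ->
     nth pt_origin (gvG Ss) i = (R0, Ropp R1) \/ nth pt_origin (gvG Ss) i = (R1, Ropp (INR n))).
Hypothesis U_cone : FL (cone_gen [:: (R1, R0); (INR n, Ropp R1)]).
Hypothesis U_ray : FL (cone_gen [:: (INR n, Ropp R1)]).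
Hypothesis W_cone : FG (cone_gen [:: (R0, Ropp R1); (R1, Ropp (INR n))]).
Hypothesis W_ray : FG (cone_gen [:: (R1, Ropp (INR n))]).

Lemma rho_map_pt (a b c d : R) : Ropp b = c -> Rplus a (Rmult (INR n) b) = d ->
  rho_map n (a, b) = (c, d).
Proof. by move=> <- <-. Qed.

Lemma rho_image C vs ws : set_eq C (cone_gen vs) -> map (rho_map n) vs = ws ->
  set_eq (rho_cone C) (cone_gen ws).
Proof. by move=> e <-; apply: set_eq_trans (image_cone_eq _ e) (rho_map_cone n vs). Qed.

(** The special cones that survive have explicit images, two of which come from [W]. In the
    exceptional case of [to_G] the cone is a face of the adjacent cone, and its image is a face of
    [sigma_plus]. *)
Lemma rho_fan_L C : FL C -> ~ set_eq C (cone_gen [:: (R0, R1)]) ->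
  ~ set_eq C sigma_plus -> ~ set_eq C sigma_mp -> FG (rho_cone C).
Proof.
have sp := special_gfan locg1 locg2 trig.
move=> /(gfan_char loc1 loc2 tri) [[vs svs e]|[Os pm e]] n1 n2 n3.
  case: svs e => e.
  - exact: gfan_eq (rho_image e erefl) (sp _ special_zero).
  - apply: gfan_eq (@rho_image _ _ [:: (R0, R1)] e _) _; last by apply: sp; constructor.
    by rewrite /= (@rho_map_pt _ _ R0 R1) //; ring.
  - by [].
  - apply: gfan_eq (@rho_image _ _ [:: (R0, Ropp R1)] e _) _; last by apply: sp; constructor.
    by rewrite /= (@rho_map_pt _ _ R0 (Ropp R1)) //; ring.
  - apply: gfan_eq (@rho_image _ _ [:: (R1, Ropp (INR n))] e _) W_ray.
    by rewrite /= (@rho_map_pt _ _ R1 (Ropp (INR n))) //; ring.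
  - by [].
  - apply: gfan_eq (@rho_image _ _ [:: (R0, Ropp R1); (R1, Ropp (INR n))] e _) W_cone.
    rewrite /= (@rho_map_pt _ _ R0 (Ropp R1)) ?(@rho_map_pt _ _ R1 (Ropp (INR n))) //; ring.
  - by [].
case: (to_G pm) => [[Ss pS eS]|h].
  apply: gfan_eq (rho_image e erefl) _; rewrite -eS.
  by apply/(gfan_char locg1 locg2 trig); right; exists Ss.
have r1 : rho_map n (R1, R0) = (R0, R1) by apply: rho_map_pt; ring.
have r2 : rho_map n (INR n, Ropp R1) = (R1, R0) by apply: rho_map_pt; ring.
case: (cone_two_values h) => e'; have e2' := set_eq_trans e e'.
- exact: gfan_eq (rho_image e2' erefl) (sp _ special_zero).
- apply: gfan_eq (@rho_image _ _ [:: (R0, R1)] e2' _) (sp _ special_e2).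
  by rewrite /= r1.
- apply: gfan_eq (@rho_image _ _ [:: (R1, R0)] e2' _) (sp _ special_e1).
  by rewrite /= r2.
- apply: gfan_eq (@rho_image _ _ [:: (R0, R1); (R1, R0)] e2' _) _.
    by rewrite /= r1 r2.
  exact: gfan_eq (cone_gen2C _ _) (sp _ special_pp).
Qed.

Lemma rho_intro C vs ws : set_eq C (cone_gen ws) -> map (rho_map n) vs = ws ->
  rho_pre n FL (cone_gen vs) -> rho n FL C.
Proof.
move=> e E h; rewrite -E in e; exists (cone_gen vs); split=> //.
exact: set_eq_trans e (set_eq_sym (rho_map_cone n vs)).
Qed.

Lemma ray_pre v : v <> pt_origin -> FL (cone_gen [:: v]) -> (v.1 <> R0 \/ Rlt v.2 R0) ->
  rho_pre n FL (cone_gen [:: v]).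
Proof.
move=> v0 h nv; right; left; split=> //; split; first exact: is_ray_cone.
move=> e; have /e /cone_gen1P [t [t0 E]] := @cone_gen_nth [:: v] 0 isT.
move: E nv => /= ->; rewrite /=; case; lra.
Qed.

(** Both removed two-dimensional cones contain [(R0, R1)], so missing this one point keeps a
    cone. *)
Lemma twodim_pre v w : pdet v w <> R0 -> FL (cone_gen [:: v; w]) ->
  ~ cone_gen [:: v; w] (R0, R1) -> rho_pre n FL (cone_gen [:: v; w]).
Proof.
move=> d h nv; right; right; right; left; split=> //; split; first exact: is_twodim_cone.
split=> e; apply: nv; apply/e; exact: (@cone_gen_nth [:: _; _] 1).
Qed.

(** Every cone is traced back to a cone of [rho_pre]. The first quadrant comes from the adjacent
    cone, and the third and second from the two added cones; in the exceptional case of [to_L] the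
    cone comes from a face of the negative of [sigma_plus]. *)
Lemma rho_fan_G C : FG C -> rho n FL C.
Proof.
have spL := special_gfan loc1 loc2 tri.
have r1 : rho_map n (R1, R0) = (R0, R1) by apply: rho_map_pt; ring.
have r2 : rho_map n (INR n, Ropp R1) = (R1, R0) by apply: rho_map_pt; ring.
have r3 : rho_map n (Ropp R1, R0) = (R0, Ropp R1) by apply: rho_map_pt; ring.
have r4 : rho_map n (R0, Ropp R1) = (R1, Ropp (INR n)) by apply: rho_map_pt; ring.
have r5 : rho_map n (Ropp (INR n), R1) = (Ropp R1, R0) by apply: rho_map_pt; ring.
have pt a b : a <> R0 \/ b <> R0 -> (a, b) <> pt_origin by move=> h [] *; case: h.
have ray_e1 : rho_pre n FL (cone_gen [:: (R1, R0)]).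
  apply: ray_pre; [by apply: pt; left; lra | by apply: spL; constructor | by left => /=; lra].
have ray_Ne1 : rho_pre n FL (cone_gen [:: (Ropp R1, R0)]).
  apply: ray_pre; [by apply: pt; left; lra | by apply: spL; constructor | by left => /=; lra].
have ray_Ne2 : rho_pre n FL (cone_gen [:: (R0, Ropp R1)]).
  apply: ray_pre; [by apply: pt; right; lra | by apply: spL; constructor | by right => /=; lra].
have ray_U : rho_pre n FL (cone_gen [:: (INR n, Ropp R1)]).
  apply: ray_pre; [by apply: pt; right; lra | exact: U_ray | by right => /=; lra].
have cone_mm : rho_pre n FL (cone_gen [:: (Ropp R1, R0); (R0, Ropp R1)]).
  apply: twodim_pre; [by rewrite /pdet /=; lra | by apply: spL; constructor |].
  by move=> /cone_gen2P [s [t [s0 t0 [/= E1 E2]]]]; lra.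
have cone_U : rho_pre n FL (cone_gen [:: (R1, R0); (INR n, Ropp R1)]).
  apply: twodim_pre; [by rewrite /pdet /=; lra | exact: U_cone |].
  by move=> /cone_gen2P [s [t [s0 t0 [/= E1 E2]]]]; lra.
have zero_pre : rho_pre n FL (cone_gen [::]) by left.
move=> /(gfan_char locg1 locg2 trig) [[vs svs e]|[Ss pm e]].
  case: svs e => e.
  - exact: (@rho_intro _ [::] [::] e erefl zero_pre).
  - by apply: (rho_intro e _ ray_U); rewrite /= r2.
  - by apply: (rho_intro e _ ray_e1); rewrite /= r1.
  - by apply: (@rho_intro _ [:: (Ropp (INR n), R1)] _ e); rewrite /= ?r5 //; right; right; left.
  - by apply: (rho_intro e _ ray_Ne1); rewrite /= r3.
  - by apply: (rho_intro (set_eq_trans e (cone_gen2C _ _)) _ cone_U); rewrite /= r1 r2.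
  - apply: (@rho_intro _ [:: (Ropp R1, R0); (Ropp (INR n), R1)] _ (set_eq_trans e (cone_gen2C _ _))).
      by rewrite /= r3 r5.
    by do 4 right; left.
  - apply: (@rho_intro _ [:: (Ropp (INR n), R1); (R1, R0)] _ e).
      by rewrite /= r1 r5.
    by do 5 right.
case: (to_L pm) => [[Os pO eO]|h].
  apply: (rho_intro e (esym eO)).
  have FO : FL (cone_gen (gvL Os)) by apply/(gfan_char loc1 loc2 tri); right; exists Os.
  (* A cone in the fourth quadrant misses [(R0, R1)], which every removed cone contains. *)
  have noup : ~ cone_gen (gvL Os) (R0, R1).
    move=> /(cone_in_quadrant (fun i hi => (pm_family_gvec tri pO hi).1)) [/=]; lra.
  case: (quadrant_cone_cases (fun i hi => pm_family_gvec tri pO hi)) => [z|z|z].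
  - by left.
  - right; left; split=> //; split=> // e'; apply: noup; apply/e'.
    exact: (@cone_gen_nth [:: _] 0).
  - right; right; right; left; split=> //; split=> //.
    by split=> e'; apply: noup; apply/e'; exact: (@cone_gen_nth [:: _; _] 1).
case: (cone_two_values h) => e'; have e2' := set_eq_trans e e'.
- exact: (@rho_intro _ [::] [::] e2' erefl zero_pre).
- by apply: (rho_intro e2' _ ray_Ne1); rewrite /= r3.
- by apply: (rho_intro e2' _ ray_Ne2); rewrite /= r4.
- by apply: (rho_intro e2' _ cone_mm); rewrite /= r3 r4.
Qed.

Lemma gfan_rotation : fan_eq FG (rho n FL).
Proof.
move=> C; split; first exact: rho_fan_G.
have sp := special_gfan locg1 locg2 trig.
have tp : is_twodim sigma_plus by apply: is_twodim_cone; rewrite /pdet /=; lra.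
have tm : is_twodim sigma_mp by apply: is_twodim_cone; rewrite /pdet /=; lra.
have r1 : rho_map n (R1, R0) = (R0, R1) by apply: rho_map_pt; ring.
have r3 : rho_map n (Ropp R1, R0) = (R0, Ropp R1) by apply: rho_map_pt; ring.
have r5 : rho_map n (Ropp (INR n), R1) = (Ropp R1, R0) by apply: rho_map_pt; ring.
case=> C' [H e]; apply: gfan_eq e _.
case: H => [z|[[F [r n1]]|[z|[[F [t [n2 n3]]]|[z|z]]]]].
- exact: gfan_eq (rho_image z erefl) (sp _ special_zero).
- apply: rho_fan_L => // e'.
    by apply: ray_not_twodim r (is_twodim_eq (set_eq_sym e') tp).
  by apply: ray_not_twodim r (is_twodim_eq (set_eq_sym e') tm).
- apply: gfan_eq (@rho_image _ _ [:: (Ropp R1, R0)] z _) (sp _ special_Ne1).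
  by rewrite /= r5.
- apply: rho_fan_L => // e'; apply: ray_not_twodim _ t.
  by apply: is_ray_eq (set_eq_sym e') _; apply: is_ray_cone => -[] *; lra.
- apply: gfan_eq (@rho_image _ _ [:: (R0, Ropp R1); (Ropp R1, R0)] z _) _.
    by rewrite /= r3 r5.
  exact: gfan_eq (cone_gen2C _ _) (sp _ special_mm).
- apply: gfan_eq (@rho_image _ _ [:: (Ropp R1, R0); (R0, R1)] z _) (sp _ special_mp).
  by rewrite /= r1 r5.
Qed.

(** The cone has a generator on the positive first axis, whose rotation lies on the positive second
    axis; so its family has no counterpart over [G], and its generators are among [(R1, R0)] and
    [(INR n, Ropp R1)]. Comparing the cones in both directions gives [l = n]. *)
Lemma adj_cone_unique l : FL (adj_cone l) -> l = n.
Proof.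
have m1 : adj_cone l (R1, R0) := @cone_gen_nth [:: _; _] 0 isT.
have m2 : adj_cone l (INR l, Ropp R1) := @cone_gen_nth [:: _; _] 1 isT.
move=> /(gfan_char loc1 loc2 tri) [[vs svs e]|[Os pm e]].
  exfalso; move/e: m1; move/e: m2; case: svs e => e.
  - by move=> [] *; lra.
  - by move=> /cone_gen1P [s [s0 [/= ? ?]]]; lra.
  - by move=> /cone_gen1P [s [s0 [/= ? ?]]]; lra.
  - by move=> /cone_gen1P [s [s0 [/= ? ?]]]; lra.
  - by move=> _ /cone_gen1P [s [s0 [/= ? ?]]]; lra.
  - by move=> /cone_gen2P [s [t [s0 t0 [/= ? ?]]]]; lra.
  - by move=> _ /cone_gen2P [s [t [s0 t0 [/= ? ?]]]]; lra.
  - by move=> /cone_gen2P [s [t [s0 t0 [/= ? ?]]]]; lra.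
have quad i (hi : (i < size (gvL Os))%N) := (pm_family_gvec tri pm hi).1.
case: (to_G pm) => [[Ss pS eS]|h].
  have [i hi [a b]] := cone_axis_generator quad ((e _).1 m1) erefl Rlt_0_1.
  have hi' : (i < size (gvG Ss))%N by rewrite eS size_map.
  have [[_ q] _] := pm_family_gvec trig pS hi'.
  by move: q; rewrite eS (nth_map pt_origin) //= a; lra.
have sub y : adj_cone l y -> cone_gen [:: (R1, R0); (INR n, Ropp R1)] y.
  move=> /e; apply: cone_gen_sub => i hi; case: (h i hi) => ->.
    exact: (@cone_gen_nth [:: _; _] 0).
  exact: (@cone_gen_nth [:: _; _] 1).
have /sub /cone_gen2P [s [t [s0 t0 [/= E1 E2]]]] := m2.
(* Some generator lies below the axis, and this is the only candidate. *)
have mU : adj_cone l (INR n, Ropp R1).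
  have [|i hi neg] := cone_below_generator ((e _).1 m2); first by rewrite /=; lra.
  case: (h i hi) => E; first by move: neg; rewrite E /=; lra.
  by rewrite -E; apply/e; exact: cone_gen_nth.
have /cone_gen2P [s' [t' [s0' t0' [/= E1' E2']]]] := mU.
have t1 : t = R1 by lra.
have t1' : t' = R1 by lra.
by apply: INR_eq; rewrite t1 in E1; rewrite t1' in E1'; lra.
Qed.

End RotatedFan.

(** * Characters and elementary algebras *)

Section Characters.
Variables (k : fieldType) (A : falgType k) (e1 e2 : A).
Hypothesis loc1 : local_idem e1.
Hypothesis loc2 : local_idem e2.
Hypothesis tri : forall z, e2 * z * e1 = 0.
Hypothesis e12 : e1 * e2 = 0.
Hypothesis e21 : e2 * e1 = 0.
Hypothesis e1D2 : e1 + e2 = 1.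
Local Notation idem := (idem e1 e2).
Let e11 : e1 * e1 = e1 := loc1.1.
Let e22 : e2 * e2 = e2 := loc2.1.

Lemma kalg_morphD (f : A -> k) : kalg_morph f -> forall a b, f (a + b) = f a + f b.
Proof. by case=> h _ a b; rewrite -[a]scale1r h mul1r scale1r. Qed.

Lemma kalg_morph0 (f : A -> k) : kalg_morph f -> f 0 = 0.
Proof. by move=> h; apply: (addrI (f 0)); rewrite -(kalg_morphD h) !addr0. Qed.

Lemma kalg_morphZ (f : A -> k) : kalg_morph f -> forall a b, f (a *: b) = a * f b.
Proof. by move=> h a b; have [h' _] := h; rewrite -[a *: b]addr0 h' kalg_morph0 ?addr0. Qed.

Lemma kalg_morphB (f : A -> k) : kalg_morph f -> forall a b, f (a - b) = f a - f b.
Proof. by move=> h a b; rewrite (kalg_morphD h) -scaleN1r (kalg_morphZ h) mulN1r. Qed.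

(** This is the preimage of the radical of the corner. For maximality: if [y] inverts the corner
    part of [x], then [1 - x * y] has zero corner part and lies in the ideal, so [x] together with
    the ideal yields [1]. *)
Lemma local_idem_maximal b :
  maximal_right_ideal (fun x => ~ corner_unit (idem b) (idem b * x * idem b)).
Proof.
have lb : local_idem (idem b) := idem_local loc1 loc2 b.
have bb := lb.1.
have cs z : corner (idem b) (idem b) (idem b * z * idem b) by apply: corner_sand.
(* Triangularity makes the passage to the corner multiplicative: the term through the other
   idempotent contains [e2 * _ * e1]. *)
have mulE z y : idem b * (z * y) * idem b = (idem b * z * idem b) * (idem b * y * idem b).
  have -> : (idem b * z * idem b) * (idem b * y * idem b) = idem b * z * idem b * y * idem b.
    by rewrite !mulrA -(mulrA _ (idem b) (idem b)) bb.
  have split1 : idem b * z * y * idem b = idem b * z * e1 * y * idem b + idem b * z * e2 * y * idem b.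
    by rewrite -!mulrDl -mulrDr e1D2 mulr1.
  rewrite !mulrA split1; case: (b) => /=.
    by rewrite tri !mul0r add0r.
  by rewrite -(mulrA (e1 * z * e2)) -(mulrA _ e2) (mulrA e2) tri mulr0 addr0.
have hI : right_ideal (fun x => ~ corner_unit (idem b) (idem b * x * idem b)).
  split; first by rewrite mulr0 mul0r; apply: corner_unit0.
  split=> [x y hx hy|x y hx]; last by rewrite mulE => /(corner_unit_mul lb (cs x) (cs y)) [].
  by rewrite mulrDr mulrDl => /(corner_unit_add lb (cs x) (cs y)) [].
split=> //; split.
  by apply; rewrite mulr1 bb; apply: corner_unit_id.
move=> I' [I0 [ID IM]] sub I1 x Ix [y [cy [xy _]]]; apply: I1.
have -> : 1 = x * y + (1 - x * y) by rewrite addrC subrK.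
apply: ID; first exact: IM.
apply: sub; rewrite mulrBr mulr1 mulrBl bb.
have -> : idem b * (x * y) * idem b = idem b.
  by rewrite mulE (corner_eq cy) xy.
by rewrite subrr; apply: corner_unit0.
Qed.

(** If all the characters killed the idempotent, it would lie in the Jacobson radical, yet it is
    outside the ideal of [local_idem_maximal]. *)
Lemma elementary_character b : elementary A -> exists2 mu, kalg_morph mu & mu (idem b) = 1.
Proof.
have lb : local_idem (idem b) := idem_local loc1 loc2 b.
case=> m [pi [hpi [_ hJ]]].
case: (classic (exists i, pi i (idem b) <> 0)) => [[i hi]|no].
  exists (pi i) => //; have [_ [hM _]] := hpi i.
  by apply: (mulfI (introN eqP hi)); rewrite mulr1 -hM lb.1.
have : jacobson (idem b).
  by apply/hJ => i; apply: NNPP => h; apply: no; exists i.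
move=> /(_ _ (local_idem_maximal b)); rewrite !lb.1 => h; case: h.
exact: corner_unit_id.
Qed.

Lemma triangular_right_inverse u : corner_unit e1 (e1 * u * e1) -> corner_unit e2 (e2 * u * e2) ->
  exists w, u * w = 1.
Proof.
move=> [c [cc [h1 _]]] [a [ca [h2 _]]].
pose v := e1 * u * e2.
have ue : u = e1 * u * e1 + v + e2 * u * e2.
  rewrite -{1}[u]mul1r -{1}[u]mulr1 -e1D2 mulrDl !mulrDr !mulrA tri add0r.
  by [].
have ca0 : e1 * u * e1 * a = 0 by rewrite -ca.1 -!mulrA (mulrA e1 e2) e12 mul0r !mulr0.
have vc : v * c = 0 by rewrite -cc.1 /v -!mulrA (mulrA e2 e1) e21 mul0r !mulr0.
have ac : e2 * u * e2 * c = 0 by rewrite -cc.1 -!mulrA (mulrA e2 e1) e21 mul0r !mulr0.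
have ev : e1 * v = v by rewrite /v !mulrA e11.
have step : forall z, u * z = e1 * u * e1 * z + v * z + e2 * u * e2 * z.
  by move=> z; rewrite {1}ue !mulrDl.
(* The inverse of an upper triangular matrix with diagonal inverses [c] and [a] and off-diagonal
   entry [v]. *)
exists (c + a - c * (v * a)); rewrite mulrBr mulrDr !step ca0 h2.
rewrite !(mulrA _ c) vc ac h1 !mul0r !addr0 add0r mulrA ev.
by rewrite addrA addrAC addrK.
Qed.

(** Kernels of characters are maximal right ideals, so the radical lies in both. Conversely, if both
    characters kill [z], then [1 - z * g] has unit diagonal corners and is right invertible, which
    puts [z] in every maximal right ideal. *)
Lemma elementary_of_characters (mu1 mu2 : A -> k) : kalg_morph mu1 -> kalg_morph mu2 ->
  mu1 e1 = 1 -> mu2 e2 = 1 -> elementary A.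
Proof.
move=> h1 h2 m11 m22.
have m12 : mu1 e2 = 0.
  by have [_ [_ o]] := h1; move: o; rewrite -e1D2 (kalg_morphD h1) m11 -{2}[1]addr0 => /addrI.
have m21 : mu2 e1 = 0.
  by have [_ [_ o]] := h2; move: o; rewrite -e1D2 (kalg_morphD h2) m22 -{2}[1]add0r => /addIr.
have M1 := h1.2.1; have M2 := h2.2.1.
pose pi (i : 'I_2) := if i == ord0 then mu1 else mu2.
have hpi i : kalg_morph (pi i) by rewrite /pi; case: eqP.
have two (Q : (A -> k) -> Prop) : Q mu1 -> Q mu2 -> forall i, Q (pi i).
  by move=> q1 q2 i; rewrite /pi; case: eqP.
exists 2%N, pi; split=> //; split.
  move=> c; exists (c ord0 *: e1 + c ord_max *: e2) => i.
  rewrite (kalg_morphD (hpi i)) !(kalg_morphZ (hpi i)) /pi.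
  case: (unliftP ord0 i) => [j|] ->; last by rewrite eqxx m11 m12 mulr1 mulr0 addr0.
  rewrite eq_sym (negPf (neq_lift _ _)) m21 m22 mulr1 mulr0 add0r.
  by congr c; apply: val_inj; rewrite /= ord1.
have unit_of mu b z : kalg_morph mu -> mu (idem b) = 1 -> mu z = 0 ->
    corner_unit (idem b) (idem b * (1 - z) * idem b).
  move=> hmu mub mz; have lb : local_idem (idem b) := idem_local loc1 loc2 b.
  have hM := hmu.2.1.
  have cz : corner (idem b) (idem b) (idem b * z * idem b) by apply: corner_sand; exact: lb.1.
  rewrite mulrBr mulr1 mulrBl lb.1; case: (lb.2.2 _ cz) => // -[y [_ [zy _]]].
  have := congr1 mu zy; rewrite !hM mz mulr0 !mul0r mub => /eqP.
  by rewrite eq_sym oner_eq0.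
move=> z; split=> [hz|hz I [[I0 [ID IM]] [I1 max]]].
  move=> i; have hi := hpi i; have Mi := hi.2.1.
  apply: (hz (fun y => pi i y = 0)); split.
    split; first exact: kalg_morph0.
    by split=> [a b ha hb|a b ha]; rewrite ?(kalg_morphD hi) ?Mi ?ha ?hb ?addr0 ?mul0r.
  split; first by rewrite hi.2.2; apply/eqP/oner_neq0.
  move=> I' [I0 [ID IM]] sub I1 a Ia; apply: NNPP => na; apply: I1.
  have -> : 1 = a * ((pi i a)^-1 *: 1) + (1 - a * ((pi i a)^-1 *: 1)) by rewrite addrC subrK.
  apply: ID; first exact: IM.
  apply: sub; rewrite (kalg_morphB hi) Mi (kalg_morphZ hi) hi.2.2 mulr1 divff ?subrr //.
  exact/eqP.
(* The right ideal generated by [I] and [z]; once it is proper, maximality of [I] gives [z] in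
   [I]. *)
pose I' y := exists i g, I i /\ y = i + z * g.
have hI' : right_ideal I'.
  split; first by exists 0, 0; rewrite mulr0 addr0.
  split=> [a b [i [g [Ii ->]]] [j [h [Ij ->]]]|a b [i [g [Ii ->]]]].
    by exists (i + j), (g + h); split; [exact: ID | rewrite mulrDr addrACA].
  by exists (i * b), (g * b); split; [exact: IM | rewrite mulrDl mulrA].
apply: (max I') => //.
- by move=> a Ia; exists a, 0; rewrite mulr0 addr0.
- move=> [i [g [Ii e]]]; apply: I1.
  have ei : i = 1 - z * g by rewrite e addrK.
  have mz mu : kalg_morph mu -> mu z = 0 -> mu (z * g) = 0.
    by move=> hmu m0; rewrite hmu.2.1 m0 mul0r.
  have z1 : mu1 z = 0 := hz ord0.
  have z2 : mu2 z = 0 := hz ord_max.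
  have u1 : corner_unit e1 (e1 * i * e1) by rewrite ei; apply: (unit_of mu1 false); rewrite ?mz.
  have u2 : corner_unit e2 (e2 * i * e2) by rewrite ei; apply: (unit_of mu2 true); rewrite ?mz.
  have [w <-] := triangular_right_inverse u1 u2.
  exact: IM.
- by exists 0, 1; rewrite mulr1 add0r.
Qed.

Lemma local_primitive (e : A) : local_idem e -> primitive_idem e.
Proof.
move=> le; have [ee [e0 _]] := le; split=> //; split=> // a b aa bb ab ba abe.
have ca : corner e e a by split; rewrite -abe ?mulrDl ?mulrDr aa ?ba ?ab addr0.
case: (local_idempotent le ca aa) => [->|ae]; first by left.
by right; apply: (addrI a); rewrite abe addr0 ae.
Qed.

End Characters.

(** * The rotated algebra *)

Section RotatedAlgebra.
Variables (k : fieldType) (R : falgType k) (p q E x : R) (n : nat).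
Hypothesis locp : local_idem p.
Hypothesis locq : local_idem q.
Hypothesis EE : E * E = E.
Hypothesis pq : p * q = 0.
Hypothesis qp : q * p = 0.
Hypothesis pE : p * E = 0.
Hypothesis Ep : E * p = 0.
Hypothesis qE : q * E = 0.
Hypothesis Eq : E * q = 0.
Hypothesis cx : corner E q x.
Hypothesis freeE : free_obj p n (E%:M : 'M[R]_1).
Hypothesis gen_x : forall m, corner p q m -> exists2 u, corner p E u & u * x = m.
Hypothesis min_x : forall u, corner p E u -> u * x = 0 ->
  forall s, corner E p s -> ~ corner_unit p (u * s).
Let pp : p * p = p := locp.1.
Let qq : q * q = q := locq.1.

Definition rotation : falgType k := rot_alg pp qq EE pq qp pE Ep qE Eq locp.2.1 cx.
Local Notation val_rot := (vsval : rotation -> R).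
Local Notation f := (p + q + E).
Local Notation in_rot := (in_rot p q E x).

Lemma rotationP (g : rotation) : in_rot (val_rot g).
Proof. exact/rot_vspaceP/subvsP. Qed.

Definition rot_el z (h : in_rot z) : rotation :=
  Subvs (introT (rot_vspaceP p q E x z) h : z \in ASpace (rot_is_aspace pp qq EE pq qp pE Ep qE Eq locp.2.1 cx)).

Lemma rot_elK z (h : in_rot z) : val_rot (rot_el h) = z.
Proof. by []. Qed.

Lemma rotationM (g h : rotation) : val_rot (g * h) = val_rot g * val_rot h.
Proof. by []. Qed.
Lemma rotationD (g h : rotation) : val_rot (g + h) = val_rot g + val_rot h.
Proof. by []. Qed.
Lemma rotationZ a (g : rotation) : val_rot (a *: g) = a *: val_rot g.
Proof. by []. Qed.
Lemma rotation0 : val_rot 0 = 0.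
Proof. by []. Qed.
Lemma rotation_inj (g h : rotation) : val_rot g = val_rot h -> g = h.
Proof. exact: val_inj. Qed.

Lemma corner_left0 (a b c z : R) : corner a b z -> c * a = 0 -> c * z = 0.
Proof. by move=> [<- _] ca; rewrite mulrA ca mul0r. Qed.

Lemma corner_right0 (a b c z : R) : corner a b z -> b * c = 0 -> z * c = 0.
Proof. by move=> [_ <-] bc; rewrite -mulrA bc mulr0. Qed.

Lemma in_rot_Ep z : corner E p z -> in_rot z.
Proof.
move=> cz; have [Ez zp] := cz.
have pz := corner_left0 cz pE; have qz := corner_left0 cz qE.
have zE := corner_right0 cz pE; have zq := corner_right0 cz pq.
have zx : z * x = 0 by rewrite -cx.1 mulrA zE mul0r.
by split; rewrite ?(mulrDl, mulrDr) ?(pz, qz, Ez, zp, zq, zE, zx, mul0r, add0r, addr0) //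
  -mulrA zq mulr0.
Qed.

Lemma in_rot_pp z : corner p p z -> in_rot z.
Proof.
move=> cz; have [pz zp] := cz.
have Ez := corner_left0 cz Ep; have qz := corner_left0 cz qp.
have zE := corner_right0 cz pE; have zq := corner_right0 cz pq.
by split; rewrite ?(mulrDl, mulrDr) ?(pz, qz, Ez, zp, zq, zE, mul0r, add0r, addr0) //
  -mulrA zq mulr0.
Qed.

Lemma in_rot_EEqq s b : corner E E s -> corner q q b -> s * x = x * b -> in_rot (s + b).
Proof.
move=> cs cb sx.
have [Es sE] := cs; have [qb bq] := cb.
have ps := corner_left0 cs pE; have qs := corner_left0 cs qE.
have sp := corner_right0 cs Ep; have sq := corner_right0 cs Eq.
have pb := corner_left0 cb pq; have Eb := corner_left0 cb Eq.
have bp := corner_right0 cb qp; have bE := corner_right0 cb qE.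
have xs : x * s = 0 by rewrite -cx.2 -mulrA qs mulr0.
split; rewrite ?(mulrDl, mulrDr) ?(ps, qs, Es, pb, Eb, qb) ?(sp, sq, sE, bp, bE, bq, mul0r);
  rewrite ?(add0r, addr0) //; first exact: addrC.
by rewrite xs mul0r add0r -mulrA bq.
Qed.

(** Four Peirce components survive. The first two equations are what makes the passages to the
    corners of [p] and [q] multiplicative. *)
Lemma in_rot_sum g : in_rot g -> [/\ p * g = p * g * p, g * q = q * g * q,
  E * g = E * g * E + E * g * p & g = p * g * p + E * g * p + (E * g * E + q * g * q)].
Proof.
move=> [fg _ [h1 h2 h3] [h4 h5]].
have ff' := rot_one_idem pp qq EE pq qp pE Ep qE Eq.
have gf : g * f = g by rewrite -{1}fg -mulrA ff' fg.
have gf' : f * g = g by rewrite -{1}fg !mulrA ff' fg.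
have e1 : p * g = p * g * p by rewrite -{1}gf mulrA 2!mulrDr h1 h2 !addr0.
have e2 : g * q = q * g * q by rewrite -{1}gf' 2!mulrDl 2!mulrDl h2 h3 addr0 add0r.
have e3 : E * g = E * g * E + E * g * p by rewrite -{1}gf mulrA 2!mulrDr h3 addr0 addrC.
have e4 : q * g = q * g * q by rewrite -{1}gf mulrA 2!mulrDr h4 h5 add0r addr0.
split=> //; rewrite -[LHS]gf' 2!mulrDl {1}e1 {1}e3 {1}e4.
by rewrite [E * g * E + _]addrC addrACA [q * g * q + _]addrC.
Qed.

Lemma in_rot_g1 : in_rot (E + q).
Proof.
apply: in_rot_EEqq; first exact: corner_id EE; first exact: corner_id qq.
by rewrite cx.1 cx.2.
Qed.

Definition rot1 : rotation := rot_el in_rot_g1.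
Definition rot2 : rotation := rot_el (in_rot_pp (corner_id pp)).

Lemma rot_val1 : val_rot 1 = f.
Proof.
pose u : rotation := rot_el (in_rot_one pp qq EE pq qp pE Ep qE Eq cx).
have -> : 1 = u; last by [].
rewrite -[u]mulr1; apply: rotation_inj; rewrite rotationM rot_elK.
by have [h _ _ _] := rotationP 1; rewrite -[in RHS]h !mulrA rot_one_idem ?h.
Qed.

Lemma rot_complete : rot1 + rot2 = 1.
Proof. by apply: rotation_inj; rewrite rot_val1 rotationD /= addrC [E + q]addrC addrA. Qed.

Lemma rot_orth12 : rot1 * rot2 = 0.
Proof. by apply: rotation_inj; rewrite rotationM rotation0 /= mulrDl Ep qp addr0. Qed.

Lemma rot_orth21 : rot2 * rot1 = 0.
Proof. by apply: rotation_inj; rewrite rotationM rotation0 /= mulrDr pE pq addr0. Qed.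

Lemma rot_triangular z : rot2 * z * rot1 = 0.
Proof.
apply: rotation_inj; rewrite !rotationM rotation0 /=.
by have [_ _ [h1 h2 _] _] := rotationP z; rewrite mulrDr h1 h2 addr0.
Qed.

Lemma img_rot11 z : img rot1 rot2 val_rot true true z <-> corner p p z.
Proof.
split=> [[a [/= h1 h2] <-]|cz].
  by split; [exact: (congr1 val_rot h1) | exact: (congr1 val_rot h2)].
by exists (rot_el (in_rot_pp cz)) => //; split; apply: rotation_inj; rewrite rotationM /=; case: cz.
Qed.

Lemma rot_corner z g h (hz : in_rot z) : val_rot g * z = z -> z * val_rot h = z ->
  corner g h (rot_el hz).
Proof. by move=> h1 h2; split; apply: rotation_inj. Qed.

Lemma img_rot01 z : img rot1 rot2 val_rot false true z <-> corner E p z.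
Proof.
split=> [[a [/= h1 h2] <-]|cz].
  have k1 : (E + q) * val_rot a = val_rot a := congr1 val_rot h1.
  have k2 : val_rot a * p = val_rot a := congr1 val_rot h2.
  have qa : q * val_rot a = 0 by rewrite -k2 mulrA; have [_ _ _ []] := rotationP a.
  by split=> //; rewrite -[RHS]k1 mulrDl qa addr0.
exists (rot_el (in_rot_Ep cz)) => //; apply: rot_corner => /=; last by case: cz.
by rewrite mulrDl (corner_left0 cz qE) addr0; case: cz.
Qed.

Lemma img_rot00 z : img rot1 rot2 val_rot false false z <->
  exists s b, [/\ corner E E s, corner q q b, s * x = x * b & z = s + b].
Proof.
split=> [[a [/= h1 h2] <-]|[s [b [cs cb sx ->]]]].
  have k1 : (E + q) * val_rot a = val_rot a := congr1 val_rot h1.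
  have k2 : val_rot a * (E + q) = val_rot a := congr1 val_rot h2.
  have Ea : E * val_rot a * p = 0 by rewrite -k2 -!mulrA mulrDl Ep qp addr0 !mulr0.
  have pa : p * val_rot a * p = 0 by rewrite -k1 !mulrA mulrDr pE pq addr0 !mul0r.
  have ha := rotationP a; have [_ aq _ dec] := in_rot_sum ha.
  exists (E * val_rot a * E), (q * val_rot a * q); split.
  - exact: corner_sand.
  - exact: corner_sand.
  - by rewrite -aq mulrA -(mulrA _ E) cx.1; case: ha.
  - by rewrite {1}dec pa Ea !add0r.
exists (rot_el (in_rot_EEqq cs cb sx)) => //; apply: rot_corner => /=.
  rewrite !mulrDl !mulrDr (corner_left0 cs qE) (corner_left0 cb Eq) addr0 add0r.
  by case: cs => ->; case: cb => ->.
rewrite !mulrDl !mulrDr (corner_right0 cs Eq) (corner_right0 cb qE) addr0 add0r.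
by case: cs => _ ->; case: cb => _ ->.
Qed.

Lemma rot2_local : local_idem rot2.
Proof.
split; first by apply: rotation_inj; exact: pp.
split; first by move=> /(congr1 val_rot); exact: locp.2.1.
have unit_rot (w : rotation) : corner_unit p (val_rot w) -> corner_unit rot2 w.
  case=> y [cy [h1 h2]]; exists (rot_el (in_rot_pp cy)).
  by split; [apply: rot_corner; case: cy | split; apply: rotation_inj].
move=> z [h1 h2].
have cz : corner p p (val_rot z) by split; [exact: (congr1 val_rot h1) | exact: (congr1 val_rot h2)].
by case: (locp.2.2 _ cz) => h; [left | right]; apply: unit_rot.
Qed.

(** An element of this corner is a compatible pair, invertible as soon as its [q] part is, by
    [cmat_inv]; localness is thus inherited from [q]. *)
Lemma rot1_local : local_idem rot1.
Proof.
have r11 : rot1 * rot1 = rot1.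
  by apply: rotation_inj; rewrite rotationM /= mulrDl !mulrDr EE Eq qE qq addr0 add0r.
split=> //; split.
  move=> /(congr1 (fun g => q * val_rot g)); rewrite rotation0 /= mulrDr qE qq add0r mulr0.
  exact: locq.2.1.
have unit_rot (w : rotation) s b : corner E E s -> corner q q b -> s * x = x * b ->
    val_rot w = s + b -> corner_unit q b -> corner_unit rot1 w.
  move=> cs cb sx wE [b' [cb' [bb b'b]]].
  have cK : cmat q E x (s%:M : 'M_1) b%:M.
    split; try (by apply/mhom_scalarP => i j; rewrite !ord1 mxE eqxx mulr1n).
    by rewrite -!scalar_mxM sx.
  have hB' : mhom q%:M q%:M (b'%:M : 'M_1).
    by apply/mhom_scalarP => i j; rewrite !ord1 mxE eqxx mulr1n.
  have B1 : b%:M *m b'%:M = q%:M :> 'M_1 by rewrite -scalar_mxM bb.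
  have B2 : b'%:M *m b%:M = q%:M :> 'M_1 by rewrite -scalar_mxM b'b.
  have [K [[hK _ Kx] sK Ks]] := cmat_inv locp cx freeE gen_x min_x cK hB' B1 B2.
  have [s' Es'] : exists s', K = s'%:M by exists (K 0 0); exact: mx11_scalar.
  have inj (c d : R) : c%:M = d%:M :> 'M_1 -> c = d.
    by move=> /matrixP /(_ 0 0); rewrite !mxE eqxx !mulr1n.
  have cs' : corner E E s' by move/mhom_scalarP: hK => /(_ 0 0); rewrite Es' mxE eqxx mulr1n.
  have s'x : s' * x = x * b' by apply: inj; rewrite !scalar_mxM -Es'.
  have ss' : s * s' = E by apply: inj; rewrite scalar_mxM -Es'.
  have s's : s' * s = E by apply: inj; rewrite scalar_mxM -Es'.
  have cross u v : corner E E u -> corner q q v -> u * v = 0 /\ v * u = 0.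
    by move=> cu cv; split; [apply: corner_left0 cv (corner_right0 cu Eq) | apply: corner_left0 cu (corner_right0 cv qE)].
  have [x1 x2] := cross _ _ cs cb'; have [x3 x4] := cross _ _ cs' cb.
  exists (rot_el (in_rot_EEqq cs' cb' s'x)); split; last first.
    by split; apply: rotation_inj; rewrite rotationM wE /= mulrDl !mulrDr ?ss' ?s's ?bb ?b'b;
      rewrite ?x1 ?x2 ?x3 ?x4 addr0 add0r.
  apply: rot_corner => /=.
    rewrite !mulrDl !mulrDr (corner_left0 cs' qE) (corner_left0 cb' Eq) addr0 add0r.
    by case: cs' => ->; case: cb' => ->.
  rewrite !mulrDl !mulrDr (corner_right0 cs' Eq) (corner_right0 cb' qE) addr0 add0r.
  by case: cs' => _ ->; case: cb' => _ ->.
move=> z cz.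
have [s [b [cs cb sx zE]]] : exists s b, [/\ corner E E s, corner q q b, s * x = x * b & val_rot z = s + b].
  by apply/img_rot00; exists z.
case: (locq.2.2 _ cb) => h; [left | right]; first exact: unit_rot zE h.
apply: (unit_rot _ (E - s) (q - b)) h.
- by apply: corner_add; [exact: corner_id | exact: corner_opp].
- by apply: corner_add; [exact: corner_id | exact: corner_opp].
- by rewrite mulrBl mulrBr cx.1 cx.2 sx.
- by rewrite -[val_rot (rot1 - z)]/(val_rot rot1 - val_rot z) zE /= opprD addrACA.
Qed.

(** Cutting down to the corner of [p] or of [q] is an algebra map on the rotated algebra by
    [in_rot_sum], so a character of the corner extends. *)
Lemma rot_character (e : R) (chi : R -> k) : e * e = e -> (e = p \/ e = q) ->
  (forall (a : k) (y z : R), chi (a *: y + z) = a * chi y + chi z) ->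
  (forall y z, corner e e y -> corner e e z -> chi (y * z) = chi y * chi z) ->
  chi e = 1 -> kalg_morph (fun g : rotation => chi (e * val_rot g * e)).
Proof.
move=> ee hE lin mul c1; split.
  by move=> a g h; rewrite rotationD rotationZ mulrDr mulrDl -scalerAr -scalerAl lin.
split; last first.
  rewrite rot_val1; case: hE => eE; subst e.
    by rewrite !mulrDr pp pq pE !addr0 pp c1.
  by rewrite !mulrDr qq qp qE add0r addr0 qq c1.
move=> g h; rewrite -mul; try exact: corner_sand.
rewrite rotationM; have [h1 _ _ _] := in_rot_sum (rotationP g); have [_ h2 _ _] := in_rot_sum (rotationP h).
congr chi; rewrite !mulrA -(mulrA _ e e) ee; case: hE => eE; subst e.
  by rewrite {1}h1.
by rewrite -!mulrA {1}h2 !mulrA.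
Qed.

End RotatedAlgebra.

(** * The rotated algebra of a minimal family of generators *)

Section Assembly.
Variables (k : fieldType) (L : falgType k) (e1 e2 : L).
Hypothesis loc1 : local_idem e1.
Hypothesis loc2 : local_idem e2.
Hypothesis e12 : e1 * e2 = 0.
Hypothesis e21 : e2 * e1 = 0.
Hypothesis e1D2 : e1 + e2 = 1.
Hypothesis tri : forall z, e2 * z * e1 = 0.
Variables (n : nat) (y : 'I_n -> L).
Hypothesis gen_y : generates e1 e2 y.
Hypothesis min_y : forall u : 'I_n -> L, (forall i, corner e1 e1 (u i)) ->
  \sum_i u i * y i = 0 -> forall i, ~ corner_unit e1 (u i).

Let e11 : e1 * e1 = e1 := loc1.1.
Let e22 : e2 * e2 = e2 := loc2.1.
Local Notation R := (mxalg 'I_n L).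
Let p : R := Rp e1 n.
Let q : R := Rq e2 n.
Let E : R := RE e1 n.
Let x : R := Rx y.
Local Notation io := (emb e1 e2 n : L -> R).

Let lp : local_idem p := Rp_local loc1 loc2 e12 e21 e1D2 tri n.
Let lq : local_idem q := Rq_local loc1 loc2 e12 e21 e1D2 tri n.
Let EE : E * E = E := RE_idem loc1 n.
Let pq : p * q = 0. Proof. by apply: diag_orth => -[i|[]] /=; rewrite ?mul0r ?mulr0. Qed.
Let qp : q * p = 0. Proof. by apply: diag_orth => -[i|[]] /=; rewrite ?mul0r ?mulr0. Qed.
Let pE : p * E = 0. Proof. by apply: diag_orth => -[i|[]] /=; rewrite ?mul0r ?mulr0. Qed.
Let Ep : E * p = 0. Proof. by apply: diag_orth => -[i|[]] /=; rewrite ?mul0r ?mulr0. Qed.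
Let qE : q * E = 0. Proof. by apply: diag_orth => -[i|[]] /=; rewrite ?mul0r ?mulr0. Qed.
Let Eq : E * q = 0. Proof. by apply: diag_orth => -[i|[]] /=; rewrite ?mul0r ?mulr0. Qed.
Let cx : corner E q x := Rx_corner gen_y.1.
Let freeE : free_obj p n (E%:M : 'M_1) := RE_free loc1 e12 e21 tri n.
Let gen_x : forall m, corner p q m -> exists2 u, corner p E u & u * x = m :=
  @Rx_gen _ _ _ _ loc1 loc2 e12 e21 tri _ _ gen_y.1 gen_y.2.
Let min_x : forall u, corner p E u -> u * x = 0 ->
  forall s, corner E p s -> ~ corner_unit p (u * s) :=
  @Rx_min _ _ _ _ loc1 loc2 e12 e21 e1D2 tri _ _ gen_y.1 min_y.

Lemma img_emb b c z : img e1 e2 io b c z <->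
  corner (if b then q else p) (if c then q else p) z.
Proof.
have hd d : io (idem e1 e2 d) = if d then q else p by case: d; rewrite /= ?emb_e1 ?emb_e2.
rewrite -!hd; split=> [[a ca <-]|]; first exact: emb_corner.
by case/(emb_corner_onto loc1 loc2 e12 e21 tri) => a ca <-; exists a.
Qed.

Definition rotated : falgType k := rotation lp lq EE pq qp pE Ep qE Eq cx.
Definition rotated1 : rotated := rot1 lp lq EE pq qp pE Ep qE Eq cx.
Definition rotated2 : rotated := rot2 lp lq EE pq qp pE Ep qE Eq cx.

Let locf1 : local_idem rotated1.
Proof. exact: rot1_local freeE gen_x min_x. Qed.
Let locf2 : local_idem rotated2.
Proof. exact: rot2_local. Qed.
Let trif : forall z, rotated2 * z * rotated1 = 0.
Proof. exact: rot_triangular. Qed.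

Local Notation comparison lem :=
  (lem _ p q E x n lp lq.1 EE Eq qE cx freeE gen_x min_x
    k L e1 e2 loc1 loc2 tri io (emb_is_additive e1 e2 n) (embM loc1 loc2 e1D2 n)
    (@emb_inj _ _ _ _ e1D2 n) (emb_e1 loc1 e12 e21 tri n) (emb_e2 loc2 e12 tri n) img_emb
    rotated rotated1 rotated2 locf1 locf2 trif vsval (fun _ _ => erefl) (fun _ _ => erefl)
    (@rotation_inj _ _ _ _ _ _ lp lq EE pq qp pE Ep qE Eq cx) erefl erefl
    (img_rot00 lp lq EE pq qp pE Ep qE Eq cx) (img_rot01 lp lq EE pq qp pE Ep qE Eq cx)
    (img_rot11 lp lq EE pq qp pE Ep qE Eq cx)).

(** [U] supplies the adjacent cone and [W] the image of the negative of [sigma_plus];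
    [adj_cone_unique] forces [l = n] before the fans are compared. *)
Lemma rotated_fan : gfan e1 e2 (adj_cone n) /\
  forall l, gfan e1 e2 (adj_cone l) -> fan_eq (gfan rotated1 rotated2) (rho l (gfan e1 e2)).
Proof.
have [U [pU _ _ gU fU]] := comparison (@exists_generator_complex).
have [W [pW gW fW]] := comparison (@exists_cogenerator_complex).
have gP : gvec (stalks e1 e2 [::] [:: false]) = (R1, R0).
  by rewrite /gvec /=; congr pair; ring.
have gQ : gvec (stalks rotated1 rotated2 [:: true] [::]) = (R0, Ropp R1).
  by rewrite /gvec /=; congr pair; ring.
have U_cone : gfan e1 e2 (adj_cone n) by apply: (family_gfan fU); rewrite /= gP gU.
have U_ray : gfan e1 e2 (cone_gen [:: (INR n, Ropp R1)]).
  by apply: (family_gfan (family_tail fU)); rewrite /= gU.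
have W_cone : gfan rotated1 rotated2 (cone_gen [:: (R0, Ropp R1); (R1, Ropp (INR n))]).
  by apply: (family_gfan fW); rewrite /= gQ gW.
have W_ray : gfan rotated1 rotated2 (cone_gen [:: (R1, Ropp (INR n))]).
  by apply: (family_gfan (family_tail fW)); rewrite /= gW.
have gvE (Os : seq (cobj e1 e2)) (Ss : seq (cobj rotated1 rotated2)) : size Ss = size Os ->
    (forall i, (i < size Os)%N -> gvec (nth (zero_obj rotated1 rotated2) Ss i) =
       rho_map n (gvec (nth (zero_obj e1 e2) Os i))) ->
    [seq gvec T | T : cobj rotated1 rotated2 <- Ss] = map (rho_map n) [seq gvec T | T : cobj e1 e2 <- Os].
  move=> sz h; apply: (@eq_from_nth _ pt_origin) => [|i]; rewrite !size_map // => hi.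
  have hi' : (i < size Os)%N by rewrite -sz.
  rewrite (nth_map pt_origin) ?size_map // (nth_map (zero_obj e1 e2)) //.
  by rewrite (nth_map (zero_obj rotated1 rotated2)) // h.
have to_G (Os : seq (cobj e1 e2)) : pm_family loc1 loc2 Os ->
  (exists2 Ss : seq (cobj rotated1 rotated2), pm_family locf1 locf2 Ss &
    [seq gvec T | T : cobj rotated1 rotated2 <- Ss] = map (rho_map n) [seq gvec T | T : cobj e1 e2 <- Os]) \/
  (forall i, (i < size [seq gvec T | T : cobj e1 e2 <- Os])%N ->
     nth pt_origin [seq gvec T | T : cobj e1 e2 <- Os] i = (R1, R0) \/
     nth pt_origin [seq gvec T | T : cobj e1 e2 <- Os] i = (INR n, Ropp R1)).
  case=> fO pO; case: (comparison (@family_to_G) fO pO) => [[Ss [fS sz h]]|h]; [left|right].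
    exists Ss; last by apply: gvE => // i /h [].
    by split=> // i; rewrite sz => /h [].
  by move=> i; rewrite size_map => hi; rewrite (nth_map (zero_obj e1 e2)) //; exact: h.
have to_L (Ss : seq (cobj rotated1 rotated2)) : pm_family locf1 locf2 Ss ->
  (exists2 Os : seq (cobj e1 e2), pm_family loc1 loc2 Os &
    [seq gvec T | T : cobj rotated1 rotated2 <- Ss] = map (rho_map n) [seq gvec T | T : cobj e1 e2 <- Os]) \/
  (forall i, (i < size [seq gvec T | T : cobj rotated1 rotated2 <- Ss])%N ->
     nth pt_origin [seq gvec T | T : cobj rotated1 rotated2 <- Ss] i = (R0, Ropp R1) \/
     nth pt_origin [seq gvec T | T : cobj rotated1 rotated2 <- Ss] i = (R1, Ropp (INR n))).
  case=> fS pS; case: (comparison (@family_to_L) fS pS) => [[Os [fO sz h]]|h]; [left|right].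
    exists Os; last by apply: gvE => // i; rewrite sz => /h [].
    by split=> // i; rewrite sz => /h [].
  by move=> i; rewrite size_map => hi; rewrite (nth_map (zero_obj rotated1 rotated2)) //; exact: h.
split=> // l hl.
have -> : l = n by apply: (adj_cone_unique tri trif to_G).
exact: (gfan_rotation tri trif to_G to_L).
Qed.

Lemma rotated_cpoi : cpoi rotated1 rotated2.
Proof.
split; first exact: local_primitive locf1.
split; first exact: local_primitive locf2.
by split; [exact: rot_orth12 | split; [exact: rot_orth21 | exact: rot_complete]].
Qed.

(** An isomorphism of the two projectives would need a nonzero element in the corner that vanishes
    by triangularity. *)
Lemma rotated_rank2 : rank2 rotated1 rotated2.
Proof.
move=> [a [b [ea [_ [ba _]]]]]; apply: locf1.2.1.
by rewrite -ba ea trif mulr0.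
Qed.

Lemma rotated_character b (mu : L -> k) : kalg_morph mu -> mu (idem e1 e2 b) = 1 ->
  kalg_morph (fun g : rotated =>
    mu (ent ((if b then q else p) * vsval g * (if b then q else p)) (inr b) (inr b))).
Proof.
move=> hmu mub.
have eE : io (idem e1 e2 b) = if b then q else p by case: b {mub}; rewrite /= ?emb_e1 ?emb_e2.
have lb := idem_local loc1 loc2 b.
have entK a : corner (idem e1 e2 b) (idem e1 e2 b) a -> ent (io a) (inr b) (inr b) = a.
  by rewrite ent_emb => /corner_eq.
rewrite -!eE.
apply: (@rot_character _ _ _ _ _ _ lp lq EE pq qp pE Ep qE Eq cx _
  (fun r : R => mu (ent r (inr b) (inr b)))).
- by rewrite -embM // lb.1.
- by rewrite eE; case: b {mub eE lb entK}; [right | left].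
- by move=> a s t; rewrite entD entZ hmu.1.
- move=> s t /(emb_corner_onto loc1 loc2 e12 e21 tri) [a ca <-].
  move=> /(emb_corner_onto loc1 loc2 e12 e21 tri) [c cc <-].
  by rewrite -embM // !entK ?hmu.2.1 //; apply: corner_mul cc.
- by rewrite entK //; apply: corner_id; exact: lb.1.
Qed.

(** The labels switch: the first idempotent contains [q], so its character comes from [e2], while
    the second is [p] and takes its character from [e1]. *)
Lemma rotated_elementary : elementary L -> elementary rotated.
Proof.
move=> el.
have [mu1 h1 m1] := elementary_character loc1 loc2 tri e1D2 false el.
have [mu2 h2 m2] := elementary_character loc1 loc2 tri e1D2 true el.
apply: (elementary_of_characters locf1 locf2 trif (rot_orth12 _ _ _ _ _ _ _ _ _ _)
  (rot_orth21 _ _ _ _ _ _ _ _ _ _) (rot_complete _ _ _ _ _ _ _ _ _ _)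
  (@rotated_character true _ h2 m2) (@rotated_character false _ h1 m1)) => /=.
  rewrite mulrDr qE add0r !lq.1 -[q](emb_e2 loc2 e12 tri) ent_emb /= e22 e22.
  exact: m2.
by rewrite !lp.1 -[p](emb_e1 loc1 e12 e21 tri) ent_emb /= e11 e11.
Qed.

End Assembly.

Theorem theorem4p6 (k : fieldType) (L : falgType k) (e1 e2 : L) :
  cpoi e1 e2 -> (forall x : L, e2 * x * e1 = 0) ->
  exists (G : falgType k) (f1 f2 : G),
    cpoi f1 f2 /\ rank2 f1 f2 /\
    (exists l : nat, gfan e1 e2 (adj_cone l)) /\
    (forall l : nat, gfan e1 e2 (adj_cone l) ->
       fan_eq (gfan f1 f2) (rho l (gfan e1 e2))) /\
    (elementary L -> elementary G).
Proof.
move=> [prim1 [prim2 [e12 [e21 e1D2]]]] tri.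
have loc1 := primitive_local prim1; have loc2 := primitive_local prim2.
have [n [y [gen_y min_y]]] := exists_minimal_generators loc1 loc2.1.
have [adj fan] := rotated_fan loc1 loc2 e12 e21 e1D2 tri gen_y min_y.
exists (rotated loc1 loc2 e12 e21 e1D2 tri gen_y),
  (rotated1 loc1 loc2 e12 e21 e1D2 tri gen_y), (rotated2 loc1 loc2 e12 e21 e1D2 tri gen_y).
split; first exact: rotated_cpoi min_y.
split; first exact: rotated_rank2 min_y.
split; first by exists n.
split=> //; exact: rotated_elementary min_y.
Qed.
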